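(* Let $L$ be a good virtual link diagram with $n$ classical crossings, representing a virtual link which has no split diagrams. Then any virtual link diagram $L'$ equivalent to $L$ has at least $n-2$ classical crossings. (All virtual link diagrams considered, in particular $L$ and $L'$, are assumed to have orientable atoms.)
   Context: A virtual link diagram is a generic immersion of circles in the plane with each double point marked either as a classical crossing (with over/under information) or as a virtual crossing. Two diagrams are equivalent if they are related by planar isotopy, the classical Reidemeister moves and the virtual moves, i.e. the detour move (an arc containing only virtual crossings may be replaced by any other arc with the same endpoints all of whose new crossings are virtual). A virtual link is an equivalence class of diagrams. Smoothings: each classical crossing has two smoothings. The $A$-smoothing joins the two local regions swept out when the overcrossing strand is rotated counterclockwise towards the undercrossing strand, and the $B$-smoothing is the other one. Smoothing all classical crossings (virtual crossings are ignored) gives a collection of closed curves, called the circles of the state. The $A$-state (resp. $B$-state) is the state with all $A$- (resp. all $B$-) smoothings. Atom: given a virtual diagram $L$, let $\Gamma$ be the abstract 4-valent graph whose vertices are the classical crossings and whose edges are the arcs of $L$ connecting classical crossings (virtual crossings are ignored; a component without classical crossings gives a circle component of $\Gamma$). The atom of $L$ is the closed surface obtained from $\Gamma$ by attaching a 2-cell along every circle of the $A$-state and every circle of the $B$-state. The diagram is orientable (in the sense of atoms) if this surface is orientable. A diagram is split if its graph $\Gamma$ is disconnected. A diagram is good if no 2-cell of its atom touches itself at a crossing. Equivalently, in the $A$-state the two arcs appearing at the smoothing of each classical crossing belong to two different circles, and the same holds for the $B$-state. *)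

(* Defs.v *)
From Stdlib Require Import Relation_Operators.
From HB Require Import structures.
From mathcomp Require Import all_boot.

Set Implicit Arguments.
Unset Strict Implicit.
Unset Printing Implicit Defensive.

(** A generic immersion of circles in the plane, with its double points marked,
    is encoded by its planar diagram code, as a planar combinatorial map.  The
    edges of the diagram are labelled by natural numbers and a node lists the
    labels of the edges arriving at it in counterclockwise order.
    - [Cross a b c d]: a classical crossing; [a], [c] are the two ends of the
      undercrossing strand and [b], [d] those of the overcrossing strand.
    - [Virt a b c d]: a virtual crossing of the strands [a]-[c] and [b]-[d].
    - [Point a b]: a marked point in the interior of an edge.  It carries no
      information; marked points are added and erased by planar isotopies, and
      are also used to encode closed curves without crossings ([Point a a]). *)
Inductive node :=
| Cross of nat & nat & nat & nat
| Virt of nat & nat & nat & nat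
| Point of nat & nat.

Definition legs (v : node) : seq nat :=
  match v with
  | Cross a b c d | Virt a b c d => [:: a; b; c; d]
  | Point a b => [:: a; b]
  end.

Definition node_code (v : node) : bool * seq nat :=
  (if v is Cross _ _ _ _ then true else false, legs v).

Definition node_decode (u : bool * seq nat) : option node :=
  match u with
  | (true, [:: a; b; c; d]) => Some (Cross a b c d)
  | (false, [:: a; b; c; d]) => Some (Virt a b c d)
  | (_, [:: a; b]) => Some (Point a b)
  | _ => None
  end.

Lemma node_codeK : pcancel node_code node_decode.
Proof. by case. Qed.

HB.instance Definition _ := Equality.copy node (pcan_type node_codeK).

Definition is_classical (v : node) : bool :=
  if v is Cross _ _ _ _ then true else false.

Definition relabel (f : nat -> nat) (v : node) : node :=
  match v with
  | Cross a b c d => Cross (f a) (f b) (f c) (f d)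
  | Virt a b c d => Virt (f a) (f b) (f c) (f d)
  | Point a b => Point (f a) (f b)
  end.

Definition code := seq node.

Definition labels (D : code) : seq nat := flatten (map legs D).

Definition each_label_twice (D : code) : bool :=
  all (fun x => count_mem x (labels D) == 2) (labels D).

(** The darts (half-edges) of a code: pairs of a node and one of its legs. *)
Definition node_at (D : code) (i : 'I_(size D)) : node := tnth (in_tuple D) i.

Definition dart (D : code) : finType :=
  {i : 'I_(size D) & 'I_(size (legs (node_at i)))}.

Definition dnode (D : code) (x : dart D) : node := node_at (tag x).

Definition dlabel (D : code) (x : dart D) : nat :=
  nth 0 (legs (dnode x)) (tagged x).

(** The other end of the edge of [x]; meaningful under [each_label_twice]. *)
Definition edge (D : code) (x : dart D) : dart D :=
  odflt x [pick y | (y != x) && (dlabel y == dlabel x)].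

(** The counterclockwise successor of [x] around its node. *)
Definition turn (D : code) (x : dart D) : dart D :=
  Tagged (fun i => 'I_(size (legs (node_at i)))) (ordS (tagged x)).

Definition face (D : code) (x : dart D) : dart D := edge (turn x).

Definition map_adj (D : code) : rel (dart D) :=
  [rel x y | (y == edge x) || (y == turn x)].

(** Euler's formula [V - E + F = 2 C]; as [#|dart D| = 2 E], it is stated in the
    form [2 C + 2 E = E + V + F]. *)
Definition planar (D : code) : bool :=
  2 * n_comp (@map_adj D) (dart D) + #|dart D| ==
  fcard (@edge D) (dart D) + fcard (@turn D) (dart D)
    + fcard (@face D) (dart D).

Record vdiagram := VDiagram {
  vcode :> code;
  vcode_wf : each_label_twice vcode;
  vcode_planar : planar vcode
}.

Definition crossings (D : vdiagram) : nat := count is_classical (vcode D).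

(** Two codes of planar isotopic diagrams.  Codes do not record how the connected
    pieces of the plane diagram are nested, nor which face is unbounded; both are
    changed at will by detours along which no crossing is met. *)
Inductive isotopy : code -> code -> Prop :=
| iso_perm D D' : perm_eq D D' -> isotopy D D'
| iso_relabel f D : injective f -> isotopy D (map (relabel f) D)
| iso_rot_cross a b c d D :
    isotopy (Cross a b c d :: D) (Cross c d a b :: D)
| iso_rot_virt a b c d D : isotopy (Virt a b c d :: D) (Virt b c d a :: D)
| iso_rot_point a b D : isotopy (Point a b :: D) (Point b a :: D)
| iso_erase_point a b D : a != b ->
    isotopy (Point a b :: D)
            (map (relabel (fun x => if x == b then a else x)) D).

(** In [R3_left] and [R3_right] the strand [t] passes over the two others, [m] over
    [b]; the indices 0 and 3 are the ends of the strands on the boundary of the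
    disc.  In [R3_left] (resp. [R3_right]) the sides of the triangle are met in the
    order [t], [m], [b] counterclockwise (resp. clockwise). *)
Inductive reidemeister : code -> code -> Prop :=
| R1_left a b c D :
    reidemeister (Cross a a b c :: D) (Point b c :: D)
| R1_right a b c D :
    reidemeister (Cross b a a c :: D) (Point b c :: D)
| R2 u0 u1 u2 o0 o1 o2 D :
    reidemeister [:: Cross u0 o0 u1 o1, Cross u1 o2 u2 o1 & D]
                 [:: Point u0 u2, Point o0 o2 & D]
| R3_left t0 t1 t2 t3 m0 m1 m2 m3 b0 b1 b2 b3 D :
    reidemeister
      [:: Cross b1 m1 b3 m3, Cross b0 t1 b1 t0, Cross m0 t3 m1 t1 & D]
      [:: Cross b0 m0 b2 m2, Cross b2 t3 b3 t2, Cross m2 t2 m3 t0 & D]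
| R3_right t0 t1 t2 t3 m0 m1 m2 m3 b0 b1 b2 b3 D :
    reidemeister
      [:: Cross b1 m3 b3 m1, Cross b0 t3 b1 t1, Cross m0 t1 m1 t0 & D]
      [:: Cross b0 m2 b2 m0, Cross b2 t2 b3 t0, Cross m2 t3 m3 t2 & D].

(** [draw_arc z a D D']: in [D] the edges [a] and [z] have a loose end, and [D'] is
    obtained from [D] by drawing an arc from the loose end of [a] to that of [z]
    all of whose crossings, including those with itself, are virtual.  The arc
    crosses an edge, in either direction, at a marked point of that edge. *)
Inductive draw_arc (z : nat) : nat -> code -> code -> Prop :=
| arc_stop a D : draw_arc z a D (Point a z :: D)
| arc_point a x D D' :
    draw_arc z x (Point a x :: D) D' -> draw_arc z a D D'
| arc_cross a x c d D D' :
    draw_arc z x (Virt a c x d :: D) D' -> draw_arc z a (Point c d :: D) D'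
| arc_cross_rev a x c d D D' :
    draw_arc z x (Virt a d x c :: D) D' -> draw_arc z a (Point c d :: D) D'
| arc_perm a D1 D2 D' :
    perm_eq D1 D2 -> draw_arc z a D2 D' -> draw_arc z a D1 D'.

Definition detour (D D' : code) : Prop :=
  exists a z E, draw_arc z a E D /\ draw_arc z a E D'.

(** All the codes met along an equivalence are those of plane diagrams, as the
    relation is on [vdiagram]. *)
Definition move (D D' : vdiagram) : Prop :=
  [\/ isotopy D D', reidemeister D D' | detour D D'].

Definition equivalent : vdiagram -> vdiagram -> Prop :=
  clos_refl_sym_trans vdiagram move.

Inductive smoothing := Asm | Bsm.

(** The dart joined to [x] at its node in the [A]-state or the [B]-state.  At
    [Cross a b c d], rotating the overcrossing strand [b]-[d] counterclockwise sweeps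
    out the regions between [b] and [c] and between [d] and [a]; joining them
    leaves the arcs [a]-[b] and [c]-[d]. *)
Definition smooth (s : smoothing) (D : code) (x : dart D) : dart D :=
  let k := tagged x in
  Tagged (fun i => 'I_(size (legs (node_at i))))
    (match dnode x, s with
     | Cross _ _ _ _, Asm => if odd k then ord_pred k else ordS k
     | Cross _ _ _ _, Bsm => if odd k then ordS k else ord_pred k
     | Virt _ _ _ _, _ => ordS (ordS k)
     | Point _ _, _ => ordS k
     end).

Definition state_adj (s : smoothing) (D : code) : rel (dart D) :=
  [rel x y | (y == edge x) || (y == smooth s x)].

Definition same_circle (s : smoothing) (D : code) : rel (dart D) :=
  connect (@state_adj s D).

(** The arcs of the smoothing of a crossing are the pairs [{x, smooth s x}]. *)
Definition good (D : vdiagram) : Prop :=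
  forall (s : smoothing) (x y : dart D),
    is_classical (dnode x) -> tag x = tag y -> y != x -> y != smooth s x ->
    ~~ same_circle s x y.

(** The connected components of the 4-valent graph: edges ending at the same
    classical crossing are adjacent, and a strand goes straight through a virtual
    crossing, where [smooth] does not depend on the state. *)
Definition graph_adj (D : code) : rel (dart D) :=
  [rel x y | [|| y == edge x, y == smooth Asm x
               | is_classical (dnode x) && (tag y == tag x)]].

Definition split_diagram (D : vdiagram) : Prop :=
  exists x y : dart D, ~~ connect (@graph_adj D) x y.

(** An orientation of all the 2-cells attached along the circles of a state, given
    by the induced orientations of the circles: [o x] holds when the circle through
    [x] runs along [x] away from the node of [x]. *)
Definition cell_orientation (s : smoothing) (D : code) (o : dart D -> bool) :=
  forall x, o (edge x) = ~~ o x /\ o (smooth s x) = ~~ o x.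

(** Every edge of the graph is on the boundary of one [A]-cell and one [B]-cell.  The
    surface is orientable if its 2-cells can be oriented so that the two cells
    along each edge induce opposite orientations on it. *)
Definition orientable (D : vdiagram) : Prop :=
  exists oA oB : dart D -> bool,
    [/\ cell_orientation Asm oA, cell_orientation Bsm oB
      & forall x, oA x = ~~ oB x].

(* Main.v *)
(** Following Lickorish's treatment of adequate classical links, we bound the crossing number
    with the Kauffman brackets of cables.  For a diagram with [x] crossings and [f] framing
    curls, all of the sign for which the [A]-smoothing of a kink splits off a circle, the
    degree of the bracket in [A] is at most [x + 2 k + 3 f], where [k] is the number of
    circles of the [A]-state, with equality if the diagram is [A]-adequate.  The 2-cable of
    an adequate diagram is adequate; iterating [r] times multiplies [x + f] by [4^r] up to a
    term of order [2^r], and [k] by at most [2^r].  For [r] large the leading terms show that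
    [x + f] is minimal at an [A]-adequate diagram among its regularly isotopic diagrams.
    An equivalence of diagrams becomes a regular isotopy once curls are added to both of
    them.  The difference between the numbers of curls added is the change of writhe, which
    is opposite for the mirror image, that is for the [B]-state.  Hence it cancels in
    the sum of the inequalities obtained from the two states. *)

From HB Require Import structures.
Require Import Defs.
From mathcomp Require Import all_boot all_order all_algebra.
From mathcomp Require Import zify ring lra.

Set Implicit Arguments.
Unset Strict Implicit.
Unset Printing Implicit Defensive.

Import Order.TTheory GRing.Theory Num.Theory.

(** Nothing planar survives in a tangle: a virtual crossing becomes two [Join]s, so that the virtual
    moves cost nothing, and an equivalence becomes a rewriting of finite lists of named vertices.
    The price is that the invariance of the 2-cable, usually read off a picture, has to be proved
    rule by rule. It is settled by computation: each rule comes with an explicit derivation between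
    its doubled sides. The same device shows that a curl can be added on both sides of a rule. No
    Laurent polynomial occurs: degrees are compared through the values of the bracket at one large
    rational [A]. The double of a curl has two crossings and two curls, so that each doubling
    multiplies [x + f] by exactly 4. Curls cannot pass from one component of a link to another.
    Hence the places of the added curls are never prescribed: two diagrams are compared by the
    numbers of curls put somewhere on each of them, and different comparisons of one diagram are
    reconciled by adding still more curls. *)

(* A tangle gives a name to every end of an edge.  In a closed tangle each name occurs
   once at a vertex [Xing], [Curl] or [Join] and once at an edge [Arc].  [Xing a b c d]
   follows the conventions of [Cross]; [Join] is a trivial vertex of valency 2; [Curl]
   is one that carries a unit of framing, with the bracket of a positive kink. *)
Inductive vertex :=
| Xing of nat & nat & nat & nat
| Curl of nat & nat
| Join of nat & nat
| Arc of nat & nat.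

Definition vertex_code (v : vertex) : nat * seq nat :=
  match v with
  | Xing a b c d => (0, [:: a; b; c; d])
  | Curl a b => (1, [:: a; b])
  | Join a b => (2, [:: a; b])
  | Arc a b => (3, [:: a; b])
  end.

Definition vertex_decode (u : nat * seq nat) : option vertex :=
  match u with
  | (0, [:: a; b; c; d]) => Some (Xing a b c d)
  | (1, [:: a; b]) => Some (Curl a b)
  | (2, [:: a; b]) => Some (Join a b)
  | (3, [:: a; b]) => Some (Arc a b)
  | _ => None
  end.

Lemma vertex_codeK : pcancel vertex_code vertex_decode.
Proof. by case. Qed.

HB.instance Definition _ := Equality.copy vertex (pcan_type vertex_codeK).

Definition tangle := seq vertex.

Definition vnode (v : vertex) : seq nat :=
  match v with
  | Xing a b c d => [:: a; b; c; d]
  | Curl a b | Join a b => [:: a; b]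
  | Arc _ _ => [::]
  end.

Definition varc (v : vertex) : seq nat := if v is Arc a b then [:: a; b] else [::].

Definition nodes (T : tangle) : seq nat := flatten (map vnode T).
Definition arcs (T : tangle) : seq nat := flatten (map varc T).
Definition names (T : tangle) : seq nat := nodes T ++ arcs T.

Definition wf (T : tangle) : bool := uniq (nodes T) && perm_eq (nodes T) (arcs T).

Definition vmap (g : nat -> nat) (v : vertex) : vertex :=
  match v with
  | Xing a b c d => Xing (g a) (g b) (g c) (g d)
  | Curl a b => Curl (g a) (g b)
  | Join a b => Join (g a) (g b)
  | Arc a b => Arc (g a) (g b)
  end.

Definition tmap (g : nat -> nat) : tangle -> tangle := map (vmap g).

Lemma nodes_cat T U : nodes (T ++ U) = nodes T ++ nodes U.
Proof. by rewrite /nodes map_cat flatten_cat. Qed.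

Lemma arcs_cat T U : arcs (T ++ U) = arcs T ++ arcs U.
Proof. by rewrite /arcs map_cat flatten_cat. Qed.

Lemma nodes_map g T : nodes (tmap g T) = map g (nodes T).
Proof. by elim: T => //= v T; rewrite /nodes /= map_cat => ->; case: v. Qed.

Lemma arcs_map g T : arcs (tmap g T) = map g (arcs T).
Proof. by elim: T => //= v T; rewrite /arcs /= map_cat => ->; case: v. Qed.

Lemma tmap_comp g h T : tmap g (tmap h T) = tmap (g \o h) T.
Proof. by rewrite /tmap -map_comp; apply: eq_map; case. Qed.

Lemma eq_in_tmap g h T : {in names T, g =1 h} -> tmap g T = tmap h T.
Proof.
elim: T => //= v T IH E; rewrite IH; last first.
  by move=> x; rewrite mem_cat => xT; apply: E; rewrite mem_cat /nodes /arcs /= !mem_cat;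
    case/orP: xT => ->; rewrite !orbT.
congr cons; case: v E => [a b c d|a b|a b|a b] E /=; rewrite !E //;
  by rewrite mem_cat /nodes /arcs /= !inE eqxx ?orbT.
Qed.

Lemma tmap_id T : tmap id T = T.
Proof. by rewrite /tmap (eq_map (g := id)) ?map_id //; case. Qed.

Lemma perm_nodes T U : perm_eq T U -> perm_eq (nodes T) (nodes U).
Proof. by move=> h; apply/perm_flatten/perm_map. Qed.

Lemma perm_arcs T U : perm_eq T U -> perm_eq (arcs T) (arcs U).
Proof. by move=> h; apply/perm_flatten/perm_map. Qed.

Lemma perm_wf T U : perm_eq T U -> wf T = wf U.
Proof.
move=> h; rewrite /wf (perm_uniq (perm_nodes h)).
by rewrite (permPl (perm_nodes h)) (permPr (perm_arcs h)).
Qed.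

(** * Merging names *)

(* The [let]s make evaluation by [vm_compute] linear in the number of gluings. *)
Definition glue (f : nat -> nat) (p : nat * nat) : nat -> nat :=
  let a := f p.1 in let b := f p.2 in fun z => let c := f z in if c == b then a else c.

Lemma glueE f p z : glue f p z = if f z == f p.2 then f p.1 else f z.
Proof. by []. Qed.

Fixpoint glues (f : nat -> nat) (ps : seq (nat * nat)) : nat -> nat :=
  if ps is p :: ps' then glues (glue f p) ps' else f.

(** The size of a spanning forest of the graph with edges [ps] on the values of [f]. The circles of
    a state are counted as the number of names minus this rank. *)
Fixpoint rank (f : nat -> nat) (ps : seq (nat * nat)) : nat :=
  if ps is p :: ps' then (f p.1 != f p.2) + rank (glue f p) ps' else 0.

Definition ends (ps : seq (nat * nat)) : seq nat := flatten [seq [:: p.1; p.2] | p <- ps].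

(** The representatives that [glue] keeps depend on the order of the gluings; only the induced
    partition is meaningful, so labellings are compared by their kernels. *)
Definition same_kernel (L : seq nat) (f g : nat -> nat) :=
  {in L &, forall x y, (f x == f y) = (g x == g y)}.

Lemma glue_eq f p z w :
  (glue f p z == glue f p w) =
  (f z == f w) || ((f z == f p.1) || (f z == f p.2)) && ((f w == f p.1) || (f w == f p.2)).
Proof.
rewrite ?glueE; case: (f z =P f p.2) => [->|/eqP nz]; case: (f w =P f p.2) => [->|/eqP nw].
- by rewrite !eqxx.
- by rewrite orbT /= orbF [f p.1 == f w]eq_sym [f p.2 == _]eq_sym (negbTE nw).
- by rewrite (negbTE nz) /= orbT orbF andbT.
- case: (f z =P f w) => //= nzw; rewrite !orbF; apply/esym/negbTE/negP => /andP[/eqP e1 /eqP e2].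
  by case: nzw; rewrite e1 e2.
Qed.

Lemma same_kernel_glue L f g p :
  p.1 \in L -> p.2 \in L -> same_kernel L f g -> same_kernel L (glue f p) (glue g p).
Proof. by move=> h1 h2 E x y hx hy; rewrite !glue_eq !E. Qed.

Lemma rank_kernel L f g ps :
  {subset ends ps <= L} -> same_kernel L f g -> rank f ps = rank g ps.
Proof.
elim: ps f g => //= p ps IH f g sub E.
have h1 : p.1 \in L by apply: sub; rewrite inE eqxx.
have h2 : p.2 \in L by apply: sub; rewrite !inE eqxx orbT.
rewrite (E _ _ h1 h2); congr addn; apply: IH; last exact: same_kernel_glue.
by move=> x hx; apply: sub; rewrite !inE hx !orbT.
Qed.

Lemma rank_cat f ps qs : rank f (ps ++ qs) = rank f ps + rank (glues f ps) qs.
Proof. by elim: ps f => //= p ps IH f; rewrite IH addnA. Qed.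

Ltac case_eqs :=
  repeat match goal with
  | |- context [?x == ?y] =>
      is_var x; is_var y; let e := fresh in
      case: (eqVneq x y) => e; [subst|]; rewrite ?eqxx //=
  end;
  repeat match goal with H : is_true (_ != _) |- _ => move/eqP: H => H end; congruence.

Lemma same_kernel_swap L f p q :
  same_kernel L (glue (glue f p) q) (glue (glue f q) p).
Proof.
move=> x y _ _; rewrite !glue_eq.
move: (f p.1) (f p.2) (f q.1) (f q.2) (f x) (f y) => a b c d u v.
case_eqs.
Qed.

Lemma rank_swap f p q ps : rank f (p :: q :: ps) = rank f (q :: p :: ps).
Proof.
rewrite /= (rank_kernel (fun _ h => h) (same_kernel_swap (L := ends ps) f p q)).
rewrite !addnA; congr addn; rewrite !glue_eq.
move: (f p.1) (f p.2) (f q.1) (f q.2) => a b c d.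
case_eqs.
Qed.

(** Two neighbouring gluings commute up to kernel, and the rank depends only on the kernel; moving
    one pair to the front does the rest. *)
Lemma rank_perm f ps qs : perm_eq ps qs -> rank f ps = rank f qs.
Proof.
have mid p s1 s2 g : rank g (s1 ++ p :: s2) = rank g (p :: s1 ++ s2).
  by elim: s1 g => // q s1 IH g; rewrite rank_swap cat_cons /= IH.
elim: ps f qs => [|p ps IH] f qs h; first by case: qs h => // q qs /perm_size.
have pq : p \in qs by rewrite -(perm_mem h) inE eqxx.
case/splitPr: pq h => s1 s2 h; rewrite mid /=; congr addn; apply: IH.
by rewrite -(perm_cons p) (permPl h) perm_catC /= perm_cons perm_catC.
Qed.

Lemma glues_mem f ps z : glues f ps z \in f z :: map f (ends ps).
Proof.
elim: ps f => [|p ps IH] f /=; first by rewrite inE.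
have hm w : glue f p w \in [:: f w; f p.1] by rewrite ?glueE; case: ifP; rewrite !inE eqxx ?orbT.
have := IH (glue f p); rewrite !inE => /orP[/eqP ->|/mapP[w hw ->]].
  by have := hm z; rewrite !inE => /orP[]/eqP->; rewrite eqxx ?orbT.
have := hm w; rewrite !inE => /orP[]/eqP->; rewrite ?eqxx ?orbT //.
by rewrite (map_f f hw) !orbT.
Qed.

Lemma glues_le (f : nat -> nat) ps x y : f x == f y -> glues f ps x == glues f ps y.
Proof.
elim: ps f => //= p ps IH f e; apply: IH.
by rewrite glue_eq e.
Qed.

Lemma glues_pair f ps p : p \in ps -> glues f ps p.1 == glues f ps p.2.
Proof.
elim: ps f => //= q ps IH f; rewrite inE => /orP[/eqP <-|/IH //].
by apply: glues_le; rewrite glue_eq !eqxx !orbT.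
Qed.

(* [glues id ps] is the finest labelling constant on the pairs of [ps]. *)
Lemma glues_finest (S : eqType) (c : nat -> S) ps x y :
  {in ps, forall p, c p.1 = c p.2} -> glues id ps x == glues id ps y -> c x = c y.
Proof.
move=> hc; suff gen f : (forall u v, f u == f v -> c u = c v) ->
    forall u v, glues f ps u == glues f ps v -> c u = c v.
  by apply: gen => u v /eqP ->.
elim: ps hc f => //= p ps IH hc f hf u v; apply: IH => {u v}.
  by move=> q hq; apply: hc; rewrite inE hq orbT.
move=> u v; have hp : c p.1 = c p.2 by apply: hc; rewrite inE eqxx.
rewrite glue_eq => /orP[/hf //|/andP[/orP[]/hf hu /orP[]/hf hv]];
  by rewrite hu hv ?hp.
Qed.

(** Counting a pair last rather than first shows its contribution relative to all the other gluings;
    this is how a pair is later seen to be redundant. *)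
Lemma rank_rcons f ps p :
  rank f (p :: ps) = rank f ps + (glues f ps p.1 != glues f ps p.2).
Proof.
rewrite (@rank_perm f (p :: ps) (ps ++ [:: p])) ?rank_cat /= ?addn0 //.
by rewrite perm_sym perm_catC.
Qed.

Definition classes (f : nat -> nat) (L : seq nat) : nat := size (undup (map f L)).

Lemma rank_classes L f ps :
  {subset ends ps <= L} -> classes f L = rank f ps + classes (glues f ps) L.
Proof.
elim: ps f => //= p ps IH f sub.
have h1 : p.1 \in L by apply: sub; rewrite inE eqxx.
have h2 : p.2 \in L by apply: sub; rewrite !inE eqxx orbT.
have sub' : {subset ends ps <= L} by move=> x hx; apply: sub; rewrite !inE hx !orbT.
rewrite -addnA -IH // /classes.
case: (f p.1 =P f p.2) => [e|/eqP ne] /=.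
  rewrite (@eq_map _ _ (glue f p) f) // => z; rewrite ?glueE e.
  by case: ifP => // /eqP ->.
(* An effective gluing loses exactly one value, namely [f p.2]. *)
have hu : uniq (f p.2 :: undup (map (glue f p) L)).
  rewrite /= undup_uniq andbT mem_undup; apply/mapP => -[z _].
  by rewrite ?glueE; case: (f z =P f p.2) ne => [_ ne e|nz _ e]; [rewrite e eqxx in ne | case: nz].
rewrite add1n -[_.+1]/(size (f p.2 :: undup (map (glue f p) L))).
apply/perm_size/uniq_perm => //; first exact: undup_uniq.
move=> u; rewrite inE !mem_undup; apply/mapP/orP.
  move=> [z hz ->]; case: (f z =P f p.2) => [_|nz]; [by left|right].
  by apply/mapP; exists z => //; rewrite ?glueE; case: eqP.
case=> [/eqP ->|/mapP[z hz ->]]; first by exists p.2.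
by rewrite ?glueE; case: ifP => _; [exists p.1|exists z].
Qed.

Lemma rank_map f g ps : rank f [seq (g p.1, g p.2) | p <- ps] = rank (f \o g) ps.
Proof. by elim: ps f => //= p ps IH f; rewrite IH. Qed.

(** * Moves *)

(* Reversal of arcs, joins and curls, rotation of a crossing, fusion of two arcs; the
   second and the two third Reidemeister moves; a positive kink is a curl, a negative kink
   absorbs a curl; a curl passes under and over a crossing.  The rules never create names,
   so that applying them in a context needs no freshness condition. *)
Definition rules : seq (tangle * tangle) := [::
  ([:: Arc 0 1], [:: Arc 1 0]);
  ([:: Join 0 1], [:: Join 1 0]);
  ([:: Curl 0 1], [:: Curl 1 0]);
  ([:: Xing 0 1 2 3], [:: Xing 2 3 0 1]);
  ([:: Arc 0 1; Join 1 2; Arc 2 3], [:: Arc 0 3]);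
  ([:: Xing 0 1 2 3; Xing 4 5 6 7; Arc 2 4; Arc 3 7], [:: Join 0 6; Join 1 5]);
  ([:: Xing 6 8 1 3; Xing 0 10 7 4; Xing 2 5 9 11; Arc 6 7; Arc 8 9; Arc 10 11],
   [:: Xing 0 2 6 8; Xing 7 5 1 10; Xing 9 11 3 4; Arc 6 7; Arc 8 9; Arc 10 11]);
  ([:: Xing 6 3 1 8; Xing 0 5 7 10; Xing 2 11 9 4; Arc 6 7; Arc 8 9; Arc 10 11],
   [:: Xing 0 8 6 2; Xing 7 10 1 4; Xing 9 5 3 11; Arc 6 7; Arc 8 9; Arc 10 11]);
  ([:: Xing 0 1 2 3; Arc 0 1], [:: Curl 2 3]);
  ([:: Xing 0 1 2 3; Arc 1 2; Arc 3 4; Curl 4 5], [:: Join 0 5]);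
  ([:: Curl 0 1; Arc 1 2; Xing 2 3 4 5], [:: Xing 0 3 1 5; Arc 1 2; Curl 2 4]);
  ([:: Curl 0 1; Arc 1 2; Xing 3 2 4 5], [:: Xing 3 0 4 1; Arc 1 2; Curl 2 5])].

Inductive tstep : tangle -> tangle -> Prop :=
| ts_perm T U : wf T -> perm_eq T U -> tstep T U
| ts_rename g T : wf T -> {in nodes T &, injective g} -> tstep T (tmap g T)
| ts_rule r g G : r \in rules -> wf (tmap g r.1 ++ G) ->
    tstep (tmap g r.1 ++ G) (tmap g r.2 ++ G).

Definition teq := Relation_Operators.clos_refl_sym_trans tangle tstep.

Lemma teq_refl T : teq T T. Proof. exact: Relation_Operators.rst_refl. Qed.
Lemma teq_sym T U : teq T U -> teq U T. Proof. exact: Relation_Operators.rst_sym. Qed.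
Lemma teq_trans U T V : teq T U -> teq U V -> teq T V.
Proof. exact: Relation_Operators.rst_trans. Qed.
Lemma teq_step T U : tstep T U -> teq T U. Proof. exact: Relation_Operators.rst_step. Qed.

Lemma teq_perm T U : wf T -> perm_eq T U -> teq T U.
Proof. by move=> *; apply/teq_step/ts_perm. Qed.

Definition internal (T : tangle) (x : nat) : bool := (x \in nodes T) && (x \in arcs T).

(** The names [I] erased by a rule leave the vertices and the arcs together, which preserves [wf].
    The bound 12 lets the names of a context be moved out of the way of those of the rule. *)
Definition rule_ok (r : tangle * tangle) : bool :=
  let I := [seq x <- nodes r.1 | x \notin nodes r.2] in
  [&& perm_eq (nodes r.1) (nodes r.2 ++ I), perm_eq (arcs r.1) (arcs r.2 ++ I),
      uniq (nodes r.1), uniq (arcs r.1) & all (ltn^~ 12) (names r.1 ++ names r.2)].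

Lemma rules_ok : all rule_ok rules.
Proof. by vm_compute. Qed.

Lemma wf_drop T U G I :
  perm_eq (nodes T) (nodes U ++ I) -> perm_eq (arcs T) (arcs U ++ I) ->
  wf (T ++ G) -> wf (U ++ G).
Proof.
rewrite /wf !nodes_cat !arcs_cat => hn ha /andP[u p].
have hn' : perm_eq (nodes T ++ nodes G) (I ++ (nodes U ++ nodes G)).
  by rewrite (permPl (perm_cat hn (perm_refl _))) catA perm_cat2r perm_catC.
have ha' : perm_eq (arcs T ++ arcs G) (I ++ (arcs U ++ arcs G)).
  by rewrite (permPl (perm_cat ha (perm_refl _))) catA perm_cat2r perm_catC.
move: u; rewrite (perm_uniq hn') cat_uniq => /and3P[_ _ ->] /=.
by rewrite -(perm_cat2l I) -(permPl hn') -(permPr ha').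
Qed.

Lemma wf_rule r g G : r \in rules -> wf (tmap g r.1 ++ G) -> wf (tmap g r.2 ++ G).
Proof.
move=> /(allP rules_ok); rewrite /rule_ok /=; set I := filter _ _.
case/and5P=> hn ha _ _ _; apply: (@wf_drop _ _ _ (map g I)).
  by rewrite !nodes_map -map_cat perm_map.
by rewrite !arcs_map -map_cat perm_map.
Qed.

Lemma wf_rename g T : {in nodes T &, injective g} -> wf T -> wf (tmap g T).
Proof.
move=> gi /andP[u p]; rewrite /wf nodes_map arcs_map perm_map // andbT.
by rewrite map_inj_in_uniq.
Qed.

Lemma tstep_wf T U : tstep T U -> wf T /\ wf U.
Proof.
case=> [{}T {}U w h|g {}T w gi|r g G hr w]; split=> //.
- by rewrite -(perm_wf h).
- exact: wf_rename.
- exact: wf_rule.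
Qed.

Lemma teq_wf T U : teq T U -> wf T = wf U.
Proof. by elim=> {T U} [T U /tstep_wf[-> ->]||T U _ ->|T U V _ -> _ ->]. Qed.

(** * The Kauffman bracket *)

(* Sign, exponents of [A] and [A^-1], and exponent of [delta]. *)
Notation monomial := (bool * nat * nat * nat)%type.
Definition Monomial s p n l : monomial := (s, p, n, l).
Definition msign (m : monomial) := m.1.1.1.
Definition mpos (m : monomial) := m.1.1.2.
Definition mneg (m : monomial) := m.1.2.
Definition mloop (m : monomial) := m.2.

Definition mmul (m n : monomial) := Monomial (msign m (+) msign n)
  (mpos m + mpos n) (mneg m + mneg n) (mloop m + mloop n).

(** The exponent of [delta] is the number of names at the vertex; an arc gets 0 because its ends are
    already counted at vertices. The coefficient of [Curl] is [- A ^+ 3], the factor of a positive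
    kink. *)
Definition smoothings (v : vertex) : seq (monomial * seq (nat * nat)) :=
  match v with
  | Xing a b c d => [:: (Monomial false 1 0 4, [:: (a, b); (c, d)]);
                        (Monomial false 0 1 4, [:: (b, c); (d, a)])]
  | Curl a b => [:: (Monomial true 3 0 2, [:: (a, b)])]
  | Join a b => [:: (Monomial false 0 0 2, [:: (a, b)])]
  | Arc a b => [:: (Monomial false 0 0 0, [:: (a, b)])]
  end.

Local Open Scope ring_scope.

Section Bracket.
Variables (R : realFieldType) (A : R).
Hypothesis A0 : A != 0.

Definition delta : R := - (A ^+ 2 + A^-1 ^+ 2).

(** This is where the ordered field serves: a sum of two squares, one of them nonzero, does not
    vanish. *)
Lemma delta_neq0 : delta != 0.
Proof.
rewrite oppr_eq0; apply: lt0r_neq0; rewrite ltr_pwDl ?sqr_ge0 //.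
by rewrite lt_neqAle eq_sym sqrf_eq0 A0 sqr_ge0.
Qed.

Definition mval (m : monomial) : R :=
  (-1) ^+ msign m * (A ^+ mpos m * A^-1 ^+ mneg m * delta ^+ mloop m).

(* A state with [N] node names and pairing [ps] has [N - rank id ps] circles: each
   name carries a factor [delta], each merging a factor [delta^-1]. *)
Fixpoint ev (f : nat -> nat) (T : tangle) (ps : seq (nat * nat)) : R :=
  if T is v :: T' then \sum_(m <- smoothings v) mval m.1 * ev f T' (m.2 ++ ps)
  else delta^-1 ^+ rank f ps.

Definition bracket (T : tangle) : R := ev id T [::].

Lemma mval_mul m n : mval (mmul m n) = mval m * mval n.
Proof. by rewrite /mval /= signr_addb !exprD; ring. Qed.

Lemma ev_perm_pairs f T ps qs : perm_eq ps qs -> ev f T ps = ev f T qs.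
Proof.
elim: T ps qs => [|v T IH] ps qs h /=; first by rewrite (rank_perm f h).
by apply: eq_bigr => m _; congr (_ * _); apply: IH; rewrite perm_cat2l.
Qed.

Lemma ev_swap f v w T ps : ev f (v :: w :: T) ps = ev f (w :: v :: T) ps.
Proof.
rewrite /=; under eq_bigr do rewrite big_distrr /=.
rewrite exchange_big /=; apply: eq_bigr => m _; rewrite big_distrr /=.
apply: eq_bigr => n _; rewrite mulrCA; do 2!congr (_ * _).
by apply: ev_perm_pairs; rewrite perm_catCA.
Qed.

Lemma ev_perm f T U ps : perm_eq T U -> ev f T ps = ev f U ps.
Proof.
have mid v s1 s2 qs : ev f (s1 ++ v :: s2) qs = ev f (v :: s1 ++ s2) qs.
  elim: s1 qs => // w s1 IH qs; rewrite ev_swap cat_cons /=.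
  by apply: eq_bigr => m _; rewrite IH.
elim: T U ps => [|v T IH] U ps h; first by case: U h => // w U /perm_size.
have vU : v \in U by rewrite -(perm_mem h) inE eqxx.
case/splitPr: vU h => s1 s2 h; rewrite mid /=; apply: eq_bigr => m _; congr (_ * _).
by apply: IH; rewrite -(perm_cons v) (permPl h) perm_catC /= perm_cons perm_catC.
Qed.

Lemma smoothing_ends v m : m \in smoothings v -> {subset ends m.2 <= vnode v ++ varc v}.
Proof.
case: v => [a b c d|a b|a b|a b]; rewrite !inE; first case/orP.
all: by move/eqP-> => x; rewrite /= !inE; do !case/orP; move/eqP->; rewrite eqxx ?orbT.
Qed.

Lemma names_cons v T : names (v :: T) =i (vnode v ++ varc v) ++ names T.
Proof. by move=> x; rewrite /names /nodes /arcs /= !mem_cat; do !case: (_ \in _). Qed.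

Lemma ends_cat ps qs : ends (ps ++ qs) = ends ps ++ ends qs.
Proof. by rewrite /ends map_cat flatten_cat. Qed.

Lemma ev_kernel L f g T ps : {subset names T <= L} -> {subset ends ps <= L} ->
  same_kernel L f g -> ev f T ps = ev g T ps.
Proof.
move=> hT hps E; elim: T ps hT hps => [|v T IH] ps hT hps /=.
  by rewrite (rank_kernel hps E).
rewrite !big_seq; apply: eq_bigr => m hm; congr (_ * _); apply: IH.
  by move=> x hx; apply: hT; rewrite names_cons mem_cat hx orbT.
move=> x; rewrite ends_cat mem_cat => /orP[hx|/hps //].
by apply: hT; rewrite names_cons mem_cat (smoothing_ends hm).
Qed.

Definition map_pairs (g : nat -> nat) (ps : seq (nat * nat)) := [seq (g p.1, g p.2) | p <- ps].

Lemma ev_tmap f g T ps : ev f (tmap g T) (map_pairs g ps) = ev (f \o g) T ps.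
Proof.
elim: T ps => [|v T IH] ps /=; first by rewrite rank_map.
case: v => [a b c d|a b|a b|a b]; rewrite !big_cons !big_nil /= -!IH //.
Qed.

Lemma bracket_rename g T : {in names T &, injective g} -> bracket (tmap g T) = bracket T.
Proof.
move=> gi; rewrite /bracket -[[::]]/(map_pairs g [::]) ev_tmap.
by apply: (ev_kernel (L := names T)) => // x y hx hy /=; rewrite (inj_in_eq gi).
Qed.

(** Performing the gluings [q] first costs their own rank and leaves an evaluation in the partition
    that they produce. This separates the state of a local tangle from its context. *)
Lemma ev_glues T r q :
  ev id T (r ++ q) = delta^-1 ^+ rank id q * ev (glues id q) T r.
Proof.
elim: T r => [|v T IH] r /=.
  by rewrite (rank_perm _ (permEl (perm_catC r q))) rank_cat exprD.
by rewrite big_distrr /=; apply: eq_bigr => m _; rewrite catA IH mulrCA.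
Qed.

(** The state sum of a local tangle as an explicit list, so that it can be computed for each of the
    finitely many rules. *)
Fixpoint expand (T : tangle) : seq (monomial * seq (nat * nat)) :=
  if T is v :: T' then
    [seq (mmul m.1 n.1, n.2 ++ m.2) | m <- smoothings v, n <- expand T']
  else [:: (Monomial false 0 0 0, [::])].

Lemma ev_expand f T U ps :
  ev f (T ++ U) ps = \sum_(m <- expand T) mval m.1 * ev f U (m.2 ++ ps).
Proof.
elim: T ps => [|v T IH] ps /=.
  by rewrite big_seq1 /mval /= !expr0 !mul1r.
rewrite big_allpairs_dep /=; apply: eq_bigr => m _; rewrite IH big_distrr /=.
by apply: eq_bigr => n _; rewrite mval_mul mulrA catA.
Qed.

(** With [B] the boundary of a local tangle, two states that connect the boundary in the same way
    are interchangeable in every context. *)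
Definition same_outside (B : seq nat) (q q' : seq (nat * nat)) : bool :=
  all (fun x => all (fun y => (glues id q x == glues id q y) ==
                              (glues id q' x == glues id q' y)) B) B.

Lemma glues_outside q z : z \notin ends q -> glues id q z = z.
Proof.
suff gen f : f z = z -> (forall u, u != z -> f u != z) -> z \notin ends q -> glues f q z = z.
  exact: gen.
elim: q f => //= p q IH f fz fu; rewrite !inE !negb_or => /and3P[z1 z2 zq].
have p1 := fu p.1; have p2 := fu p.2; rewrite ![_ == z]eq_sym in p1 p2.
apply: IH => // [|u uz]; first by rewrite ?glueE fz (negbTE (p2 z2)).
by rewrite ?glueE; case: ifP => _; apply: fu; rewrite // eq_sym.
Qed.

Lemma glues_outside_neq q z w : z \notin ends q -> w != z -> glues id q w != z.
Proof.
move=> hz wz; have := glues_mem id q w; rewrite map_id inE.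
case/orP=> [/eqP->//|h]; by apply: contraNneq hz => e; rewrite -e.
Qed.

Lemma ev_same_outside (B L : seq nat) q q' T : same_outside B q q' ->
  {subset ends q <= L} -> {subset ends q' <= L} ->
  {in names T, forall x, (x \in B) || (x \notin L)} ->
  ev (glues id q) T [::] = ev (glues id q') T [::].
Proof.
move=> so hq hq' hT; apply: (ev_kernel (L := names T)) => // x y hx hy.
have nq z : z \notin L -> (z \notin ends q) * (z \notin ends q').
  by move=> h; split; apply: contraNN h; [apply: hq|apply: hq'].
have out z w : z \notin L ->
    (glues id q w == glues id q z) = (glues id q' w == glues id q' z).
  move=> /nq[z1 z2]; rewrite !(glues_outside z1) !(glues_outside z2).
  by case: (eqVneq w z) => [->|wz]; rewrite ?(glues_outside z1) ?(glues_outside z2) //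
    !(negbTE (glues_outside_neq _ wz)).
case/orP: (hT y hy) => [yB|yL]; last exact: out.
case/orP: (hT x hx) => [xB|xL]; last by rewrite ![_ == glues _ _ y]eq_sym; exact: out.
by have /allP/(_ _ xB)/allP/(_ _ yB)/eqP := so.
Qed.

(** The rank of a local state may exceed the exponent of [delta] by one: [Arc 0 1] has exponent 0
    and rank 1. One extra factor [delta] keeps the exponents natural, and [term_ok] checks that the
    truncated subtraction is exact. *)
Definition mdiv (m : monomial) (k : nat) :=
  Monomial (msign m) (mpos m) (mneg m) ((mloop m).+1 - k).

Definition term_ok B (reps : seq (seq (nat * nat))) (m : monomial * seq (nat * nat)) :=
  has (same_outside B m.2) reps && (rank id m.2 <= (mloop m.1).+1)%N.

Definition terms B reps i (E : seq (monomial * seq (nat * nat))) : seq monomial :=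
  [seq mdiv m.1 (rank id m.2) | m <- E & find (same_outside B m.2) reps == i].

Lemma expand_ends T m : m \in expand T -> {subset ends m.2 <= names T}.
Proof.
elim: T m => [|v T IH] m /=; first by rewrite inE => /eqP->.
case/allpairsP=> -[a b] [/= ha hb ->] x; rewrite ends_cat mem_cat names_cons mem_cat.
by case/orP=> [/(IH _ hb)->|/(smoothing_ends ha)->]; rewrite ?orbT.
Qed.

(** The skein expansion: states are grouped by the way they connect the boundary, and the context
    enters only through the representative of each group. Two local tangles with equal group
    coefficients thus have the same bracket in every context. *)
Lemma bracket_terms (B L : seq nat) reps T G :
  {subset names T <= L} -> {in reps, forall q, {subset ends q <= L}} ->
  all (term_ok B reps) (expand T) ->
  {in names G, forall x, (x \in B) || (x \notin L)} ->
  delta * bracket (T ++ G) = \sum_(i < size reps)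
    (\sum_(m <- terms B reps i (expand T)) mval m) * ev (glues id (nth [::] reps i)) G [::].
Proof.
move=> hT hreps ok hG; rewrite /bracket ev_expand big_distrr /=.
under [RHS]eq_bigr => i _ do rewrite /terms big_map big_filter big_distrl /=.
rewrite (exchange_big_dep xpredT) //= !big_seq; apply: eq_bigr => m hm.
have /andP[hh hr] := allP ok _ hm.
rewrite has_find in hh; rewrite (bigD1 (Ordinal hh)) //= ?eqxx // big1 ?addr0; last first.
  move=> i /andP[/eqP e /negP[]]; apply/eqP/val_inj; exact/esym.
rewrite cats0 (ev_glues G [::] m.2) !mulrA; congr (_ * _).
  by rewrite /mval /mdiv /msign /mpos /mneg /mloop /= !exprVn exprB ?unitfE ?delta_neq0 // exprS; ring.
apply: (ev_same_outside (B := B) (L := L)) => //.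
- by rewrite -has_find in hh; exact: nth_find.
- by move=> x /(expand_ends hm)/hT.
- by apply: hreps; rewrite mem_nth.
Qed.

End Bracket.

Local Close Scope ring_scope.

(** * Invariance of the bracket under the rules *)

Local Open Scope ring_scope.

Definition rule_names (r : tangle * tangle) : seq nat := undup (names r.1).
Definition rule_boundary (r : tangle * tangle) : seq nat :=
  [seq x <- rule_names r | ~~ internal r.1 x].
(** All the states of both sides serve as representatives. Repetitions are harmless, since [find]
    selects the first match. *)
Definition rule_states (r : tangle * tangle) : seq (seq (nat * nat)) :=
  [seq m.2 | m <- expand r.1 ++ expand r.2].
Definition rule_terms (r : tangle * tangle) : seq (seq monomial * seq monomial) :=
  [seq (terms (rule_boundary r) (rule_states r) i (expand r.1),
        terms (rule_boundary r) (rule_states r) i (expand r.2))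
     | i <- iota 0 (size (rule_states r))].

Definition rule_check (r : tangle * tangle) : bool :=
  all (term_ok (rule_boundary r) (rule_states r)) (expand r.1 ++ expand r.2)
  && all (mem (names r.1)) (names r.2).

Lemma rules_checked : all rule_check rules.
Proof. by vm_compute. Qed.

Section RuleInvariance.
Variables (R : realFieldType) (A : R).
Hypothesis A0 : A != 0.

(** A recursive conjunction, so that simplification on a closed list leaves finitely many identities
    in the field. *)
Fixpoint same_values (l : seq (seq monomial * seq monomial)) : Prop :=
  if l is p :: l' then
    \sum_(m <- p.1) mval A m = \sum_(m <- p.2) mval A m /\ same_values l'
  else True.

Lemma same_values_nth l i : (i < size l)%N -> same_values l ->
  \sum_(m <- (nth ([::], [::]) l i).1) mval A m = \sum_(m <- (nth ([::], [::]) l i).2) mval A m.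
Proof. by elim: l i => // p l IH [|i] /= hi [h1 h2] //; apply: IH. Qed.

(** The classical verification of the bracket for the second and third moves and for the kinks. The
    closed lists of monomials are computed before [A] comes in; the identities in [A] that remain
    are rational. *)
Lemma rules_values : {in rules, forall r, same_values (rule_terms r)}.
Proof.
move=> r; rewrite /rules !inE.
do 11?[case/orP]; move/eqP->.
all: match goal with |- same_values ?t =>
       let v := eval vm_compute in t in have -> : t = v by vm_compute end.
all: repeat match goal with |- _ /\ _ => split | |- True => exact I
       | |- same_values (_ :: _) => simpl | |- same_values [::] => exact I end.
all: rewrite ?big_nil //.
all: rewrite ?(big_cons, big_nil) /mval /delta /=.
all: rewrite ?expr0 ?mul1r ?mulr1 ?addr0 //.
all: by field.
Qed.

Lemma uniq_map_inj (S S' : eqType) (g : S -> S') s : uniq (map g s) -> {in s &, injective g}.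
Proof.
elim: s => //= a s IH /andP[na u] x y.
rewrite !inE => /orP[/eqP->|hx] /orP[/eqP->|hy] e //; last exact: IH.
- by rewrite e map_f in na.
- by rewrite -e map_f in na.
Qed.

Lemma wf_internal g T G x : wf (tmap g T ++ G) -> internal T x -> g x \notin names G.
Proof.
move=> /andP[]; rewrite nodes_cat arcs_cat => u p /andP[xn xa].
have ua := u; rewrite (perm_uniq p) in ua.
move: u ua; rewrite !cat_uniq !nodes_map !arcs_map => /and3P[_ /hasPn h1 _] /and3P[_ /hasPn h2 _].
rewrite mem_cat negb_or; apply/andP; split; apply/negP.
  by move/h1; rewrite (map_f g xn).
by move/h2; rewrite (map_f g xa).
Qed.

(** On the left side of each rule all the names occur at vertices, or all of them occur on arcs;
    either way [wf] makes their images distinct. *)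
Lemma wf_rule_inj r g G : r \in rules -> wf (tmap g r.1 ++ G) ->
  {in names r.1 &, injective g}.
Proof.
move=> hr /andP[]; rewrite nodes_cat arcs_cat nodes_map arcs_map => u p.
have ua := u; rewrite (perm_uniq p) in ua.
move: u ua; rewrite !cat_uniq => /and3P[u _ _] /and3P[ua _ _].
have sub : {subset names r.1 <= nodes r.1} \/ {subset names r.1 <= arcs r.1}.
  have : all (fun r => all (mem (nodes r.1)) (names r.1) || all (mem (arcs r.1)) (names r.1)) rules.
    by vm_compute.
  by move/allP/(_ _ hr)/orP=> -[/allP h|/allP h]; [left|right].
have := allP rules_ok _ hr; case/and5P => _ _ u1 u2 _.
by case: sub => sub x y /sub hx /sub hy; [apply: (uniq_map_inj u)|apply: (uniq_map_inj ua)].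
Qed.
End RuleInvariance.

Local Close Scope ring_scope.

Local Open Scope ring_scope.

Section BracketInvariance.
Variables (R : realFieldType) (A : R).
Hypothesis A0 : A != 0.

Lemma bracket_rule_closed r G : r \in rules ->
  {in names G, forall x, (x \in rule_boundary r) || (x \notin names r.1)} ->
  bracket A (r.1 ++ G) = bracket A (r.2 ++ G).
Proof.
move=> hr hG; have /andP[ok /allP hsub] := allP rules_checked _ hr.
move: (ok); rewrite all_cat => /andP[ok1 ok2].
apply: (mulfI (delta_neq0 A0)).
have hreps : {in rule_states r, forall q, {subset ends q <= names r.1}}.
  move=> q /mapP[m]; rewrite mem_cat => /orP[] hm -> x /(expand_ends hm) //.
  exact: hsub.
rewrite !(bracket_terms A0 (L := names r.1) (reps := rule_states r) (B := rule_boundary r)) //.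
apply: eq_bigr => i _; congr (_ * _).
have ri := ltn_ord i; move: {i}(val i) ri => /= i ri.
have hi : (i < size (rule_terms r))%N by rewrite size_map size_iota.
have := same_values_nth hi (rules_values A0 hr).
by rewrite (nth_map 0%N) ?size_iota // nth_iota.
Qed.

Lemma bracket_rule r g G : r \in rules -> wf (tmap g r.1 ++ G) ->
  bracket A (tmap g r.1 ++ G) = bracket A (tmap g r.2 ++ G).
Proof.
move=> hr w; have gi := wf_rule_inj hr w.
have /andP[_ /allP hsub] := allP rules_checked _ hr.
have lt12 x : x \in names r.1 -> (x < 12)%N.
  have /and5P[_ _ _ _ /allP h] := allP rules_ok _ hr.
  by move=> hx; apply: h; rewrite mem_cat hx.
pose L := undup (names r.1).
have inL x : (x \in L) = (x \in names r.1) by rewrite mem_undup.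
(* [k] undoes [g] on the names of the rule and pushes all other names to 12 and beyond. After this
   renaming the rule appears literally, and the context meets it only at its boundary. *)
pose k x := if x \in map g L then nth 0%N L (index x (map g L)) else (x + 12)%N.
have kg x : x \in names r.1 -> k (g x) = x.
  rewrite -inL => hx; rewrite /k map_f //.
  suff -> : index (g x) (map g L) = index x L by rewrite nth_index.
  have := hx; rewrite -index_mem => hi.
  rewrite -{1}(nth_index 0%N hx) -(nth_map 0%N 0%N) // index_uniq ?size_map //.
  rewrite map_inj_in_uniq ?undup_uniq //.
  by move=> y z; rewrite !inL; exact: gi.
have kout x : x \notin map g L -> k x = (x + 12)%N by rewrite /k => /negbTE->.
have ki : injective k.
  move=> x y; case hx : (x \in map g L); case hy : (y \in map g L).
  - case/mapP: hx => x' hx' ->; case/mapP: hy => y' hy' ->.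
    by rewrite !inL in hx' hy'; rewrite !kg // => ->.
  - case/mapP: hx => x' hx' ->; rewrite inL in hx'; rewrite kg // kout ?hy // => e.
    by have := lt12 _ hx'; rewrite e; lia.
  - case/mapP: hy => y' hy' ->; rewrite inL in hy'; rewrite kg // kout ?hx // => e.
    by have := lt12 _ hy'; rewrite -e; lia.
  - by rewrite !kout ?hx ?hy //; lia.
have tk T : {subset names T <= names r.1} -> tmap k (tmap g T) = T.
  by move=> h; rewrite tmap_comp -[RHS]tmap_id; apply: eq_in_tmap => x /h /kg.
rewrite -(bracket_rename A (g := k) (T := tmap g r.1 ++ G)); last by move=> ? ? _ _ /ki.
rewrite -(bracket_rename A (g := k) (T := tmap g r.2 ++ G)); last by move=> ? ? _ _ /ki.
rewrite {1 3}/tmap !map_cat -!/(tmap k _) !tk //.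
apply: bracket_rule_closed => // y.
have -> : names (tmap k G) = map k (names G) by rewrite /names nodes_map arcs_map map_cat.
case/mapP=> x hx ->{y}.
case h : (k x \in names r.1); last by rewrite orbT.
rewrite /= orbF mem_filter inL h andbT; apply/negP => hint.
have := wf_internal w hint; suff -> : g (k x) = x by rewrite hx.
have hx' : x \in map g L.
  by apply/negPn/negP => hx'; have := lt12 _ h; rewrite kout //; lia.
by case/mapP: hx' => z; rewrite inL => hz ->; rewrite kg.
Qed.

Lemma bracket_teq T U : teq T U -> bracket A T = bracket A U.
Proof.
elim=> {T U} [T U|//|T U _ -> //|T U V _ -> _ -> //].
case=> [{}T {}U w h|g {}T w gi|r g G hr w].
- exact: ev_perm.
- rewrite bracket_rename // => x y.
  have sub z : z \in names T -> z \in nodes T.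
    by have /andP[_ p] := w; rewrite mem_cat -(perm_mem p) orbb.
  by move=> /sub hx /sub hy; apply: gi.
- exact: bracket_rule.
Qed.

End BracketInvariance.

Local Close Scope ring_scope.

(** * Certificates *)

(* A certificate is a list of rule applications followed by a renaming of the internal
   names; vertices are matched up to [vcanon]. *)
Definition certificate : Type := seq (nat * seq nat) * seq (nat * nat).

(** A normal form for the first four rules, so that certificates never spell out reversals and half
    turns. *)
Definition vcanon (v : vertex) : vertex :=
  match v with
  | Xing a b c d => if a < c then v else Xing c d a b
  | Curl a b => if a < b then v else Curl b a
  | Join a b => if a < b then v else Join b a
  | Arc a b => if a < b then v else Arc b a
  end.

Definition canon (T : tangle) : tangle := map vcanon T.

Definition assoc (l : seq (nat * nat)) (x : nat) : nat :=
  if [seq p <- l | p.1 == x] is p :: _ then p.2 else x.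

(** [rem] silently ignores an absent vertex; the test by [perm_eq] rejects the application in that
    case. *)
Definition apply_rule (T : tangle) (i : nat * seq nat) : option tangle :=
  let r := nth ([::], [::]) rules i.1 in
  let lhs := canon (tmap (nth 0 i.2) r.1) in
  let rest := foldl (fun s v => rem v s) T lhs in
  if (i.1 < size rules) && perm_eq T (lhs ++ rest)
  then Some (canon (tmap (nth 0 i.2) r.2) ++ rest) else None.

Fixpoint run (T : tangle) (l : seq (nat * seq nat)) : option tangle :=
  if l is i :: l' then obind (run^~ l') (apply_rule T i) else Some T.

Definition certifies (c : certificate) (T U : tangle) : bool :=
  if run (canon T) c.1 is Some V then
    perm_eq (canon (tmap (assoc c.2) V)) (canon U)
    && all (fun x => internal V x || (assoc c.2 x == x)) (names V)
  else false.

Lemma perm_canon T :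
  perm_eq (nodes (canon T)) (nodes T) /\ perm_eq (arcs (canon T)) (arcs T).
Proof.
have sw (a b : nat) : perm_eq [:: b; a] [:: a; b] by rewrite (perm_catC [:: b] [:: a]).
elim: T => [|v T [IH1 IH2]]; first by [].
rewrite /nodes /arcs /=; split; apply: perm_cat => //.
  case: v => [a b c d|a b|a b|a b] /=; case: ifP => // _; try exact: sw.
  by rewrite (perm_catC [:: c; d] [:: a; b]).
by case: v => [a b c d|a b|a b|a b] /=; case: ifP => // _; exact: sw.
Qed.

Lemma wf_canon g T G : wf (tmap g (canon T) ++ G) = wf (tmap g T ++ G).
Proof.
have [hn ha] := perm_canon T; rewrite /wf !nodes_cat !arcs_cat !nodes_map !arcs_map.
have h1 : perm_eq (map g (nodes (canon T)) ++ nodes G) (map g (nodes T) ++ nodes G).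
  by rewrite perm_cat2r perm_map.
rewrite (perm_uniq h1) (permPl h1); congr andb; apply: permPr.
by rewrite perm_cat2r perm_map.
Qed.

Lemma vcanon_step g v G : wf (vmap g v :: G) -> teq (vmap g v :: G) (vmap g (vcanon v) :: G).
Proof.
move=> w; have flip i l : i < 4 -> wf (tmap (nth 0 (map g l)) (nth ([::], [::]) rules i).1 ++ G) ->
    teq (tmap (nth 0 (map g l)) (nth ([::], [::]) rules i).1 ++ G)
      (tmap (nth 0 (map g l)) (nth ([::], [::]) rules i).2 ++ G).
  move=> hi w'; apply/teq_step/ts_rule => //; apply: mem_nth; exact: leq_trans hi _.
case: v w => [a b c d|a b|a b|a b] /=; case: ifP => // _ w; try exact: teq_refl.
- exact: (flip 3 [:: a; b; c; d]).
- exact: (flip 2 [:: a; b]).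
- exact: (flip 1 [:: a; b]).
- exact: (flip 0 [:: a; b]).
Qed.

Lemma teq_canon g T G : wf (tmap g T ++ G) -> teq (tmap g T ++ G) (tmap g (canon T) ++ G).
Proof.
elim: T G => [|v T IH] G w; first exact: teq_refl.
have h := vcanon_step w; apply: teq_trans h _.
have w1 : wf (vmap g (vcanon v) :: tmap g T ++ G) by rewrite -(teq_wf (vcanon_step w)).
have p T' : perm_eq (vmap g (vcanon v) :: tmap g T' ++ G) (tmap g T' ++ vmap g (vcanon v) :: G).
  by rewrite perm_sym -cat1s perm_catCA.
have w2 : wf (tmap g T ++ vmap g (vcanon v) :: G) by rewrite -(perm_wf (p T)).
apply: teq_trans (teq_perm w1 (p T)) _; apply: teq_trans (IH _ w2) _.
apply/teq_sym/teq_perm; last exact: p.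
by rewrite -[X in wf X]/(vmap g (vcanon v) :: tmap g (canon T) ++ G) (perm_wf (p _)) -(teq_wf (IH _ w2)).
Qed.

Lemma teq_rule r g G : r \in rules -> wf (tmap g r.1 ++ G) ->
  teq (tmap g r.1 ++ G) (tmap g r.2 ++ G).
Proof. by move=> *; apply/teq_step/ts_rule. Qed.

Lemma tmap_cat g T U : tmap g (T ++ U) = tmap g T ++ tmap g U.
Proof. exact: map_cat. Qed.

Lemma apply_rule_teq g T i U G : apply_rule T i = Some U -> wf (tmap g T ++ G) ->
  teq (tmap g T ++ G) (tmap g U ++ G).
Proof.
rewrite /apply_rule; set r := nth _ _ _; set lhs := canon _; set rest := foldl _ _ _.
case: ifP => // /andP[hi hp] [<-] w; have hr : r \in rules by exact: mem_nth.
have p1 : perm_eq (tmap g T ++ G) (tmap g lhs ++ (tmap g rest ++ G)).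
  by rewrite catA -tmap_cat perm_cat2r perm_map.
apply: teq_trans (teq_perm w p1) _.
have w1 : wf (tmap g lhs ++ (tmap g rest ++ G)) by rewrite -(perm_wf p1).
have hT k T0 H : wf (tmap (g \o k) T0 ++ H) ->
    teq (tmap (g \o k) T0 ++ H) (tmap g (canon (tmap k T0)) ++ H).
  by rewrite -tmap_comp => w0; apply: teq_canon.
have w2 : wf (tmap (g \o nth 0 i.2) r.1 ++ (tmap g rest ++ G)).
  by rewrite -tmap_comp -wf_canon.
rewrite tmap_cat -catA.
apply: teq_trans (teq_sym (hT _ _ _ w2)) _; apply: teq_trans (teq_rule hr w2) _.
by apply: hT; apply: wf_rule w2.
Qed.

Lemma run_teq g T l U G : run T l = Some U -> wf (tmap g T ++ G) ->
  teq (tmap g T ++ G) (tmap g U ++ G).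
Proof.
elim: l T => [|i l IH] T /=; first by case=> -> _; apply: teq_refl.
case e : (apply_rule T i) => [V|//] /= h w.
have h1 := apply_rule_teq e w; apply: (teq_trans h1); apply: IH => //.
by rewrite -(teq_wf h1).
Qed.

(** Each step of a certificate remains a step after any instantiation [g] of its names and in any
    context [G]. Only the final renaming needs an argument, as it must become a renaming of the
    whole tangle. *)
Lemma certifies_teq c T U g G : certifies c T U ->
  wf (tmap g T ++ G) -> wf (tmap g U ++ G) -> teq (tmap g T ++ G) (tmap g U ++ G).
Proof.
rewrite /certifies; case e : run => [V|//] /andP[hp /allP hr] wT wU.
have hTV : teq (tmap g T ++ G) (tmap g V ++ G).
  by apply: teq_trans (teq_canon wT) _; apply: run_teq e _; rewrite wf_canon.
apply: (teq_trans hTV); have wV := wT; rewrite (teq_wf hTV) in wV.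
set k := assoc c.2 in hp hr.
have p1 : perm_eq (tmap g (canon (tmap k V)) ++ G) (tmap g (canon U) ++ G).
  by rewrite perm_cat2r perm_map.
have wk : wf (tmap g (tmap k V) ++ G) by rewrite -wf_canon (perm_wf p1) wf_canon.
suff h : teq (tmap g V ++ G) (tmap g (tmap k V) ++ G).
  apply: teq_trans h _; apply: teq_trans (teq_canon wk) _.
  apply: teq_trans (teq_perm _ p1) _; first by rewrite wf_canon.
  exact/teq_sym/teq_canon.
(* The final renaming [k] acts on the names of [V]; [h] is its conjugate by [g], extended by the
   identity. It fixes the context because [k] moves only internal names, which the context does not
   contain. *)
pose h z := if z \in map g (nodes V) then g (k (nth 0 (nodes V) (index z (map g (nodes V))))) else z.
have /andP[u pna] := wV; have ua := u; rewrite (perm_uniq pna) in ua.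
move: u ua; rewrite nodes_cat arcs_cat !cat_uniq nodes_map arcs_map.
case/and3P=> u1 /hasPn u2 u3 /and3P[a1 /hasPn a2 a3].
have gi := uniq_map_inj u1; have gia := uniq_map_inj a1.
have hg x : x \in nodes V -> h (g x) = g (k x).
  move=> hx; rewrite /h map_f //; congr (g (k _)).
  suff -> : index (g x) (map g (nodes V)) = index x (nodes V) by rewrite nth_index.
  have hi := hx; rewrite -index_mem in hi.
  by rewrite -{1}(nth_index 0 hx) -(nth_map 0 0) // index_uniq ?size_map.
have hout z : z \notin map g (nodes V) -> h z = z by rewrite /h => /negbTE->.
have hG z : z \in names G -> h z = z.
  move=> hz; case hzV : (z \in map g (nodes V)); last by rewrite hout ?hzV.
  case/mapP: hzV => x hx ezx; rewrite ezx hg //.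
  have : x \in names V by rewrite mem_cat hx.
  move/hr/orP=> [/andP[_ xa]|/eqP -> //].
  move: hz; rewrite mem_cat => /orP[/u2|/a2]; first by rewrite ezx map_f.
  by rewrite ezx map_f.
have hV x : x \in names V -> h (g x) = g (k x).
  rewrite mem_cat; case hx : (x \in nodes V); first by move=> _; apply: hg.
  move=> /= xa.
  have : internal V x || (k x == x) by apply: hr; rewrite mem_cat xa orbT.
  rewrite /internal hx /= => /eqP ->.
  case hz : (g x \in map g (nodes V)); last by rewrite hout ?hz.
  case/mapP: hz => y hy exy; rewrite exy hg //.
  have : internal V y || (k y == y) by apply: hr; rewrite mem_cat hy.
  case/orP=> [/andP[_ ya]|/eqP -> //].
  by have := gia _ _ xa ya exy => exy'; rewrite exy' hy in hx.
have -> : tmap g (tmap k V) ++ G = tmap h (tmap g V ++ G).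
  rewrite tmap_cat !tmap_comp; congr (_ ++ _).
    by apply: eq_in_tmap => x hx /=; rewrite hV.
  by rewrite -[LHS]tmap_id; apply: eq_in_tmap => x hx /=; rewrite hG.
apply/teq_step/ts_rename => //; apply: uniq_map_inj.
suff -> : map h (nodes (tmap g V ++ G)) = nodes (tmap g (tmap k V) ++ G) by case/andP: wk.
rewrite nodes_cat map_cat nodes_cat !nodes_map -!map_comp; congr (_ ++ _).
  by apply/eq_in_map => x hx /=; rewrite hg.
by rewrite -[RHS]map_id; apply/eq_in_map => x hx; rewrite hG // mem_cat hx.
Qed.

(** * Doubling *)

(** Eight copies per name are enough: the cable of a curl uses all those of its second name. *)
Definition copy (i x : nat) : nat := 8 * x + i.

(* The blackboard 2-cable.  Seen from a vertex, [copy 0 x] comes before [copy 1 x]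
   counterclockwise; the two ends of an edge see its copies in opposite orders.  The other
   copies name the ends of the edges inside the cable of the vertex. A doubled curl is a
   full twist of two strands carrying one curl each. *)
Definition vdbl (v : vertex) : tangle :=
  match v with
  | Xing a b c d => [::
      Xing (copy 1 a) (copy 0 b) (copy 2 a) (copy 3 a);
      Xing (copy 3 b) (copy 1 b) (copy 0 c) (copy 2 b);
      Xing (copy 1 c) (copy 0 d) (copy 2 c) (copy 3 c);
      Xing (copy 0 a) (copy 2 d) (copy 3 d) (copy 1 d);
      Arc (copy 2 a) (copy 3 b); Arc (copy 2 b) (copy 3 c);
      Arc (copy 2 c) (copy 3 d); Arc (copy 2 d) (copy 3 a)]
  | Curl a b => [::
      Xing (copy 2 a) (copy 0 a) (copy 1 a) (copy 3 a);
      Xing (copy 4 b) (copy 2 b) (copy 3 b) (copy 5 b);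
      Arc (copy 2 a) (copy 2 b); Arc (copy 3 a) (copy 3 b);
      Arc (copy 5 b) (copy 6 b); Curl (copy 6 b) (copy 0 b);
      Arc (copy 4 b) (copy 7 b); Curl (copy 7 b) (copy 1 b)]
  | Join a b => [:: Join (copy 0 a) (copy 1 b); Join (copy 1 a) (copy 0 b)]
  | Arc a b => [:: Arc (copy 0 a) (copy 1 b); Arc (copy 1 a) (copy 0 b)]
  end.

Definition dbl (T : tangle) : tangle := flatten (map vdbl T).

(** Derivations between the doubled sides, in the order of [rules]. A doubled second move takes four
    second moves, and a doubled third move takes eight third moves, one for each choice of a copy of
    each strand. Where curls occur, they are slid through the crossings of the full twists. *)
Definition dbl_certificates : seq certificate := [::
   ([::],
     [::]);
   ([::],
     [::]);
   ([:: (10, [:: 9; 15; 12; 10; 11; 13]); (11, [:: 8; 14; 13; 15; 9; 10]); (10, [:: 13; 10; 2; 0; 1; 3]); (11, [:: 12; 11; 3; 10; 13; 0])],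
     [:: (2, 7); (3, 6); (10, 4); (11, 5); (12, 2); (13, 3); (14, 11); (15, 10)]);
   ([::],
     [::]);
   ([:: (4, [:: 0; 9; 16; 25]); (4, [:: 1; 8; 17; 24])],
     [::]);
   ([:: (5, [:: 18; 19; 17; 24; 32; 58; 59; 57]); (4, [:: 10; 19; 58; 35]); (5, [:: 11; 9; 16; 10; 33; 40; 34; 35]); (4, [:: 2; 11; 34; 43]); (4, [:: 27; 18; 59; 50]); (5, [:: 0; 26; 27; 25; 50; 51; 49; 56]); (4, [:: 3; 26; 51; 42]); (5, [:: 1; 8; 2; 3; 43; 41; 48; 42])],
     [::]);
   ([:: (6, [:: 83; 50; 74; 51; 82; 75; 49; 56; 64; 73; 81; 88]); (6, [:: 56; 8; 43; 66; 81; 41; 67; 50; 65; 72; 75; 42]); (6, [:: 58; 27; 73; 25; 32; 88; 48; 57; 26; 51; 59; 82]); (6, [:: 57; 9; 72; 24; 59; 42; 10; 27; 11; 66; 88; 81]); (6, [:: 1; 49; 16; 64; 3; 90; 83; 2; 74; 91; 80; 89]); (6, [:: 0; 48; 91; 26; 33; 89; 58; 35; 73; 64; 34; 3]); (6, [:: 2; 67; 17; 65; 80; 40; 56; 49; 43; 18; 90; 19]); (6, [:: 35; 10; 18; 11; 34; 19; 57; 48; 72; 65; 89; 80])],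
     [:: (2, 19); (3, 34); (10, 83); (11, 74); (18, 51); (19, 82); (26, 35); (27, 10); (34, 75); (35, 50); (42, 11); (43, 18); (48, 56); (49, 57); (50, 43); (51, 26); (56, 48); (57, 49); (58, 67); (59, 90); (64, 72); (65, 73); (66, 91); (67, 58); (72, 64); (73, 65); (74, 3); (75, 42); (80, 88); (81, 89); (82, 27); (83, 2); (88, 80); (89, 81); (90, 59); (91, 66)]);
   ([:: (7, [:: 58; 67; 91; 66; 90; 59; 48; 57; 65; 72; 80; 89]); (7, [:: 57; 9; 74; 11; 32; 80; 10; 67; 64; 73; 90; 75]); (7, [:: 0; 48; 17; 65; 19; 82; 58; 83; 91; 18; 81; 88]); (7, [:: 83; 10; 16; 64; 33; 81; 57; 48; 74; 35; 19; 34]); (7, [:: 43; 50; 72; 24; 89; 41; 49; 56; 51; 66; 42; 59]); (7, [:: 56; 8; 73; 25; 75; 42; 27; 50; 26; 11; 89; 80]); (7, [:: 1; 49; 18; 51; 88; 40; 43; 2; 72; 65; 3; 82]); (7, [:: 2; 27; 35; 26; 34; 3; 56; 49; 73; 64; 88; 81])],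
     [:: (2, 67); (3, 90); (10, 35); (11, 26); (18, 3); (19, 34); (26, 91); (27, 58); (34, 59); (35, 66); (42, 27); (43, 2); (48, 56); (49, 57); (50, 83); (51, 74); (56, 48); (57, 49); (58, 19); (59, 42); (64, 72); (65, 73); (66, 43); (67, 10); (72, 64); (73, 65); (74, 51); (75, 82); (80, 88); (81, 89); (82, 75); (83, 50); (88, 80); (89, 81); (90, 11); (91, 18)]);
   ([:: (8, [:: 1; 8; 2; 3]); (11, [:: 2; 3; 26; 0; 27; 25]); (7, [:: 17; 0; 16; 3; 9; 24; 27; 18; 2; 11; 19; 10]); (8, [:: 0; 9; 18; 19]); (11, [:: 18; 19; 10; 3; 11; 24])],
     [:: (2, 19); (3, 28); (10, 30); (11, 27); (18, 26); (19, 29); (26, 31); (27, 18)]);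
   ([:: (10, [:: 41; 47; 44; 42; 43; 45]); (7, [:: 0; 17; 34; 19; 35; 26; 18; 27; 24; 33; 25; 32]); (7, [:: 1; 16; 33; 9; 32; 8; 11; 2; 10; 19; 3; 26]); (5, [:: 19; 8; 9; 26; 16; 32; 2; 3]); (4, [:: 11; 2; 19; 10]); (4, [:: 17; 8; 32; 25]); (9, [:: 27; 25; 17; 35; 43; 44]); (4, [:: 18; 27; 44; 47]); (5, [:: 0; 24; 18; 34; 47; 45; 41; 42]); (4, [:: 33; 24; 45; 46]); (9, [:: 1; 10; 11; 33; 46; 40])],
     [::]);
   ([:: (10, [:: 14; 8; 17; 24; 18; 19]); (10, [:: 15; 9; 16; 42; 43; 41]); (10, [:: 16; 43; 34; 35; 33; 40]); (10, [:: 17; 18; 27; 25; 32; 26]); (7, [:: 9; 11; 8; 10; 24; 41; 12; 15; 13; 14; 42; 19]); (7, [:: 14; 1; 15; 0; 24; 41; 2; 10; 3; 11; 19; 42]); (7, [:: 43; 12; 18; 13; 25; 40; 9; 16; 8; 17; 35; 26]); (7, [:: 17; 2; 16; 3; 25; 40; 14; 13; 15; 12; 26; 35])],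
     [:: (2, 27); (3, 10); (8, 34); (9, 35); (10, 2); (11, 43); (12, 9); (13, 8); (14, 17); (15, 16); (16, 19); (17, 18); (18, 37); (19, 3); (27, 38); (34, 39); (35, 11); (43, 36)]);
   ([:: (11, [:: 14; 8; 17; 19; 32; 18]); (11, [:: 15; 9; 16; 25; 26; 27]); (11, [:: 16; 27; 42; 24; 43; 41]); (11, [:: 17; 18; 35; 34; 33; 40]); (7, [:: 32; 25; 11; 9; 10; 8; 26; 19; 15; 12; 14; 13]); (7, [:: 32; 25; 1; 14; 0; 15; 19; 26; 10; 2; 11; 3]); (7, [:: 33; 24; 12; 27; 13; 18; 43; 34; 16; 9; 17; 8]); (7, [:: 33; 24; 2; 17; 3; 16; 34; 43; 13; 14; 12; 15])],
     [:: (2, 35); (3, 10); (8, 42); (9, 43); (10, 2); (11, 27); (12, 9); (13, 8); (14, 17); (15, 16); (16, 19); (17, 18); (18, 45); (19, 3); (27, 44); (35, 46); (42, 47); (43, 11)])].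

Lemma dbl_certified :
  all2 (fun r c => certifies c (dbl r.1) (dbl r.2)) rules dbl_certificates.
Proof. by vm_compute. Qed.

Definition copy_map (g : nat -> nat) (z : nat) : nat := copy (z %% 8) (g (z %/ 8)).

Lemma copy_div i x : i < 8 -> copy i x %/ 8 = x.
Proof. by move=> hi; rewrite /copy mulnC divnMDl // divn_small // addn0. Qed.

Lemma copy_mod i x : i < 8 -> copy i x %% 8 = i.
Proof. by move=> hi; rewrite /copy mulnC modnMDl modn_small. Qed.

Lemma copy_mapE g i x : i < 8 -> copy_map g (copy i x) = copy i (g x).
Proof. by move=> hi; rewrite /copy_map copy_div ?copy_mod. Qed.

Lemma copy_inj i j x y : i < 8 -> j < 8 -> copy i x = copy j y -> i = j /\ x = y.
Proof.
move=> hi hj e; split; first by rewrite -(copy_mod x hi) e copy_mod.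
by rewrite -(copy_div x hi) e copy_div.
Qed.

Lemma dbl_cat T U : dbl (T ++ U) = dbl T ++ dbl U.
Proof. by rewrite /dbl map_cat flatten_cat. Qed.

Lemma vdbl_map g v : vdbl (vmap g v) = tmap (copy_map g) (vdbl v).
Proof. by case: v => [a b c d|a b|a b|a b]; rewrite /= !copy_mapE. Qed.

Lemma dbl_map g T : dbl (tmap g T) = tmap (copy_map g) (dbl T).
Proof.
elim: T => //= v T IH; rewrite -[v :: T]cat1s dbl_cat /tmap map_cat -!/(tmap _ _) -IH.
by rewrite -[vmap g v :: _]cat1s dbl_cat /dbl /= !cats0 vdbl_map.
Qed.

Lemma copy_map_inj g (s : seq nat) :
  {in s &, injective g} -> {in [pred z | z %/ 8 \in s] &, injective (copy_map g)}.
Proof.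
move=> gi x y; rewrite !inE => hx hy e.
have [em eg] := copy_inj (ltn_pmod x (isT : 0 < 8)) (ltn_pmod y (isT : 0 < 8)) e.
by rewrite (divn_eq x 8) (divn_eq y 8) em (gi _ _ hx hy eg).
Qed.

Definition vinner (v : vertex) : seq nat :=
  match v with
  | Xing a b c d => [:: copy 2 a; copy 3 a; copy 3 b; copy 2 b;
                        copy 2 c; copy 3 c; copy 2 d; copy 3 d]
  | Curl a b => [:: copy 2 a; copy 3 a; copy 2 b; copy 3 b; copy 4 b; copy 5 b; copy 6 b; copy 7 b]
  | _ => [::]
  end.

Definition inner (T : tangle) : seq nat := flatten (map vinner T).

Definition outer (s : seq nat) : seq nat := map (copy 0) s ++ map (copy 1) s.

Lemma perm_outer s t : perm_eq s t -> perm_eq (outer s) (outer t).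
Proof. by move=> h; apply: perm_cat; apply: perm_map. Qed.

Lemma outer_cat s t : perm_eq (outer (s ++ t)) (outer s ++ outer t).
Proof. by apply/permP => a; rewrite /outer !map_cat !count_cat; lia. Qed.

Ltac perm_counts :=
  repeat match goal with |- context [nat_of_bool ?b] => generalize (nat_of_bool b); intro end;
  lia.

Lemma vdbl_nodes v : perm_eq (nodes (vdbl v)) (outer (vnode v) ++ vinner v).
Proof.
by case: v => [a b c d|a b|a b|a b]; apply/permP => p; rewrite /= ?addn0; perm_counts.
Qed.

Lemma vdbl_arcs v : perm_eq (arcs (vdbl v)) (outer (varc v) ++ vinner v).
Proof.
by case: v => [a b c d|a b|a b|a b]; apply/permP => p; rewrite /= ?addn0; perm_counts.
Qed.

Lemma dbl_cons v T : dbl (v :: T) = vdbl v ++ dbl T. Proof. by []. Qed.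
Lemma nodes_cons v T : nodes (v :: T) = vnode v ++ nodes T. Proof. by []. Qed.
Lemma arcs_cons v T : arcs (v :: T) = varc v ++ arcs T. Proof. by []. Qed.
Lemma inner_cons v T : inner (v :: T) = vinner v ++ inner T. Proof. by []. Qed.

Lemma dbl_nodes T : perm_eq (nodes (dbl T)) (outer (nodes T) ++ inner T).
Proof.
elim: T => // v T IH; rewrite dbl_cons nodes_cat nodes_cons inner_cons.
rewrite (permPl (perm_cat (vdbl_nodes v) IH)).
rewrite (permPr (perm_cat (outer_cat _ _) (perm_refl _))).
by apply/permP => p; rewrite !count_cat; lia.
Qed.

Lemma dbl_arcs T : perm_eq (arcs (dbl T)) (outer (arcs T) ++ inner T).
Proof.
elim: T => // v T IH; rewrite dbl_cons arcs_cat arcs_cons inner_cons.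
rewrite (permPl (perm_cat (vdbl_arcs v) IH)).
rewrite (permPr (perm_cat (outer_cat _ _) (perm_refl _))).
by apply/permP => p; rewrite !count_cat; lia.
Qed.

Lemma mem_vdbl v z : z \in nodes (vdbl v) -> z %/ 8 \in vnode v.
Proof.
rewrite (perm_mem (vdbl_nodes v)) !mem_cat => /orP[/orP[]|].
- by case/mapP=> x hx ->; rewrite copy_div.
- by case/mapP=> x hx ->; rewrite copy_div.
- by case: v => [a b c d|a b|a b|a b] //=; rewrite !inE;
    do !case/orP; move/eqP->; rewrite copy_div ?eqxx ?orbT.
Qed.

Lemma mem_dbl T z : z \in nodes (dbl T) -> z %/ 8 \in nodes T.
Proof.
elim: T => // v T IH; rewrite dbl_cons nodes_cat nodes_cons !mem_cat.
by case/orP=> [/mem_vdbl|/IH] ->; rewrite ?orbT.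
Qed.

Lemma uniq_vdbl v : uniq (vnode v) -> uniq (nodes (vdbl v)).
Proof.
(* A vertex with distinct names is an injective image of one with names 0, 1, ..., whose cable is
   checked by computation. *)
have gen v0 l : v = vmap (nth 0 l) v0 -> uniq l ->
    all (fun x => x < size l) (vnode v0) -> uniq (nodes (vdbl v0)) -> uniq (nodes (vdbl v)).
  move=> -> ul /allP hl u0; rewrite vdbl_map nodes_map map_inj_in_uniq //.
  have gi : {in [pred z | z < size l] &, injective (nth 0 l)}.
    by move=> x y; rewrite !inE => hx hy /eqP; rewrite nth_uniq // => /eqP.
  move=> x y /mem_vdbl/hl hx /mem_vdbl/hl hy.
  by apply: (@copy_map_inj _ (iota 0 (size l))); rewrite ?inE ?mem_iota //;
    move=> x' y'; rewrite !mem_iota => ? ?; apply: gi.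
case: v gen => [a b c d|a b|a b|a b] gen u //.
- exact: (gen (Xing 0 1 2 3) [:: a; b; c; d]).
- exact: (gen (Curl 0 1) [:: a; b]).
- exact: (gen (Join 0 1) [:: a; b]).
Qed.

Lemma uniq_dbl T : uniq (nodes T) -> uniq (nodes (dbl T)).
Proof.
elim: T => // v T IH; rewrite dbl_cons nodes_cat nodes_cons !cat_uniq.
case/and3P=> u1 /hasPn h u2; rewrite IH // andbT uniq_vdbl //=.
by apply/hasPn => z /mem_dbl/h; apply: contra => /mem_vdbl.
Qed.

Lemma wf_dbl T : wf T -> wf (dbl T).
Proof.
case/andP=> u p; rewrite /wf uniq_dbl //= (permPl (dbl_nodes T)) (permPr (dbl_arcs T)).
by rewrite perm_cat2r perm_outer.
Qed.

Lemma all2_exists (S : eqType) S' (P : S -> S' -> bool) s t :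
  all2 P s t -> {in s, forall x, exists y, P x y}.
Proof.
elim: s t => [|x s IH] [|y t] //= /andP[h /IH{}IH] z.
by rewrite inE => /orP[/eqP ->|/IH //]; exists y.
Qed.

(** The 2-cable respects the equivalence: permutations and renamings lift directly, and a rule lifts
    by its certificate. *)
Lemma teq_dbl T U : teq T U -> teq (dbl T) (dbl U).
Proof.
elim=> {T U} [T U s|T|T U _ h|T U V _ h1 _ h2].
- case: s => [{}T {}U w h|g {}T w gi|r g G hr w].
  + by apply: teq_perm; [exact: wf_dbl|apply/perm_flatten/perm_map].
  + rewrite dbl_map; apply/teq_step/ts_rename; first exact: wf_dbl.
    by move=> x y /mem_dbl hx /mem_dbl hy; apply: (copy_map_inj gi).
  + rewrite !dbl_cat !dbl_map.
    have [c hc] := all2_exists dbl_certified hr; apply: (certifies_teq hc).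
      by rewrite -dbl_map -dbl_cat wf_dbl.
    by rewrite -dbl_map -dbl_cat wf_dbl // wf_rule.
- exact: teq_refl.
- exact: teq_sym.
- exact: teq_trans h1 h2.
Qed.

(** * Adequacy and the number of circles *)

Definition is_xing (v : vertex) : bool := if v is Xing _ _ _ _ then true else false.
Definition is_curl (v : vertex) : bool := if v is Curl _ _ then true else false.

Definition xings (T : tangle) : nat := count is_xing T.
Definition curls (T : tangle) : nat := count is_curl T.

(** Only the [A]-smoothing is needed: the [B]-state of a diagram will be treated as the [A]-state of
    the diagram with all crossings switched. *)
Definition vpairs (v : vertex) : seq (nat * nat) :=
  match v with
  | Xing a b c d => [:: (a, b); (c, d)]
  | Curl a b | Join a b | Arc a b => [:: (a, b)]
  end.

Definition pairs (T : tangle) : seq (nat * nat) := flatten (map vpairs T).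

Definition circles (T : tangle) : nat := classes (glues id (pairs T)) (nodes T).

(* [o] orients the circles of the [A]-state and [c] names them. *)
Definition vadequate (o : nat -> bool) (c : nat -> nat) (v : vertex) : bool :=
  all (fun p => (o p.1 != o p.2) && (c p.1 == c p.2)) (vpairs v)
  && (if v is Xing x _ y _ then c x != c y else true).

(** The witness [c] may give several circles the same name, which makes it easy to transport through
    constructions. By [glues_finest] it still forces the true circles to be distinct at each
    crossing. *)
Definition adequate (T : tangle) : Prop := exists o c, all (vadequate o c) T.

Lemma pairs_cons v T : pairs (v :: T) = vpairs v ++ pairs T.
Proof. by []. Qed.

Lemma pairs_names T : {subset ends (pairs T) <= names T}.
Proof.
elim: T => // v T IH x; rewrite pairs_cons ends_cat mem_cat names_cons mem_cat.
case/orP=> [|/IH ->]; last by rewrite orbT.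
by move=> h; apply/orP; left; case: v h => [a b c d|a b|a b|a b] /=; rewrite !inE.
Qed.

Lemma wf_names T : wf T -> names T =i nodes T.
Proof. by case/andP=> _ p x; rewrite mem_cat -(perm_mem p) orbb. Qed.

Lemma circles_rank T : wf T -> size (nodes T) = rank id (pairs T) + circles T.
Proof.
move=> w; rewrite /circles -rank_classes; last first.
  by move=> x /pairs_names; rewrite wf_names.
by rewrite /classes map_id undup_id //; case/andP: w.
Qed.

(** Compare both smoothings with the gluing of all four pairs. Starting from the [A]-pairs its rank
    grows if [a] and [c] are not yet joined; starting from the [B]-pairs it grows by at most one. So
    the other smoothing creates at most one circle, and none if two circles meet at the crossing. *)
Lemma rank_crossing a b c d ps (f := glues id [:: (a, b), (c, d) & ps]) :
  rank id [:: (a, b), (c, d) & ps] + (f a != f c) <= rank id [:: (b, c), (d, a) & ps] + 1.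
Proof.
set rA := rank _ _; set rB := rank _ _.
have h1 : rA + (f a != f c) <= rank id [:: (d, a), (b, c), (a, b), (c, d) & ps].
  rewrite rank_rcons [rank id [:: (b, c), _, _ & _]]rank_rcons -/rA -/f /=.
  have /eqP -> : f b == f a by rewrite eq_sym; apply: (@glues_pair id _ (a, b)); rewrite inE eqxx.
  exact: leq_addr.
apply: (leq_trans h1).
rewrite (@rank_perm _ _ [:: (c, d), (a, b), (b, c), (d, a) & ps]); last first.
  by apply/permP => p /=; lia.
rewrite rank_rcons [rank id [:: (a, b), _, _ & _]]rank_rcons -/rB.
set g := glues id [:: (a, b), _, _ & _].
(* Once three sides of the square [a], [b], [c], [d] are glued, the fourth is redundant. *)
have /eqP -> : g (c, d).1 == g (c, d).2.
  have /eqP e1 : g (b, c).1 == g (b, c).2 by apply: glues_pair; rewrite !inE eqxx orbT.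
  have /eqP e2 : g (a, b).1 == g (a, b).2 by apply: glues_pair; rewrite !inE eqxx.
  have /eqP e3 : g (d, a).1 == g (d, a).2 by apply: glues_pair; rewrite !inE eqxx !orbT.
  by rewrite /= in e1 e2 e3 *; rewrite -e1 -e2 e3.
by rewrite eqxx addn0 leq_add2l leq_b1.
Qed.

(** * Degree estimates by evaluation at a large rational number *)

Local Open Scope ring_scope.

Section Degree.
Variable A : rat.
Hypothesis A1 : 1 <= A.

Let A0 : A != 0. Proof. by apply: lt0r_neq0; apply: lt_le_trans A1. Qed.
Let Apos : 0 < A. Proof. exact: lt_le_trans A1. Qed.

Let D := `|delta A|.

Let DE : D = A ^+ 2 + A^-1 ^+ 2.
Proof. by rewrite /D /delta normrN ger0_norm // addr_ge0 // sqr_ge0. Qed.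

Let AD : A ^+ 2 <= D.
Proof. by rewrite DE lerDl sqr_ge0. Qed.

Let D1 : 1 <= D.
Proof. by apply: le_trans AD; rewrite exprn_ege1. Qed.

Let D0 : 0 < D. Proof. exact: lt_le_trans D1. Qed.

(** A circle is worth [A ^+ 2] up to a factor 2; this is the constant behind the powers of 2 and 3
    below. *)
Let DA : D <= 2 * A ^+ 2.
Proof.
rewrite DE mulr2n mulrDl mul1r lerD2l ler_pXn2r ?nnegrE ?invr_ge0 ?(ltW Apos) //.
by rewrite (le_trans _ A1) // invf_le1.
Qed.

(** The absolute value of the contribution of the all-[A] state, given the pairs [ps] chosen so
    far. *)
Definition main (T : tangle) (ps : seq (nat * nat)) : rat :=
  A ^+ (xings T + 3 * curls T) * D ^+ size (nodes T) * D^-1 ^+ rank id (pairs T ++ ps).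

Lemma main_ge0 T ps : 0 <= main T ps.
Proof. by rewrite /main !mulr_ge0 ?exprn_ge0 ?invr_ge0 ?(ltW Apos) ?(ltW D0). Qed.

Lemma ev_Xing f a b c d T ps : ev A f (Xing a b c d :: T) ps =
  delta A ^+ 4 * (A * ev A f T [:: (a, b), (c, d) & ps]
                  + A^-1 * ev A f T [:: (b, c), (d, a) & ps]).
Proof. by rewrite /= !big_cons big_nil /mval /mpos /mneg /mloop /= !expr0 !expr1; ring. Qed.

Lemma rank_mid f v T ps : rank f (pairs T ++ vpairs v ++ ps) = rank f (pairs (v :: T) ++ ps).
Proof. by apply: rank_perm; rewrite pairs_cons -catA perm_catCA. Qed.

Lemma main_Xing a b c d T ps :
  main (Xing a b c d :: T) ps = D ^+ 4 * (A * main T [:: (a, b), (c, d) & ps]).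
Proof.
rewrite /main -(rank_mid _ (Xing a b c d)) /= /xings /curls /=.
by rewrite !exprS expr0; ring.
Qed.

Lemma ev_Curl f a b T ps : ev A f (Curl a b :: T) ps = - (A ^+ 3 * delta A ^+ 2 * ev A f T ((a, b) :: ps)).
Proof. by rewrite /= big_seq1 /mval /mpos /mneg /mloop /= !expr0 !expr1; ring. Qed.

Lemma ev_Join f a b T ps : ev A f (Join a b :: T) ps = delta A ^+ 2 * ev A f T ((a, b) :: ps).
Proof. by rewrite /= big_seq1 /mval /mpos /mneg /mloop /= !expr0; ring. Qed.

Lemma ev_Arc f a b T ps : ev A f (Arc a b :: T) ps = ev A f T ((a, b) :: ps).
Proof. by rewrite /= big_seq1 /mval /mpos /mneg /mloop /= !expr0; ring. Qed.

Lemma main_Curl a b T ps : main (Curl a b :: T) ps = A ^+ 3 * D ^+ 2 * main T ((a, b) :: ps).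
Proof.
by rewrite /main -(rank_mid _ (Curl a b)) /= /xings /curls /= add0n mulnDr addnCA exprD !exprS expr0; ring.
Qed.

Lemma main_Join a b T ps : main (Join a b :: T) ps = D ^+ 2 * main T ((a, b) :: ps).
Proof. by rewrite /main -(rank_mid _ (Join a b)) /= /xings /curls /= !exprS expr0; ring. Qed.

Lemma main_Arc a b T ps : main (Arc a b :: T) ps = main T ((a, b) :: ps).
Proof. by rewrite /main -(rank_mid _ (Arc a b)). Qed.

(** The other smoothing replaces [A] by [A^-1] and creates at most one circle, worth at most
    [2 * A ^+ 2]: loss and gain balance up to the factor 2. *)
Lemma main_Xing_other a b c d T ps :
  D ^+ 4 * (A^-1 * main T [:: (b, c), (d, a) & ps]) <= 2 * main (Xing a b c d :: T) ps.
Proof.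
rewrite main_Xing [X in _ <= X]mulrCA ler_pM2l ?exprn_gt0 // /main.
set M := A ^+ _ * _; have M0 : 0 <= M by rewrite !mulr_ge0 ?exprn_ge0 ?(ltW D0) ?(ltW Apos).
have h := rank_crossing a b c d (pairs T ++ ps).
have pm p q : rank id (pairs T ++ [:: p, q & ps]) = rank id [:: p, q & pairs T ++ ps].
  by apply: rank_perm; rewrite -[[:: p, q & ps]]/([:: p; q] ++ ps) perm_catCA.
rewrite !pm; set rA := rank _ [:: (a, b), _ & _] in h *; set rB := rank _ _ in h *.
have le_rank : D^-1 ^+ rB <= D * D^-1 ^+ rA.
  rewrite !exprVn -(ler_pM2l (exprn_gt0 rA D0)) mulrCA divff ?expf_neq0 ?lt0r_neq0 // mulr1.
  rewrite ler_pdivrMr ?exprn_gt0 // -exprS; apply: ler_weXn2l => //.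
  by move: h; rewrite addn1; apply: leq_trans; apply: leq_addr.
have key : A^-1 * D^-1 ^+ rB <= 2 * A * D^-1 ^+ rA.
  rewrite -(ler_pM2l Apos) mulVKf //; apply: (le_trans le_rank).
  rewrite mulrA ler_wpM2r ?exprn_ge0 ?invr_ge0 ?(ltW D0) //.
  by rewrite mulrCA -expr2.
have -> : A^-1 * (M * D^-1 ^+ rB) = M * (A^-1 * D^-1 ^+ rB) by ring.
have -> : 2 * (A * (M * D^-1 ^+ rA)) = M * (2 * A * D^-1 ^+ rA) by ring.
exact: ler_wpM2l.
Qed.

(** Two different circles meet at the crossing, so the other smoothing creates none and the loss of
    [A ^+ 2] is not compensated. *)
Lemma main_Xing_adequate a b c d T ps (f := glues id (pairs (Xing a b c d :: T) ++ ps)) :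
  f a != f c ->
  D ^+ 4 * (A^-1 * main T [:: (b, c), (d, a) & ps]) <= main (Xing a b c d :: T) ps * A^-1 ^+ 2.
Proof.
move=> fac; rewrite main_Xing.
have -> : D ^+ 4 * (A * main T [:: (a, b), (c, d) & ps]) * A^-1 ^+ 2
    = D ^+ 4 * (A^-1 * main T [:: (a, b), (c, d) & ps]).
  by rewrite -mulrA; congr (_ * _); rewrite mulrC expr2 -mulrA mulKf.
rewrite ler_pM2l ?exprn_gt0 // ler_pM2l ?invr_gt0 // /main ler_wpM2l //.
  by rewrite !mulr_ge0 ?exprn_ge0 ?(ltW Apos) ?(ltW D0).
have h : (rank id [:: (a, b), (c, d) & pairs T ++ ps] + (f a != f c)
    <= rank id [:: (b, c), (d, a) & pairs T ++ ps] + 1)%N by exact: rank_crossing.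
rewrite fac in h.
have pm p q : rank id (pairs T ++ [:: p, q & ps]) = rank id [:: p, q & pairs T ++ ps].
  by apply: rank_perm; rewrite -[[:: p, q & ps]]/([:: p; q] ++ ps) perm_catCA.
rewrite !pm !exprVn lef_pV2 ?posrE ?exprn_gt0 //; apply: ler_weXn2l => //.
by move: h; rewrite leq_add2r.
Qed.

(** Each crossing costs a factor 3: 1 for its [A]-smoothing and at most 2 for the other one. *)
Lemma ev_upper T ps : `|ev A id T ps| <= 3 ^+ xings T * main T ps.
Proof.
elim: T ps => [|v T IH] ps.
  by rewrite /= normrX normfV /main /= !expr0 !mul1r.
case: v => [a b c d|a b|a b|a b].
- rewrite ev_Xing normrM normrX -/D.
  have hA := IH [:: (a, b), (c, d) & ps]; have hB := IH [:: (b, c), (d, a) & ps].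
  have h3 : 0 <= 3 ^+ xings T :> rat by rewrite exprn_ge0.
  apply: le_trans (_ : D ^+ 4 * (A * (3 ^+ xings T * main T [:: (a, b), (c, d) & ps])
      + A^-1 * (3 ^+ xings T * main T [:: (b, c), (d, a) & ps])) <= _).
    rewrite ler_pM2l ?exprn_gt0 //; apply: le_trans (ler_normD _ _) _.
    by rewrite !normrM normfV !(gtr0_norm Apos) lerD // ler_pM2l ?invr_gt0.
  have -> : 3 ^+ xings (Xing a b c d :: T) = 3 * 3 ^+ xings T :> rat by rewrite -exprS.
  have := ler_wpM2l h3 (main_Xing_other a b c d T ps); rewrite main_Xing.
  set m1 := main T [:: (a, b), _ & _]; set m2 := main T [:: (b, c), _ & _]; move=> h.
  have e : D ^+ 4 * (A^-1 * (3 ^+ xings T * m2)) = 3 ^+ xings T * (D ^+ 4 * (A^-1 * m2)) by ring.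
  have e' : D ^+ 4 * (A * (3 ^+ xings T * m1)) = 3 ^+ xings T * (D ^+ 4 * (A * m1)) by ring.
  rewrite [X in X <= _]mulrDr e e'; move: h; set z := 3 ^+ _ * (D ^+ 4 * (A^-1 * m2)); set y := 3 ^+ xings T * (D ^+ 4 * (A * m1)).
  have -> : 3 * 3 ^+ xings T * (D ^+ 4 * (A * m1)) = 3 * y by rewrite /y; ring.
  have -> : 3 ^+ xings T * (2 * (D ^+ 4 * (A * m1))) = 2 * y by rewrite /y; ring.
  by move=> h; lra.
- rewrite ev_Curl main_Curl normrN 2!normrM !normrX (gtr0_norm Apos) -/D [X in _ <= X]mulrCA.
  by rewrite ler_pM2l // mulr_gt0 ?exprn_gt0.
- by rewrite ev_Join main_Join normrM normrX -/D [X in _ <= X]mulrCA ler_pM2l // exprn_gt0.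
- by rewrite ev_Arc main_Arc.
Qed.

(** [main] with its sign: both [delta A] and the factor [- A ^+ 3] of a curl are negative. *)
Definition leading (T : tangle) (ps : seq (nat * nat)) : rat :=
  A ^+ xings T * (- A ^+ 3) ^+ curls T * delta A ^+ size (nodes T)
    * (delta A)^-1 ^+ rank id (pairs T ++ ps).

Lemma norm_leading T ps : `|leading T ps| = main T ps.
Proof.
rewrite /leading /main 3!normrM !normrX normrN normfV normrX (gtr0_norm Apos) -/D.
by rewrite exprD exprM.
Qed.

(** A state other than the all-[A] state has a first [B]-smoothing. There adequacy gains
    [A^-1 ^+ 2], and the remaining crossings are bounded by [ev_upper]. The pairs [ps] come from
    [A]-smoothings only, hence are compatible with [c]. *)
Lemma ev_lower o c T ps : all (vadequate o c) T -> {in ps, forall p, c p.1 = c p.2} ->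
  `|ev A id T ps - leading T ps| <= 3 ^+ xings T * (main T ps * A^-1 ^+ 2).
Proof.
elim: T ps => [|v T IH] ps ad hps.
  rewrite /leading /= !expr0 !mul1r subrr normr0.
  by rewrite mulr_ge0 ?main_ge0 ?exprn_ge0 ?invr_ge0 ?(ltW Apos).
have /andP[adv adT] : vadequate o c v && all (vadequate o c) T := ad.
have hps' : {in vpairs v ++ ps, forall p, c p.1 = c p.2}.
  move=> p; rewrite mem_cat => /orP[hp|/hps //].
  by have /andP[/allP/(_ _ hp)/andP[_ /eqP]] := adv.
have hall : {in pairs (v :: T) ++ ps, forall p, c p.1 = c p.2}.
  move=> p; rewrite mem_cat => /orP[/flatten_mapP[w hw hp]|/hps //].
  by have /andP[/allP/(_ _ hp)/andP[_ /eqP]] := allP ad _ hw.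
have lead_mid v' : rank id (pairs T ++ vpairs v' ++ ps) = rank id (pairs (v' :: T) ++ ps).
  exact: rank_mid.
have {}IH := IH _ adT hps'; case: v adv ad IH hps' hall => [a b x d|a b|a b|a b] adv ad IH hps' hall.
(* [c] is constant on everything glued so far and separates [a] from [x], so these two are not
   glued. *)
- have fac : glues id (pairs (Xing a b x d :: T) ++ ps) a
      != glues id (pairs (Xing a b x d :: T) ++ ps) x.
    have /andP[_ ne] := adv; apply: contra ne => e; apply/eqP; exact: glues_finest e.
  have eB := main_Xing_adequate fac; have eU := ev_upper T [:: (b, x), (d, a) & ps].
  have -> : leading (Xing a b x d :: T) ps
      = delta A ^+ 4 * (A * leading T [:: (a, b), (x, d) & ps]).
    rewrite /leading -(lead_mid (Xing a b x d)) /= /xings /curls /= !exprS expr0; ring.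
  rewrite ev_Xing -mulrBr addrAC -mulrBr normrM normrX -/D.
  have h3 : 0 <= 3 ^+ xings T :> rat by rewrite exprn_ge0.
  apply: le_trans (_ : D ^+ 4 * (A * (3 ^+ xings T * (main T [:: (a, b), (x, d) & ps] * A^-1 ^+ 2))
      + A^-1 * (3 ^+ xings T * main T [:: (b, x), (d, a) & ps])) <= _).
    rewrite ler_pM2l ?exprn_gt0 //; apply: le_trans (ler_normD _ _) _.
    by rewrite !normrM normfV !(gtr0_norm Apos) lerD // ler_pM2l ?invr_gt0.
  have -> : 3 ^+ xings (Xing a b x d :: T) = 3 * 3 ^+ xings T :> rat by rewrite -exprS.
  have := ler_wpM2l h3 eB; have M0 := main_ge0 T [:: (a, b), (x, d) & ps].
  have I0 : 0 <= A^-1 ^+ 2 by rewrite exprn_ge0 // invr_ge0 ltW.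
  rewrite main_Xing; move: I0 M0.
  set m1 := main T [:: (a, b), _ & _]; set m2 := main T [:: (b, x), _ & _]; set I := A^-1 ^+ 2 => I0 M0 h.
  have e1 : D ^+ 4 * (A^-1 * (3 ^+ xings T * m2)) = 3 ^+ xings T * (D ^+ 4 * (A^-1 * m2)) by ring.
  have e2 : D ^+ 4 * (A * (3 ^+ xings T * (m1 * I))) = 3 ^+ xings T * (D ^+ 4 * (A * m1) * I) by ring.
  have p : 0 <= 3 ^+ xings T * (D ^+ 4 * (A * m1) * I).
    exact: mulr_ge0 h3 (mulr_ge0 (mulr_ge0 (exprn_ge0 _ (ltW D0)) (mulr_ge0 (ltW Apos) M0)) I0).
  rewrite [X in X <= _]mulrDr e1 e2; move: h p; set z := 3 ^+ _ * (D ^+ 4 * (A^-1 * m2)); set y := 3 ^+ xings T * (D ^+ 4 * (A * m1) * I).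
  have -> : 3 * 3 ^+ xings T * (D ^+ 4 * (A * m1) * I) = 3 * y by rewrite /y; ring.
  by move=> h p; lra.
- have -> : leading (Curl a b :: T) ps = - (A ^+ 3 * delta A ^+ 2 * leading T ((a, b) :: ps)).
    rewrite /leading -(lead_mid (Curl a b)) /= /xings /curls /= !exprS expr0; ring.
  rewrite ev_Curl main_Curl -opprD normrN -mulrN -mulrDr 2!normrM !normrX.
  rewrite (gtr0_norm Apos) -/D -[X in _ <= _ * X]mulrA [X in _ <= X]mulrCA ler_pM2l // mulr_gt0 ?exprn_gt0 //.
- have -> : leading (Join a b :: T) ps = delta A ^+ 2 * leading T ((a, b) :: ps).
    rewrite /leading -(lead_mid (Join a b)) /= /xings /curls /= !exprS expr0; ring.
  by rewrite ev_Join main_Join -mulrBr normrM normrX -/D -[X in _ <= _ * X]mulrA [X in _ <= X]mulrCA ler_pM2l // exprn_gt0.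
- have -> : leading (Arc a b :: T) ps = leading T ((a, b) :: ps).
    by rewrite /leading -(lead_mid (Arc a b)).
  by rewrite ev_Arc main_Arc.
Qed.

(** For [A] this large the error in [ev_lower] is at most half of the leading term. The factor
    [D ^+ circles T], which is at least 1, is dropped: only the power of [A] from crossings and
    curls is needed. *)
Lemma bracket_lower T : adequate T -> wf T -> 2 * 3 ^+ xings T <= A ^+ 2 ->
  A ^+ (xings T + 3 * curls T) <= 2 * `|bracket A T|.
Proof.
move=> [o [c ad]] w hA; have := @ev_lower o c T [::] ad (fun _ => ltac:(by [])).
rewrite -/(bracket A T) exprVn => h.
have hm : main T [::] <= 2 * `|bracket A T|.
  have : 3 ^+ xings T * (main T [::] / A ^+ 2) <= main T [::] / 2.
    rewrite mulrCA ler_wpM2l ?main_ge0 // ler_pdivrMr ?exprn_gt0 //.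
    rewrite mulrC ler_pdivlMr //; lra.
  have := ler_normD (leading T [::] - bracket A T) (bracket A T).
  by rewrite subrK norm_leading distrC; lra.
apply: le_trans hm; rewrite /main cats0 -mulrA ler_peMr ?exprn_ge0 ?(ltW Apos) //.
have -> : size (nodes T) = (circles T + rank id (pairs T))%N by rewrite circles_rank // addnC.
by rewrite exprD exprVn mulfK ?expf_neq0 ?lt0r_neq0 // exprn_ege1.
Qed.

Lemma bracket_upper T : wf T ->
  `|bracket A T| <= 3 ^+ xings T * 2 ^+ circles T * A ^+ (xings T + 3 * curls T + 2 * circles T).
Proof.
move=> w; apply: le_trans (ev_upper T [::]) _.
rewrite -mulrA ler_pM2l ?exprn_gt0 // /main cats0.
have -> : size (nodes T) = (circles T + rank id (pairs T))%N by rewrite circles_rank // addnC.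
rewrite -[X in X <= _]mulrA [D ^+ _]exprD exprVn mulfK ?expf_neq0 ?lt0r_neq0 //.
rewrite [A ^+ (_ + 2 * _)]exprD [X in _ <= X]mulrCA ler_pM2l ?exprn_gt0 // exprM -exprMn.
by rewrite lerXn2r ?nnegrE ?mulr_ge0 ?exprn_ge0 ?(ltW D0) ?(ltW Apos).
Qed.

End Degree.

(** Were the inequality false, the equal values of the two brackets would grow at different rates;
    one sufficiently large [A] shows the contradiction. *)
Lemma degree_bound T U : adequate T -> teq T U -> wf T ->
  (xings T + 3 * curls T <= xings U + 3 * curls U + 2 * circles U)%N.
Proof.
move=> ad e w; have wU := w; rewrite (teq_wf e) in wU.
rewrite leqNgt; apply/negP; set m := (_ + _)%N; set n := (_ + _)%N => lt_mn.
(* Large enough for [bracket_lower] on [T], and larger than twice the constant of [bracket_upper] on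
   [U], so that this constant cannot make up for one power of [A]. *)
pose k := (2 * (3 ^ xings T + 3 ^ xings U * 2 ^ circles U)).+1%N.
pose A : rat := k%:R.
have A1 : 1 <= A by rewrite ler1n.
have kA : (2 * 3 ^ xings T + 2 * (3 ^ xings U * 2 ^ circles U))%N%:R < A.
  by rewrite ltr_nat /k; lia.
have hl : A ^+ n <= 2 * `|bracket A T|.
  apply: bracket_lower => //; apply: (@le_trans _ _ A); last by rewrite expr2 ler_peMl // (le_trans _ A1).
  apply: le_trans (ltW kA); rewrite natrD natrM !natrX lerDl; exact: ler0n.
have hu := bracket_upper A1 wU.
have A0 : A != 0 by apply: lt0r_neq0; apply: lt_le_trans A1.
rewrite -(bracket_teq A0 e) -/m in hu.
have : A ^+ m.+1 <= A ^+ n by apply: ler_weXn2l.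
have Am : 0 < A ^+ m by rewrite exprn_gt0 // (lt_le_trans _ A1).
rewrite exprS leNgt => /negP[]; apply: le_lt_trans hl _.
apply: (@le_lt_trans _ _ (2 * (3 ^+ xings U * 2 ^+ circles U) * A ^+ m)).
  by rewrite -mulrA ler_pM2l.
rewrite ltr_pM2r //; apply: le_lt_trans kA; rewrite natrD !natrM !natrX lerDr.
by rewrite mulr_ge0 ?exprn_ge0.
Qed.

Local Close Scope ring_scope.

(** * Doubles of adequate tangles *)

Definition lookup (S : Type) (s0 : S) (l : seq (nat * S)) (z : nat) : S :=
  if [seq p <- l | p.1 == z] is p :: _ then p.2 else s0.

Lemma lookupE (S : eqType) (s0 : S) l z s :
  uniq (map fst l) -> (z, s) \in l -> lookup s0 l z = s.
Proof.
elim: l => //= -[z1 s1] l IH /andP[h u]; rewrite inE /lookup /=.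
case: (eqVneq z1 z) => [e|ne] /=; last by move=> /orP[/eqP[e _]|/(IH u)]; first by rewrite e eqxx in ne.
case/orP=> [/eqP[_ ->] //|hz]; case/negP: h; rewrite e.
exact: (map_f fst hz).
Qed.

Section AdequateDouble.
Variables (o : nat -> bool) (c : nat -> nat).

(* The two parallel copies of a circle are distinguished by the side of it on which
   they run. *)
Let side0 x := 2 * c x + o x.
Let side1 x := 2 * c x + ~~ o x.

Definition ends_table (x : nat) : seq (nat * (bool * nat)) :=
  [:: (copy 0 x, (o x, side0 x)); (copy 1 x, (o x, side1 x))].

(** The orientation and the circle of every end in a cable; those of the inner ends are found by
    following the [A]-state to an outer end. Arcs have no entry, as their ends are listed at the
    vertices. *)
Definition vtable (v : vertex) : seq (nat * (bool * nat)) :=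
  match v with
  | Xing a b x d => ends_table a ++ ends_table b ++ ends_table x ++ ends_table d ++ [::
      (copy 2 d, (~~ o a, side0 a)); (copy 3 a, (o a, side0 a));
      (copy 2 a, (~~ o a, side0 a)); (copy 3 b, (o a, side0 a));
      (copy 2 b, (~~ o x, side0 x)); (copy 3 x, (o x, side0 x));
      (copy 2 x, (~~ o x, side0 x)); (copy 3 d, (o x, side0 x))]
  | Curl a b => ends_table a ++ ends_table b ++ [::
      (copy 2 a, (~~ o a, side0 a)); (copy 2 b, (o a, side0 a));
      (copy 4 b, (~~ o a, side0 a)); (copy 7 b, (o a, side0 a));
      (copy 3 a, (~~ o a, side1 a)); (copy 3 b, (o a, side1 a));
      (copy 5 b, (~~ o a, side1 a)); (copy 6 b, (o a, side1 a))]
  | Join a b => ends_table a ++ ends_table b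
  | Arc _ _ => [::]
  end.

Lemma vtable_keys v : perm_eq (map fst (vtable v)) (nodes (vdbl v)).
Proof.
by case: v => [a b x d|a b|a b|a b]; apply/permP => p; rewrite /= ?addn0; perm_counts.
Qed.

Let table T := flatten (map vtable T).

Lemma table_keys T : perm_eq (map fst (table T)) (nodes (dbl T)).
Proof.
elim: T => // v T IH; rewrite /table /= map_cat dbl_cons nodes_cat.
exact: perm_cat (vtable_keys v) IH.
Qed.

Ltac use_table := repeat match goal with
  | H : ?L (copy ?i ?x) = _ |- context [?L (copy ?i ?x)] => rewrite H end.

(** Of the four crossings in the cable of a crossing, two separate copies of the two circles that
    meet there, and the other two separate the two copies of one circle. The latter also holds for
    both crossings of the twist replacing a curl. All of it is a finite check on the table. *)
Lemma dbl_vadequate T : wf T -> all (vadequate o c) T -> adequate (dbl T).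
Proof.
move=> w ad; pose L := lookup (false, 0) (table T).
have uk : uniq (map fst (table T)).
  by rewrite (perm_uniq (table_keys T)); case/andP: (wf_dbl w).
have LE v z s : v \in T -> (z, s) \in vtable v -> L z = s.
  by move=> hv hz; apply: lookupE uk _; apply/flatten_mapP; exists v.
have Lend x : x \in nodes T -> L (copy 0 x) = (o x, side0 x) /\ L (copy 1 x) = (o x, side1 x).
  case/flatten_mapP=> v hv hx; split; apply: (LE v) => //;
  case: v hx {hv} => [a b y d|a b|a b|a b] //; rewrite [vnode _]/= !inE;
  do ?[case/orP]; move/eqP->; by rewrite /vtable /ends_table /= !eqxx ?orbT.
have flip (b1 b2 : bool) : b1 != b2 -> b2 = ~~ b1 by case: b1; case: b2.
exists (fst \o L), (snd \o L); apply/allP => u /flatten_mapP[v hv].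
have := allP ad v hv.
have {LE} : all (fun e => L e.1 == e.2) (vtable v) by apply/allP => -[z s] /(LE v _ _ hv) /= ->.
case: v hv => [a b x d|a b|a b|a b] hv.
- rewrite /= => tb; rewrite /vadequate /= andbT -!andbA.
  move: tb; do 16![case/andP=> /eqP ?]; move=> _.
  case/and5P => /flip ob /eqP cb /flip od /eqP cd ne.
  rewrite !inE; do 7?[case/orP]; move/eqP->; rewrite /vadequate /=; use_table;
  rewrite /= ?andbT /side0 /side1 ?ob ?od -?cb -?cd ?eqxx /=;
  move: ne; case: (o a); case: (o x) => /= ?; lia.
- rewrite /= => tb; rewrite /vadequate /= !andbT.
  move: tb; do 12![case/andP=> /eqP ?]; move=> _.
  case/andP => /flip ob /eqP cb.
  rewrite !inE; do 7?[case/orP]; move/eqP->; rewrite /vadequate /=; use_table;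
  rewrite /= ?andbT /side0 /side1 ?ob -?cb ?eqxx /=;
  case: (o a) => /=; lia.
- rewrite /= => tb; rewrite /vadequate /= !andbT.
  move: tb; do 4![case/andP=> /eqP ?]; move=> _.
  case/andP => /flip ob /eqP cb.
  rewrite !inE; do 1?[case/orP]; move/eqP->; rewrite /vadequate /=; use_table;
  rewrite /= ?andbT /side0 /side1 ?ob -?cb ?eqxx /=;
  case: (o a) => /=; lia.
- move=> _; rewrite /vadequate /= !andbT => /andP[/flip ob /eqP cb].
  have [] : a \in nodes T /\ b \in nodes T.
    have /andP[_ p] := w; rewrite !(perm_mem p).
    by split; apply/flatten_mapP; exists (Arc a b); rewrite //= !inE eqxx ?orbT.
  move=> /Lend[? ?] /Lend[? ?].
  rewrite !inE; do 1?[case/orP]; move/eqP->; rewrite /vadequate /=; use_table;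
  rewrite /= ?andbT /side0 /side1 ?ob -?cb ?eqxx /=;
  case: (o a) => /=; lia.
Qed.
End AdequateDouble.

Lemma adequate_dbl T : wf T -> adequate T -> adequate (dbl T).
Proof. by move=> w [o [c ad]]; apply: dbl_vadequate ad. Qed.

Lemma vdbl_pairs T v (f := glues id (pairs (dbl T))) : v \in T ->
  all (fun p => f p.1 == f p.2) (pairs (vdbl v)).
Proof.
move=> hv; apply/allP => p /flatten_mapP[u hu hp]; apply: glues_pair.
by apply/flatten_mapP; exists u => //; apply/flatten_mapP; exists v.
Qed.

Lemma pairs_dbl_copy T p (f := glues id (pairs (dbl T))) : p \in pairs T ->
  f (copy 0 p.1) = f (copy 1 p.2) /\ f (copy 1 p.1) = f (copy 0 p.2).
Proof.
case/flatten_mapP=> v /vdbl_pairs; rewrite -/f; move: f => f.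
case: v => [a b x d|a b|a b|a b]; rewrite /= !inE ?andbT.
- by do 11![case/andP=> /eqP ?]; move/eqP=> ? /orP[]/eqP-> /=; split; congruence.
- by do 9![case/andP=> /eqP ?]; move/eqP=> ? /eqP-> /=; split; congruence.
- by case/andP=> /eqP ? /eqP ? /eqP-> /=; split; congruence.
- by case/andP=> /eqP ? /eqP ? /eqP-> /=; split; congruence.
Qed.

Lemma inner_copy T z (f := glues id (pairs (dbl T))) : z \in nodes (dbl T) ->
  exists2 x, x \in nodes T & f z = f (copy 0 x) \/ f z = f (copy 1 x).
Proof.
case/flatten_mapP=> u /flatten_mapP[v hv hu] hz.
have {hu}hz : z \in nodes (vdbl v) by apply/flatten_mapP; exists u.
have hx x : x \in vnode v -> x \in nodes T by move=> h; apply/flatten_mapP; exists v.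
move: hz; rewrite (perm_mem (vdbl_nodes v)) mem_cat => /orP[].
  by rewrite mem_cat => /orP[]/mapP[x /hx ? ->]; exists x => //; [left|right].
suff : all (fun z => has (fun x => (f z == f (copy 0 x)) || (f z == f (copy 1 x))) (vnode v)) (vinner v).
  by move/allP=> h /h/hasP[x /hx ? /orP[]/eqP ?]; exists x => //; [left|right].
have := vdbl_pairs hv; rewrite -/f; move: f => {hv hx} f.
case: v => [a b x d|a b|a b|a b] //=; rewrite ?andbT ?orbF.
- do 11![case/andP=> /eqP ?]; move/eqP=> ?.
  repeat (apply/andP; split);
  first [by rewrite (_ : f _ = f (copy 0 a)) ?eqxx /= ?orbT //; congruence
             |by rewrite (_ : f _ = f (copy 0 x)) ?eqxx /= ?orbT //; congruence].
- do 9![case/andP=> /eqP ?]; move/eqP=> ?.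
  repeat (apply/andP; split);
  first [by rewrite (_ : f _ = f (copy 0 a)) ?eqxx /= ?orbT //; congruence
             |by rewrite (_ : f _ = f (copy 1 a)) ?eqxx /= ?orbT //; congruence].
Qed.

(** Every end in a cable lies on the circle of an outer copy, by [inner_copy], and the two circles
    above an end do not change along a circle of [T]; so at most two circles lie above each
    circle. *)
Lemma circles_dbl T : circles (dbl T) <= 2 * circles T.
Proof.
set f := glues id (pairs (dbl T)); set g := glues id (pairs T).
pose rep v := nth 0 (nodes T) (index v (map g (nodes T))).
pose R := [seq rep v | v <- undup (map g (nodes T))].
have gR x : x \in nodes T -> exists2 r, r \in R & g x = g r.
  move=> hx; have hgx := map_f g hx; exists (rep (g x)).
    by apply: map_f; rewrite mem_undup.
  by rewrite /rep -(nth_map 0 0) ?nth_index // -(size_map g) index_mem.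
have fR x r : g x = g r -> (f (copy 0 x) = f (copy 0 r) /\ f (copy 1 x) = f (copy 1 r)) \/
    (f (copy 0 x) = f (copy 1 r) /\ f (copy 1 x) = f (copy 0 r)).
  move=> e; pose h z := (minn (f (copy 0 z)) (f (copy 1 z)), maxn (f (copy 0 z)) (f (copy 1 z))).
  have : h x = h r.
    apply: (@glues_finest _ h (pairs T)) => [p hp|]; last exact/eqP.
    by have [e1 e2] := pairs_dbl_copy hp; rewrite -/f in e1 e2; rewrite /h e1 e2 minnC maxnC.
  by case; move: (f _) (f _) (f _) (f _) => a b a' b'; lia.
have -> : 2 * circles T = size [seq f (copy i r) | r <- R, i <- [:: 0; 1]].
  by rewrite size_allpairs /= size_map mulnC.
apply: uniq_leq_size; first exact: undup_uniq.
move=> y; rewrite mem_undup => /mapP[z /inner_copy[x hx hz] ->{y}].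
have [r hr /fR hxr] := gR x hx.
have m0 : f (copy 0 r) \in [seq f (copy i r) | r <- R, i <- [:: 0; 1]].
  by apply/allpairsP; exists (r, 0).
have m1 : f (copy 1 r) \in [seq f (copy i r) | r <- R, i <- [:: 0; 1]].
  by apply/allpairsP; exists (r, 1).
rewrite -/f in hz *.
by case: hxr => -[e0 e1]; case: hz => ->; rewrite ?e0 ?e1.
Qed.

Lemma xings_curls_dbl T : xings (dbl T) = 4 * xings T + 2 * curls T /\ curls (dbl T) = 2 * curls T.
Proof.
elim: T => // v T [IH1 IH2]; rewrite dbl_cons /xings /curls !count_cat -!/(xings _) -!/(curls _).
by rewrite -/(xings (dbl T)) -/(curls (dbl T)) IH1 IH2; case: v => [a b x d|a b|a b|a b] /=; lia.
Qed.

Lemma adequate_crossing_bound T U : wf T -> adequate T -> teq T U ->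
  xings T + curls T <= xings U + curls U.
Proof.
move=> w ad e.
have gen k : let Tk := iter k dbl T in let Uk := iter k dbl U in
  [/\ wf Tk, adequate Tk, teq Tk Uk & circles Uk <= 2 ^ k * circles U].
  elim: k => [|k /= [w' ad' e' hc]]; first by rewrite /= mul1n.
  split; [exact: wf_dbl|exact: adequate_dbl|exact: teq_dbl|].
  by apply: leq_trans (circles_dbl _) _; rewrite expnS -mulnA leq_mul2l hc orbT.
have count k V : xings (iter k dbl V) + 2 ^ k * curls V = 4 ^ k * (xings V + curls V)
    /\ curls (iter k dbl V) = 2 ^ k * curls V.
  elim: k => [|k [h1 h2]]; first by rewrite /= !mul1n.
  have [e1 e2] := xings_curls_dbl (iter k dbl V).
  by rewrite iterS e1 e2 h2 !expnS; split; lia.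
pose m := 2 * (curls U + circles U).
have [wm adm em hc] := gen m.
have := degree_bound adm em wm.
have [a1 a2] := count m T; have [b1 b2] := count m U.
rewrite a2 b2 => h.
have m2 : m < 2 ^ m by exact: ltn_expl.
have e4 : 4 ^ m = 2 ^ m * 2 ^ m by rewrite -[4]/(2 * 2) expnMn.
rewrite leqNgt; apply/negP => lt.
have : 4 ^ m * (xings U + curls U).+1 <= 4 ^ m * (xings T + curls T) by rewrite leq_mul2l lt orbT.
have : 2 ^ m * m < 2 ^ m * 2 ^ m by rewrite ltn_mul2l m2 expn_gt0.
rewrite mulnS -a1 -b1 e4 {3}/m; nia.
Qed.

(** * Adding curls *)

(** Renaming an end on the arcs only, or at the vertices only, cuts the edge there and makes room
    for a curl. *)
Definition arc_map (g : nat -> nat) (T : tangle) : tangle :=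
  [seq (if v is Arc a b then Arc (g a) (g b) else v) | v <- T].

Definition node_map (g : nat -> nat) (T : tangle) : tangle :=
  [seq (if v is Arc _ _ then v else vmap g v) | v <- T].

Definition update (x y z : nat) : nat := if z == x then y else z.

(** The vertex keeps the end [x], and the old arc now ends at [q]. Old vertices are unchanged, so a
    rule elsewhere still applies. *)
Definition add_curl (T : tangle) (x p q : nat) : tangle :=
  arc_map (update x q) T ++ [:: Arc x p; Curl p q].

(* The result of [add_curl T x p q], up to renaming, when the arc at [x] lies outside
   of [T]. *)
Definition add_outer_curl (T : tangle) (x p q : nat) : tangle :=
  node_map (update x p) T ++ [:: Arc p q; Curl q x].

(** One list per rule. An entry says that a curl at the arc end [x] of the left side can be traded
    for a curl at [y] on the right side. If the flag is set, [y] lies on the boundary and the curl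
    is pushed out of the local tangle, as for the arcs that a second move destroys. *)
Definition curl_certificates : seq (seq (nat * bool * nat * certificate)) := [::
   [:: ((0, false, 0), ([::],
     [::]));
     ((1, false, 0), ([::],
     [:: (20, 21); (21, 20)]));
     ((0, false, 1), ([::],
     [:: (20, 21); (21, 20)]))];
   [::];
   [::];
   [::];
   [:: ((0, false, 0), ([:: (4, [:: 21; 1; 2; 3])],
     [::]));
     ((1, false, 0), ([:: (4, [:: 20; 1; 2; 3])],
     [:: (20, 21); (21, 20)]));
     ((2, false, 0), ([:: (4, [:: 0; 1; 2; 20])],
     [::]));
     ((3, false, 0), ([:: (4, [:: 0; 1; 2; 21])],
     [:: (20, 21); (21, 20)]));
     ((0, false, 3), ([:: (4, [:: 21; 1; 2; 3])],
     [:: (20, 21); (21, 20)]))];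
   [:: ((2, true, 0), ([:: (10, [:: 21; 20; 2; 3; 0; 1]); (5, [:: 20; 1; 21; 3; 4; 5; 6; 7])],
     [:: (2, 21)]));
     ((3, true, 1), ([:: (11, [:: 21; 20; 3; 2; 0; 1]); (5, [:: 0; 20; 2; 21; 4; 5; 6; 7])],
     [:: (3, 21)]));
     ((4, true, 0), ([:: (10, [:: 20; 21; 2; 3; 0; 1]); (5, [:: 21; 1; 20; 3; 4; 5; 6; 7])],
     [:: (2, 21); (21, 20)]));
     ((7, true, 1), ([:: (11, [:: 20; 21; 3; 2; 0; 1]); (5, [:: 0; 21; 2; 20; 4; 5; 6; 7])],
     [:: (3, 21); (21, 20)]))];
   [:: ((6, false, 6), ([:: (10, [:: 20; 21; 7; 4; 0; 10]); (6, [:: 21; 1; 2; 3; 4; 5; 6; 20; 8; 9; 10; 11]); (10, [:: 0; 7; 21; 2; 6; 8])],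
     [:: (6, 21); (7, 6); (20, 7); (21, 20)]));
     ((7, false, 6), ([:: (10, [:: 20; 21; 6; 8; 1; 3]); (6, [:: 0; 21; 2; 3; 4; 5; 20; 7; 8; 9; 10; 11]); (10, [:: 1; 6; 21; 10; 7; 5])],
     [:: (6, 7); (7, 20); (20, 6)]));
     ((8, false, 8), ([:: (10, [:: 20; 21; 9; 11; 2; 5]); (6, [:: 0; 1; 21; 3; 4; 5; 6; 7; 8; 20; 10; 11]); (11, [:: 2; 9; 21; 0; 6; 8])],
     [:: (8, 21); (9, 8); (20, 9); (21, 20)]));
     ((9, false, 8), ([:: (10, [:: 21; 20; 9; 11; 2; 5]); (6, [:: 0; 1; 20; 3; 4; 5; 6; 7; 8; 21; 10; 11]); (11, [:: 2; 9; 20; 0; 6; 8])],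
     [:: (8, 21); (9, 8); (21, 9)]));
     ((10, false, 10), ([:: (11, [:: 20; 21; 11; 9; 2; 5]); (6, [:: 0; 1; 2; 3; 4; 21; 6; 7; 8; 9; 10; 20]); (11, [:: 5; 11; 21; 7; 1; 10])],
     [:: (10, 21); (11, 10); (20, 11); (21, 20)]));
     ((11, false, 10), ([:: (11, [:: 20; 21; 10; 0; 7; 4]); (6, [:: 0; 1; 2; 3; 21; 5; 6; 7; 8; 9; 20; 11]); (11, [:: 4; 10; 21; 3; 9; 11])],
     [:: (10, 11); (11, 20); (20, 10)]));
     ((6, false, 7), ([:: (10, [:: 20; 21; 7; 4; 0; 10]); (6, [:: 21; 1; 2; 3; 4; 5; 6; 20; 8; 9; 10; 11]); (10, [:: 0; 7; 21; 2; 6; 8])],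
     [:: (6, 20); (7, 6); (20, 7)]));
     ((8, false, 9), ([:: (10, [:: 20; 21; 9; 11; 2; 5]); (6, [:: 0; 1; 21; 3; 4; 5; 6; 7; 8; 20; 10; 11]); (11, [:: 2; 9; 21; 0; 6; 8])],
     [:: (8, 20); (9, 8); (20, 9)]));
     ((10, false, 11), ([:: (11, [:: 20; 21; 11; 9; 2; 5]); (6, [:: 0; 1; 2; 3; 4; 21; 6; 7; 8; 9; 10; 20]); (11, [:: 5; 11; 21; 7; 1; 10])],
     [:: (10, 20); (11, 10); (20, 11)]))];
   [:: ((6, false, 6), ([:: (10, [:: 20; 21; 7; 10; 0; 5]); (7, [:: 21; 1; 2; 3; 4; 5; 6; 20; 8; 9; 10; 11]); (10, [:: 0; 7; 21; 8; 6; 2])],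
     [:: (6, 21); (7, 6); (20, 7); (21, 20)]));
     ((7, false, 6), ([:: (10, [:: 20; 21; 6; 3; 1; 8]); (7, [:: 0; 21; 2; 3; 4; 5; 20; 7; 8; 9; 10; 11]); (10, [:: 1; 6; 21; 4; 7; 10])],
     [:: (6, 7); (7, 20); (20, 6)]));
     ((8, false, 8), ([:: (10, [:: 20; 21; 9; 4; 2; 11]); (7, [:: 0; 1; 21; 3; 4; 5; 6; 7; 8; 20; 10; 11]); (11, [:: 2; 9; 21; 6; 0; 8])],
     [:: (8, 21); (9, 8); (20, 9); (21, 20)]));
     ((9, false, 8), ([:: (10, [:: 21; 20; 9; 4; 2; 11]); (7, [:: 0; 1; 20; 3; 4; 5; 6; 7; 8; 21; 10; 11]); (11, [:: 2; 9; 20; 6; 0; 8])],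
     [:: (8, 21); (9, 8); (21, 9)]));
     ((10, false, 10), ([:: (11, [:: 20; 21; 11; 2; 9; 4]); (7, [:: 0; 1; 2; 3; 21; 5; 6; 7; 8; 9; 10; 20]); (11, [:: 4; 11; 21; 1; 7; 10])],
     [:: (10, 21); (11, 10); (20, 11); (21, 20)]));
     ((11, false, 10), ([:: (11, [:: 20; 21; 10; 7; 0; 5]); (7, [:: 0; 1; 2; 3; 4; 21; 6; 7; 8; 9; 20; 11]); (11, [:: 5; 10; 21; 9; 3; 11])],
     [:: (10, 11); (11, 20); (20, 10)]));
     ((6, false, 7), ([:: (10, [:: 20; 21; 7; 10; 0; 5]); (7, [:: 21; 1; 2; 3; 4; 5; 6; 20; 8; 9; 10; 11]); (10, [:: 0; 7; 21; 8; 6; 2])],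
     [:: (6, 20); (7, 6); (20, 7)]));
     ((8, false, 9), ([:: (10, [:: 20; 21; 9; 4; 2; 11]); (7, [:: 0; 1; 21; 3; 4; 5; 6; 7; 8; 20; 10; 11]); (11, [:: 2; 9; 21; 6; 0; 8])],
     [:: (8, 20); (9, 8); (20, 9)]));
     ((10, false, 11), ([:: (11, [:: 20; 21; 11; 2; 9; 4]); (7, [:: 0; 1; 2; 3; 21; 5; 6; 7; 8; 9; 10; 20]); (11, [:: 4; 11; 21; 1; 7; 10])],
     [:: (10, 20); (11, 10); (20, 11)]))];
   [:: ((0, true, 2), ([:: (10, [:: 21; 20; 0; 1; 2; 3]); (8, [:: 21; 1; 20; 3])],
     [:: (0, 21)]));
     ((1, true, 2), ([:: (10, [:: 20; 21; 0; 1; 2; 3]); (8, [:: 20; 1; 21; 3])],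
     [:: (0, 21); (21, 20)]))];
   [:: ((1, true, 0), ([:: (10, [:: 20; 21; 2; 3; 0; 1]); (9, [:: 21; 1; 20; 3; 4; 5])],
     [:: (2, 21); (21, 20)]));
     ((2, true, 0), ([:: (10, [:: 21; 20; 2; 3; 0; 1]); (9, [:: 20; 1; 21; 3; 4; 5])],
     [:: (2, 21)]));
     ((3, true, 0), ([:: (11, [:: 21; 20; 3; 2; 0; 1]); (10, [:: 3; 1; 2; 21; 0; 20]); (9, [:: 1; 20; 3; 21; 4; 5])],
     [:: (1, 20); (2, 21)]));
     ((4, true, 0), ([:: (11, [:: 20; 21; 3; 2; 0; 1]); (10, [:: 3; 1; 2; 20; 0; 21]); (9, [:: 1; 21; 3; 20; 4; 5])],
     [:: (1, 20); (2, 21)]))];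
   [:: ((1, false, 1), ([:: (10, [:: 20; 21; 2; 3; 4; 5]); (10, [:: 0; 1; 20; 3; 21; 5])],
     [::]));
     ((2, false, 1), ([:: (10, [:: 21; 20; 2; 3; 4; 5]); (10, [:: 0; 1; 21; 3; 20; 5])],
     [:: (20, 21); (21, 20)]));
     ((1, false, 2), ([:: (10, [:: 20; 21; 2; 3; 4; 5]); (10, [:: 0; 1; 20; 3; 21; 5])],
     [:: (20, 21); (21, 20)]))];
   [:: ((1, false, 1), ([:: (11, [:: 20; 21; 2; 3; 4; 5]); (11, [:: 0; 1; 20; 3; 4; 21])],
     [::]));
     ((2, false, 1), ([:: (11, [:: 21; 20; 2; 3; 4; 5]); (11, [:: 0; 1; 21; 3; 4; 20])],
     [:: (20, 21); (21, 20)]));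
     ((1, false, 2), ([:: (11, [:: 20; 21; 2; 3; 4; 5]); (11, [:: 0; 1; 20; 3; 4; 21])],
     [:: (20, 21); (21, 20)]))]].

Definition curl_certified (r : tangle * tangle)
    (e : nat * bool * nat * certificate) : bool :=
  let x := e.1.1.1 in let y := e.1.2 in
  (x \in arcs r.1) &&
  (if e.1.1.2 then (y \in nodes r.2) && (y \notin arcs r.2) &&
     certifies e.2 (add_curl r.1 x 20 21) (add_outer_curl r.2 y 20 21)
   else (y \in arcs r.2) && certifies e.2 (add_curl r.1 x 20 21) (add_curl r.2 y 20 21)).

(** Both directions are served: every arc end on the left has a counterpart, and every arc end on
    the right is the counterpart of one on the left. *)
Definition curls_certified (r : tangle * tangle)
    (l : seq (nat * bool * nat * certificate)) : bool :=
  [&& all (curl_certified r) l,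
      all (fun x => has (fun e => e.1.1.1 == x) l) (arcs r.1)
    & all (fun y => has (fun e => ~~ e.1.1.2 && (e.1.2 == y)) l) (arcs r.2)].

Lemma rules_curls_certified : all2 curls_certified rules curl_certificates.
Proof. by vm_compute. Qed.

Lemma arcs_arc_map g T : arcs (arc_map g T) = map g (arcs T).
Proof. by elim: T => //= v T IH; rewrite !arcs_cons map_cat IH; case: v. Qed.

Lemma nodes_arc_map g T : nodes (arc_map g T) = nodes T.
Proof. by elim: T => //= v T IH; rewrite !nodes_cons IH; case: v. Qed.

Lemma arc_map_cat g T U : arc_map g (T ++ U) = arc_map g T ++ arc_map g U.
Proof. exact: map_cat. Qed.

Lemma eq_in_arc_map g h T : {in arcs T, g =1 h} -> arc_map g T = arc_map h T.
Proof.
elim: T => //= v T IH E; congr cons; last by apply: IH => x hx; apply: E; rewrite arcs_cons mem_cat hx orbT.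
by case: v E => // a b E; rewrite !E // arcs_cons !inE eqxx ?orbT.
Qed.

Lemma arc_map_id T : arc_map id T = T.
Proof. by rewrite /arc_map (eq_map (g := id)) ?map_id //; case. Qed.

Lemma arc_map_update_out x q T : x \notin arcs T -> arc_map (update x q) T = T.
Proof.
move=> hx; rewrite -[RHS]arc_map_id; apply: eq_in_arc_map => z hz.
by rewrite /update; case: eqP => // e; rewrite -e hz in hx.
Qed.

Lemma node_map_id T : node_map id T = T.
Proof. by rewrite /node_map (eq_map (g := id)) ?map_id //; case. Qed.

Definition fresh (T : tangle) (p q : nat) : bool :=
  [&& p \notin nodes T, q \notin nodes T & p != q].

Lemma wf_mem T x : wf T -> (x \in arcs T) = (x \in nodes T).
Proof. by case/andP=> _ p; rewrite (perm_mem p). Qed.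

Lemma perm_update (s : seq nat) x q : uniq s -> x \in s ->
  perm_eq (x :: map (update x q) s) (q :: s).
Proof.
move=> u hx; have p := perm_to_rem hx; have := u; rewrite (perm_uniq p) /= => /andP[nx _].
rewrite (permPl (_ : perm_eq _ (x :: map (update x q) (x :: rem x s)))); last first.
  by rewrite perm_cons perm_map.
rewrite /= {1}/update eqxx (_ : map _ (rem x s) = rem x s); last first.
  rewrite -[RHS]map_id; apply/eq_in_map => z hz; rewrite /update.
  by move: hz; case: eqP => // ->; rewrite (negbTE nx).
apply: perm_trans (_ : perm_eq _ (q :: x :: rem x s)) _.
  exact/permEl/(perm_catCA [:: x] [:: q] (rem x s)).
by rewrite perm_cons perm_sym.
Qed.

Lemma wf_add_curl T x p q : wf T -> x \in arcs T -> fresh T p q -> wf (add_curl T x p q).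
Proof.
case/andP=> u pe hx /and3P[hp hq pq]; have ua := u; rewrite (perm_uniq pe) in ua.
rewrite /wf /add_curl nodes_cat arcs_cat nodes_arc_map arcs_arc_map; apply/andP; split.
  by rewrite cat_uniq u /= orbF !inE negb_or hp hq pq.
have h1 : perm_eq (nodes T ++ [:: p; q]) (p :: q :: arcs T).
  by rewrite perm_catC /= !perm_cons.
rewrite (permPl h1) perm_sym perm_catC /=.
rewrite (permPl (permEl (perm_catCA [:: x] [:: p] _))) /= perm_cons.
exact: perm_update.
Qed.

Definition extend (g : nat -> nat) (p q p' q' z : nat) : nat :=
  if z == p then p' else if z == q then q' else g z.

Lemma tmap_arc_map f g h k T : {in nodes T, f =1 g} -> {in arcs T, f \o h =1 k \o g} ->
  tmap f (arc_map h T) = arc_map k (tmap g T).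
Proof.
elim: T => //= v T IH hn ha; congr cons; last first.
  by apply: IH => z hz; [apply: hn; rewrite nodes_cons mem_cat hz orbT
                        |apply: ha; rewrite arcs_cons mem_cat hz orbT].
have {}hn z : z \in vnode v -> f z = g z by move=> hz; apply: hn; rewrite nodes_cons mem_cat hz.
have {}ha z : z \in varc v -> f (h z) = k (g z) by move=> hz; apply: ha; rewrite arcs_cons mem_cat hz.
by case: v hn ha => [a b c d|a b|a b|a b] /= hn ha;
  first [by rewrite ?hn ?inE ?eqxx ?orbT | by rewrite ?ha ?inE ?eqxx ?orbT].
Qed.

Lemma tmap_node_map f g h k T : {in arcs T, f =1 g} -> {in nodes T, f \o h =1 k \o g} ->
  tmap f (node_map h T) = node_map k (tmap g T).
Proof.
elim: T => //= v T IH hn ha; congr cons; last first.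
  by apply: IH => z hz; [apply: hn; rewrite arcs_cons mem_cat hz orbT
                        |apply: ha; rewrite nodes_cons mem_cat hz orbT].
have {}hn z : z \in varc v -> f z = g z by move=> hz; apply: hn; rewrite arcs_cons mem_cat hz.
have {}ha z : z \in vnode v -> f (h z) = k (g z) by move=> hz; apply: ha; rewrite nodes_cons mem_cat hz.
by case: v hn ha => [a b c d|a b|a b|a b] /= hn ha;
  first [by rewrite ?hn ?inE ?eqxx ?orbT | by rewrite ?ha ?inE ?eqxx ?orbT].
Qed.

Lemma extend_out g p q p' q' z : z != p -> z != q -> extend g p q p' q' z = g z.
Proof. by rewrite /extend => /negbTE-> /negbTE->. Qed.

Lemma extend1 g p q p' q' : extend g p q p' q' p = p'.
Proof. by rewrite /extend eqxx. Qed.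

Lemma extend2 g p q p' q' : p != q -> extend g p q p' q' q = q'.
Proof. by rewrite /extend eq_sym => /negbTE->; rewrite eqxx. Qed.

Lemma tmap_add_curl g T x p q p' q' : p \notin names T -> q \notin names T -> p != q ->
  x \in names T -> {in arcs T, forall z, g z = g x -> z = x} ->
  tmap (extend g p q p' q') (add_curl T x p q) = add_curl (tmap g T) (g x) p' q'.
Proof.
move=> hp hq pq hx gi.
have out z : z \in names T -> extend g p q p' q' z = g z.
  by move=> hz; apply: extend_out; apply: contraTneq hz => ->.
rewrite /add_curl tmap_cat /= extend1 extend2 // out //; congr (_ ++ _).
apply: tmap_arc_map => z hz /=; first by apply: out; rewrite mem_cat hz.
rewrite /update; case: (eqVneq z x) => [->|zx]; first by rewrite eqxx extend2.
rewrite out ?mem_cat ?hz ?orbT //; case: eqP => // /(gi z hz) e.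
by rewrite e eqxx in zx.
Qed.

Lemma tmap_add_outer_curl g T x p q p' q' : p \notin names T -> q \notin names T -> p != q ->
  x \in names T -> {in nodes T, forall z, g z = g x -> z = x} ->
  tmap (extend g p q p' q') (add_outer_curl T x p q) = add_outer_curl (tmap g T) (g x) p' q'.
Proof.
move=> hp hq pq hx gi.
have out z : z \in names T -> extend g p q p' q' z = g z.
  by move=> hz; apply: extend_out; apply: contraTneq hz => ->.
rewrite /add_outer_curl tmap_cat /= extend1 extend2 // out //; congr (_ ++ _).
apply: tmap_node_map => z hz /=; first by apply: out; rewrite mem_cat hz orbT.
rewrite /update; case: (eqVneq z x) => [->|zx]; first by rewrite eqxx extend1.
rewrite out ?mem_cat ?hz //; case: eqP => // /(gi z hz) e.
by rewrite e eqxx in zx.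
Qed.

Lemma fresh_names T p q : wf T -> fresh T p q -> (p \notin names T) * (q \notin names T) * (p != q).
Proof. by move=> w /and3P[hp hq pq]; rewrite !(wf_names w). Qed.

Lemma nodes_add_curl T x p q : nodes (add_curl T x p q) = nodes T ++ [:: p; q].
Proof. by rewrite nodes_cat nodes_arc_map. Qed.

Lemma teq_add_curl_rename g T x p q p' q' : wf T -> x \in arcs T ->
  {in nodes T &, injective g} -> fresh T p q -> fresh (tmap g T) p' q' ->
  teq (add_curl T x p q) (add_curl (tmap g T) (g x) p' q').
Proof.
move=> w hx gi f1 f2; have [[hp hq] pq] := fresh_names w f1.
have hxn : x \in nodes T by rewrite -wf_mem.
rewrite -(tmap_add_curl (g := g) p' q' hp hq pq); last 2 first.
- by rewrite wf_names.
- by move=> z; rewrite wf_mem // => hz; apply: gi.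
apply/teq_step/ts_rename; first exact: wf_add_curl.
apply: uniq_map_inj; rewrite nodes_add_curl map_cat /= extend1 extend2 //.
have -> : map (extend g p q p' q') (nodes T) = nodes (tmap g T).
  rewrite nodes_map; apply/eq_in_map => z hz; have /and3P[np nq _] := f1.
  by apply: extend_out; apply: contraTneq hz => ->.
have /andP[u _] := wf_rename gi w; have /and3P[h1 h2 h3] := f2.
by rewrite cat_uniq u /= orbF !inE negb_or h1 h2 h3.
Qed.

Lemma teq_fresh T x p q p' q' : wf T -> x \in arcs T -> fresh T p q -> fresh T p' q' ->
  teq (add_curl T x p q) (add_curl T x p' q').
Proof.
move=> w hx f1 f2; have := @teq_add_curl_rename id T x p q p' q' w hx (fun _ _ _ _ h => h) f1.
by rewrite tmap_id; apply.
Qed.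

Lemma perm_add_curl T U x p q : perm_eq T U -> perm_eq (add_curl T x p q) (add_curl U x p q).
Proof. by move=> h; rewrite perm_cat2r; apply: perm_map. Qed.

Lemma add_curl_catl T G x p q : x \notin arcs G ->
  perm_eq (add_curl (T ++ G) x p q) (add_curl T x p q ++ G).
Proof.
by move=> hx; rewrite /add_curl arc_map_cat (arc_map_update_out _ hx) perm_catAC.
Qed.

Lemma add_curl_catr T G x p q : x \notin arcs T ->
  add_curl (T ++ G) x p q = T ++ add_curl G x p q.
Proof. by move=> hx; rewrite /add_curl arc_map_cat (arc_map_update_out _ hx) catA. Qed.

Lemma teq_add_outer_curl T G x p q : wf (T ++ G) -> fresh (T ++ G) p q ->
  x \in nodes T -> x \notin arcs T ->
  teq (add_curl (T ++ G) x p q) (add_outer_curl T x p q ++ G).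
Proof.
move=> w f xn xa; have [[hp hq] pq] := fresh_names w f.
have hx : x \in nodes (T ++ G) by rewrite nodes_cat mem_cat xn.
have xp : x != p by apply: contraNneq hp => <-; rewrite wf_names.
have xq : x != q by apply: contraNneq hq => <-; rewrite wf_names.
have xG : x \notin nodes G.
  have /andP[u _] := w; move: u; rewrite nodes_cat cat_uniq => /and3P[_ /hasPn h _].
  by apply/negP => /h; rewrite /= xn.
(* The cycle [x] to [p] to [q] to [x]: it gives the name [x] back to the outside arc, which
   [add_curl] had attached to [q], and moves the change to the vertices of [T]. *)
pose r z := if z == x then p else if z == p then q else if z == q then x else z.
have rx : r x = p by rewrite /r eqxx.
have rp : r p = q by rewrite /r eq_sym (negbTE xp) eqxx.
have rq : r q = x by rewrite /r eq_sym (negbTE xq) eq_sym (negbTE pq) eqxx.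
have rz z : z \in names (T ++ G) -> z != x -> r z = z.
  move=> hz zx; rewrite /r (negbTE zx).
  case: eqP => [e|_]; first by rewrite e (negbTE hp) in hz.
  by case: eqP => [e|_] //; rewrite e (negbTE hq) in hz.
have inA z : z \in arcs T ++ arcs G -> z \in names (T ++ G).
  by rewrite wf_names // -wf_mem // arcs_cat.
have inN z : z \in nodes T ++ nodes G -> z \in names (T ++ G).
  by rewrite wf_names // nodes_cat.
have wa : wf (add_curl (T ++ G) x p q) by apply: wf_add_curl => //; rewrite wf_mem.
have e : tmap r (add_curl (T ++ G) x p q) =
    node_map (update x p) T ++ G ++ [:: Arc p q; Curl q x].
  rewrite /add_curl arc_map_cat !tmap_cat /= rx rp rq -catA; congr (_ ++ (_ ++ _)).
    rewrite arc_map_update_out // -{1}[T]node_map_id.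
    rewrite (tmap_node_map (g := id) (k := update x p)) ?tmap_id // => z hz /=.
      by apply: rz; [apply: inA; rewrite mem_cat hz|apply: contraTneq hz => ->].
    rewrite /update; case: eqP => [->//|/eqP zx].
    by apply: rz; rewrite // inN // mem_cat hz.
  rewrite (tmap_arc_map (g := id) (k := id)) ?tmap_id ?arc_map_id // => z hz /=.
    by apply: rz; [apply: inN; rewrite mem_cat hz orbT|apply: contraTneq hz => ->].
  rewrite /update; case: eqP => [->|/eqP zx] //.
  by apply: rz; rewrite // inA // mem_cat hz orbT.
have ri : injective r.
  move/eqP: xp => xp; move/eqP: xq => xq; move/eqP: pq => pq.
  move=> y z; rewrite /r.
  by case: (y =P x) => [|?]; case: (z =P x) => [|?]; case: (y =P p) => [|?];
    case: (z =P p) => [|?]; case: (y =P q) => [|?]; case: (z =P q) => [|?]; congruence.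
apply: teq_trans (teq_step (ts_rename (g := r) wa _)) _; first by move=> y z _ _; apply: ri.
have wr : wf (tmap r (add_curl (T ++ G) x p q)) by apply: wf_rename => // y z _ _; apply: ri.
by apply: teq_perm => //; rewrite e /add_outer_curl -catA perm_cat2l perm_catC.
Qed.

(** As a curl cannot reach every component, each place on [T] needs its own counterpart on [U]; it
    must not depend on the fresh names. *)
Definition curled (T U : tangle) : Prop :=
  forall x, x \in arcs T -> exists2 y, y \in arcs U &
    forall p q, fresh T p q -> fresh U p q -> teq (add_curl T x p q) (add_curl U y p q).

Lemma rule_nodes r : r \in rules -> {subset nodes r.2 <= nodes r.1}.
Proof.
move=> hr; have /and5P[h _ _ _ _] := allP rules_ok _ hr.
by move=> x hx; rewrite (perm_mem h) mem_cat hx.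
Qed.

Lemma curl_rule r g G (T := tmap g r.1 ++ G) (U := tmap g r.2 ++ G) e :
  r \in rules -> wf T -> curl_certified r e ->
  exists2 y, y \in arcs U & (~~ e.1.1.2 -> y = g e.1.2) /\ forall p q, fresh T p q ->
    teq (add_curl T (g e.1.1.1) p q) (add_curl U y p q).
Proof.
move=> hr w; case: e => -[[x b] y] c; rewrite /curl_certified /= => /andP[hx hb].
have wU : wf U by exact: wf_rule w.
have gi := wf_rule_inj hr w.
have /and5P[_ _ _ _ /allP lt12] := allP rules_ok _ hr.
have /andP[_ /allP sub21] := allP rules_checked _ hr.
have out k z : 12 <= k -> z \in names r.1 ++ names r.2 -> k != z.
  by move=> hk /lt12 hz; apply: contraTneq hz => <-; rewrite -leqNgt.
have n20 k : k \in [:: 20; 21] -> (k \notin names r.1) * (k \notin names r.2).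
  move=> hk; have {}hk : 12 <= k by move: hk; rewrite !inE => /orP[]/eqP->.
  split; apply/negP => h; [have := out k k hk | have := out k k hk];
  by rewrite mem_cat h ?orbT eqxx => /(_ isT).
have gxT : g x \in arcs T by rewrite arcs_cat arcs_map mem_cat map_f.
have gxG : g x \notin arcs G.
  have /andP[u p] := w; move: u; rewrite (perm_uniq p) arcs_cat arcs_map cat_uniq.
  by case/and3P=> _ /hasPn h _; apply/negP => /h; rewrite /= map_f.
have x1 : x \in names r.1 by rewrite mem_cat hx orbT.
have y1 : y \in (if b then nodes r.2 else arcs r.2) by case: (b) hb => /andP[] // /andP[].
have y2 : y \in names r.2 by move: y1; rewrite mem_cat; case: (b) => ->; rewrite ?orbT.
have hT p q : fresh T p q ->
    perm_eq (add_curl T (g x) p q) (tmap (extend g 20 21 p q) (add_curl r.1 x 20 21) ++ G).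
  move=> f; rewrite tmap_add_curl ?n20 //; first exact: add_curl_catl.
  by move=> z hz; apply: gi; rewrite // mem_cat hz orbT.
have wT p q (f : fresh T p q) := wf_add_curl w gxT f.
have fU p q : fresh T p q -> fresh U p q.
  have sub : {subset nodes U <= nodes T}.
    move=> z; rewrite !nodes_cat !nodes_map !mem_cat => /orP[/mapP[z' /(rule_nodes hr) hz' ->]|->].
      by rewrite map_f.
    by rewrite orbT.
  by case/and3P=> h1 h2 h3; apply/and3P; split=> //; [apply: contra h1|apply: contra h2]; apply: sub.
have gi2 z : z \in names r.2 -> g z = g y -> z = y.
  by move=> /sub21 hz; apply: gi; rewrite //; exact: sub21.
have gyn : y \in arcs r.2 -> g y \in arcs U by move=> h; rewrite arcs_cat arcs_map mem_cat map_f.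
have gyU : g y \in arcs U.
  by case: (b) y1 => [h|/gyn//]; rewrite wf_mem // nodes_cat nodes_map mem_cat map_f.
have [y20 y21] : 20 \notin names r.2 /\ 21 \notin names r.2 by rewrite !n20.
have eqU p q : fresh T p q ->
    teq (add_curl U (g y) p q)
      (tmap (extend g 20 21 p q) (if b then add_outer_curl r.2 y 20 21 else add_curl r.2 y 20 21) ++ G).
  move=> f; case: b hb y1 => /andP[hy hc] y1.
    rewrite tmap_add_outer_curl //; last by move=> z hz; apply: gi2; rewrite mem_cat hz.
    apply: teq_add_outer_curl => //; first exact: fU.
      by rewrite nodes_map map_f.
    have /andP[_ hy'] := hy; apply: contra hy'; rewrite arcs_map => /mapP[z hz ezy].
    by rewrite -(gi2 z) // mem_cat hz orbT.
  rewrite tmap_add_curl //; last by move=> z hz; apply: gi2; rewrite mem_cat hz orbT.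
  apply: teq_perm; first by apply: wf_add_curl => //; exact: fU.
  apply: add_curl_catl; have /andP[u pe] := wU; move: u.
  rewrite (perm_uniq pe) arcs_cat arcs_map cat_uniq.
  by case/and3P=> _ /hasPn h _; apply/negP => /h; rewrite /= map_f.
exists (g y) => //; split=> // p q f.
apply: (teq_trans (teq_perm (wT p q f) (hT p q f))).
apply: (fun h => teq_trans h (teq_sym (eqU p q f))).
have w1 : wf (tmap (extend g 20 21 p q) (add_curl r.1 x 20 21) ++ G).
  by rewrite -(perm_wf (hT p q f)); exact: wT.
have w2 := wf_add_curl wU gyU (fU p q f); rewrite (teq_wf (eqU p q f)) in w2.
by case: (b) hb w2 => /andP[_ hc] w2; exact: (certifies_teq hc w1 w2).
Qed.

Lemma curled_rule r g G : r \in rules -> wf (tmap g r.1 ++ G) ->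
  curled (tmap g r.1 ++ G) (tmap g r.2 ++ G) /\ curled (tmap g r.2 ++ G) (tmap g r.1 ++ G).
Proof.
move=> hr w; have wU := wf_rule hr w.
have [l /and3P[hl h1 h2]] := all2_exists rules_curls_certified hr.
have inG z : z \in arcs G -> forall p q, fresh (tmap g r.1 ++ G) p q ->
    teq (add_curl (tmap g r.1 ++ G) z p q) (add_curl (tmap g r.2 ++ G) z p q).
  move=> hz p q f.
  have notin V : wf (tmap g V ++ G) -> z \notin arcs (tmap g V).
    move=> /andP[u pe]; move: u; rewrite (perm_uniq pe) arcs_cat cat_uniq => /and3P[_ /hasPn h _].
    by apply/negP => h'; have := h z hz; rewrite /= h'.
  rewrite !add_curl_catr ?notin //; apply: teq_rule => //.
  rewrite -add_curl_catr ?notin //; apply: wf_add_curl => //.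
  by rewrite arcs_cat mem_cat hz orbT.
split=> x; rewrite arcs_cat mem_cat => /orP[].
- rewrite arcs_map => /mapP[x0 hx0 ->]; have /hasP[e he /eqP ex] := allP h1 _ hx0.
  have [y hy [_ hyy]] := curl_rule hr w (allP hl _ he); exists y => // p q f _.
  by rewrite -ex; exact: hyy.
- move=> hx; exists x; first by rewrite arcs_cat mem_cat hx orbT.
  by move=> p q f _; exact: inG.
- rewrite arcs_map => /mapP[y0 hy0 ->]; have /hasP[e he /andP[nb /eqP ey]] := allP h2 _ hy0.
  have hc := allP hl _ he.
  have [y hy [hyg hyy]] := curl_rule hr w hc; exists (g e.1.1.1).
    by rewrite arcs_cat mem_cat arcs_map map_f //; case/andP: hc.
  by move=> p q _ f; rewrite -ey -(hyg nb); apply/teq_sym/hyy.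
- move=> hx; exists x; first by rewrite arcs_cat mem_cat hx orbT.
  by move=> p q _ f; apply/teq_sym/inG.
Qed.

(** * Tangles decorated with a number of curls *)

Definition decorated (T T' : tangle) : Prop :=
  exists x p q, [/\ x \in arcs T, fresh T p q & teq (add_curl T x p q) T'].

Lemma fresh_exists (Ts : seq tangle) : exists p q, all (fun T => fresh T p q) Ts.
Proof.
pose m := \max_(T <- Ts) \max_(z <- nodes T) z.
have hm T z : T \in Ts -> z \in nodes T -> z <= m.
  move=> hT hz; apply: leq_trans (_ : \max_(z <- nodes T) z <= m).
    by rewrite (big_rem z) //= leq_maxl.
  by rewrite /m (big_rem T) //= leq_maxl.
exists m.+1, m.+2; apply/allP => T hT; apply/and3P; split.
- by apply/negP => /(hm T _ hT); rewrite ltnn.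
- by apply/negP => /(hm T _ hT); rewrite ltnNge leqnSn.
- by rewrite neq_ltn leqnn.
Qed.

Lemma decorated_curled T U T' : wf T -> curled T U -> decorated T T' -> decorated U T'.
Proof.
move=> w h [x [p [q [hx f e]]]]; have [y hy hxy] := h x hx.
have [p' [q' /and3P[f1 f2 _]]] := fresh_exists [:: T; U].
exists y, p', q'; split=> //; apply: teq_trans e; apply: teq_trans (teq_sym (hxy _ _ f1 f2)) _.
exact: teq_fresh.
Qed.

Lemma curled_step T U : tstep T U -> curled T U /\ curled U T.
Proof.
case=> [{}T {}U w h|g {}T w gi|r g G hr w].
- split=> x hx; exists x.
  + by rewrite -(perm_mem (perm_arcs h)).
  + by move=> p q f _; apply: teq_perm; [exact: wf_add_curl|exact: perm_add_curl].
  + by rewrite (perm_mem (perm_arcs h)).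
  + move=> p q _ f; apply/teq_sym/teq_perm; last exact: perm_add_curl.
    by apply: wf_add_curl; rewrite ?(perm_mem (perm_arcs h)).
- split=> x hx.
    exists (g x) => [|p q f1 f2]; first by rewrite arcs_map map_f.
    exact: teq_add_curl_rename.
  move: hx; rewrite arcs_map => /mapP[y hy ->]; exists y => // p q f1 f2.
  exact/teq_sym/teq_add_curl_rename.
- exact: curled_rule.
Qed.

Lemma decorated_teq T U T' : teq T U -> decorated T T' -> decorated U T'.
Proof.
move=> e; suff : decorated T T' <-> decorated U T' by case.
elim: e => {T U} [T U s||T U _ ->|T U V _ -> _ ->] //.
have [w wU] := tstep_wf s; have [h1 h2] := curled_step s.
by split; apply: decorated_curled.
Qed.

Lemma decorated_wf T T' : wf T -> decorated T T' -> wf T'.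
Proof. by move=> w [x [p [q [hx f /teq_wf <-]]]]; apply: wf_add_curl. Qed.

(** The places of the curls remain unspecified, and the equivalence may be used between two
    additions. *)
Fixpoint decorations (i : nat) (T V : tangle) : Prop :=
  if i is j.+1 then exists2 T', decorated T T' & decorations j T' V else teq T V.

Lemma decorations_teql i T U V : teq T U -> decorations i T V -> decorations i U V.
Proof.
case: i => [|i] e /=; first by apply/teq_trans/teq_sym.
by case=> T' /(decorated_teq e) h1 h2; exists T'.
Qed.

Lemma arcs_add_curl T x p q : arcs (add_curl T x p q) = map (update x q) (arcs T) ++ [:: x; p].
Proof. by rewrite arcs_cat arcs_arc_map. Qed.

Lemma arc_map_comp g h T : arc_map g (arc_map h T) = arc_map (g \o h) T.
Proof. by rewrite /arc_map -map_comp; apply: eq_map; case. Qed.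

Lemma decorated_add_curl T x p q : wf T -> x \in arcs T -> fresh T p q ->
  exists V, decorated (add_curl T x p q) V.
Proof.
move=> w hx f; have [p' [q' /andP[f' _]]] := fresh_exists [:: add_curl T x p q].
exists (add_curl (add_curl T x p q) x p' q'), x, p', q'; split=> //; last exact: teq_refl.
by rewrite arcs_add_curl mem_cat !inE eqxx orbT.
Qed.

Lemma perm_add_curl2 T (x y p q p' q' : nat) : wf T -> x \in arcs T -> y \in arcs T -> x != y ->
  fresh T p q -> fresh T p' q' -> fresh (add_curl T x p q) p' q' ->
  perm_eq (add_curl (add_curl T x p q) y p' q') (add_curl (add_curl T y p' q') x p q).
Proof.
move=> w hx hy xy f f' _.
have ne (z k k' : nat) : z \in arcs T -> fresh T k k' -> (z != k) * (z != k').
  move=> hz /and3P[h1 h2 _]; rewrite wf_mem // in hz.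
  by split; [apply: contraNneq h1 => <-|apply: contraNneq h2 => <-].
have u z k k' : update z k k' = if k' == z then k else k' by [].
rewrite {1 3}/add_curl !arc_map_cat !arc_map_comp /= !u.
rewrite (negbTE xy) [y == x]eq_sym (negbTE xy).
rewrite [p == y]eq_sym (negbTE (ne y p q hy f).1) [p' == x]eq_sym (negbTE (ne x p' q' hx f').1).
rewrite (@eq_in_arc_map (update y q' \o update x q) (update x q \o update y q')).
  by rewrite -!catA perm_cat2l perm_catC.
move=> z hz /=; rewrite !u; case: (eqVneq z x) => [->|zx].
  by rewrite (negbTE xy) eqxx [q == y]eq_sym (negbTE (ne y p q hy f).2).
case: (eqVneq z y) => [_|_]; last by rewrite (negbTE zx).
by rewrite [q' == x]eq_sym (negbTE (ne x p' q' hx f').2).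
Qed.

(** Curls at two different ends can be added in either order; at the same end, [T1] and [T2] are
    already equivalent and any further curl will do. *)
Lemma decorated_diamond T T1 T2 : wf T -> decorated T T1 -> decorated T T2 ->
  exists V, decorated T1 V /\ decorated T2 V.
Proof.
move=> w [x [p [q [hx f e1]]]] [y [p0 [q0 [hy f0 e2]]]].
have [p' [q' /and3P[f1 f2 _]]] := fresh_exists [:: T; add_curl T x p q].
have {e2 f0} e2 : teq (add_curl T y p' q') T2.
  by apply: teq_trans e2; apply: teq_fresh.
case: (eqVneq x y) => [exy|xy].
  have [V hV] := decorated_add_curl w hx f; exists V; split.
    exact: decorated_teq e1 hV.
  apply: decorated_teq hV; apply: teq_trans e2; rewrite -exy; exact: teq_fresh.
exists (add_curl (add_curl T x p q) y p' q'); split.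
  apply: (decorated_teq e1); exists y, p', q'; split=> //; last exact: teq_refl.
  rewrite arcs_add_curl mem_cat; apply/orP; left; apply/mapP; exists y => //.
  by rewrite /update eq_sym (negbTE xy).
apply: (decorated_teq e2); exists x, p, q; split.
- rewrite arcs_add_curl mem_cat; apply/orP; left; apply/mapP; exists x => //.
  by rewrite /update (negbTE xy).
- have mem_add z x0 k k' : (z \in nodes (add_curl T x0 k k')) = [|| z \in nodes T, z == k | z == k'].
    by rewrite nodes_add_curl mem_cat !inE.
  have /and3P[h1 h2 h3] := f; have /and3P[] := f2.
  rewrite !mem_add !negb_or => /and3P[_ a1 a2] /and3P[_ b1 b2] _.
  by rewrite /fresh !mem_add !negb_or h1 h2 h3 ![p == _]eq_sym ![q == _]eq_sym a1 a2 b1 b2.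
- apply/teq_sym/teq_perm; last exact: perm_add_curl2.
  apply: wf_add_curl => //; first exact: wf_add_curl.
  rewrite arcs_add_curl mem_cat; apply/orP; left; apply/mapP; exists y => //.
  by rewrite /update eq_sym (negbTE xy).
Qed.

Lemma decorations_strip j T T1 V : wf T -> decorated T T1 -> decorations j T V ->
  exists2 V', decorations j T1 V' & decorated V V'.
Proof.
elim: j T T1 => [|j IH] T T1 w h1 /=.
  by move=> e; exists T1; [exact: teq_refl|exact: decorated_teq e h1].
case=> T2 h2 hV; have [W [hW1 hW2]] := decorated_diamond w h1 h2.
have [V' h hV'] := IH _ _ (decorated_wf w h2) hW2 hV.
by exists V' => //; exists W.
Qed.

(** The usual tiling by diamonds. The counts are exchanged: what one side received, the other has
    still to receive. *)
Lemma decorations_confluent i j T V1 V2 : wf T -> decorations i T V1 -> decorations j T V2 ->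
  exists2 V, decorations j V1 V & decorations i V2 V.
Proof.
elim: i T V2 => [|i IH] T V2 w /=.
  by move=> e h; exists V2; [exact: decorations_teql e h|exact: teq_refl].
case=> T' h1 h2 hj; have [V' hV' hd] := decorations_strip w h1 hj.
have [V a b] := IH _ _ (decorated_wf w h1) h2 hV'.
by exists V => //; exists V'.
Qed.

Lemma decorations_add i j T U V : decorations i T U -> decorations j U V -> decorations (i + j) T V.
Proof.
elim: i T => [|i IH] T /=; first by move=> e; apply: decorations_teql; exact: teq_sym.
by case=> T' h1 h2 h3; exists T' => //; apply: IH h2 h3.
Qed.

Lemma xings_add_curl T x p q : xings (add_curl T x p q) = xings T.
Proof.
rewrite /xings count_cat /= !addn0; move: (update x q) => g.
by elim: T => //= v T ->; case: v.
Qed.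

Lemma curls_add_curl T x p q : curls (add_curl T x p q) = (curls T).+1.
Proof.
rewrite /curls count_cat /= ?addn0 ?add0n addn1; move: (update x q) => g; congr _.+1.
by elim: T => //= v T ->; case: v.
Qed.

Lemma adequate_add_curl T x p q : wf T -> x \in arcs T -> fresh T p q ->
  adequate T -> adequate (add_curl T x p q).
Proof.
move=> w hx f [o [c /allP ad]]; have [[hp hq] pq] := fresh_names w f.
pose o' z := if z == p then ~~ o x else if z == q then o x else o z.
pose c' z := if (z == p) || (z == q) then c x else c z.
have out z : z \in names T -> (o' z = o z) * (c' z = c z).
  move=> hz; have zp : z != p by apply: contraTneq hz => ->.
  have zq : z != q by apply: contraTneq hz => ->.
  by rewrite /o' /c' (negbTE zp) (negbTE zq).
have xn : x \in names T by rewrite mem_cat hx orbT.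
have op : o' p = ~~ o x by rewrite /o' eqxx.
have oq : o' q = o x by rewrite /o' eq_sym (negbTE pq) eqxx.
have cp : c' p = c x by rewrite /c' eqxx.
have cq : c' q = c x by rewrite /c' eqxx orbT.
exists o', c'; rewrite /add_curl all_cat /= andbT; apply/and3P; split.
- apply/allP => v' /mapP[v hv ->].
  have vn z : z \in vnode v ++ varc v -> z \in names T.
    rewrite !mem_cat => /orP[] hz; apply/orP; [left|right]; apply/flatten_mapP; by exists v.
  have := ad v hv; case: v {hv} vn => [a b y d|a b|a b|a b] vn.
  + by rewrite /vadequate /= !(out a, out b, out y, out d) // vn // !inE eqxx ?orbT.
  + by rewrite /vadequate /= !(out a, out b) // vn // !inE eqxx ?orbT.
  + by rewrite /vadequate /= !(out a, out b) // vn // !inE eqxx ?orbT.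
  + have ua z : z \in [:: a; b] -> (o' (update x q z) = o z) * (c' (update x q z) = c z).
      move=> hz; rewrite /update; case: eqP => [->|_]; first by rewrite oq cq.
      by rewrite !out // vn.
    by rewrite /vadequate /= !(ua a, ua b) // !inE eqxx ?orbT.
- by rewrite /vadequate /= op cp !out // eqxx; case: (o x).
- by rewrite /vadequate /= op oq cp cq eqxx; case: (o x).
Qed.

(** The equivalences between the additions can be postponed: all the curls are put on [T] itself,
    where crossings, curls and adequacy are under control. *)
Lemma decorations_undecorated i T V : wf T -> decorations i T V ->
  exists T1, [/\ wf T1, teq T1 V, xings T1 = xings T, curls T1 = curls T + i
    & adequate T -> adequate T1].
Proof.
elim: i T => [|i IH] T w /=; first by move=> e; exists T; rewrite addn0; split.
case=> T' [x [p [q [hx f e]]]] hV.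
have w1 := wf_add_curl w hx f.
have [T1 [wT1 eT1 n1 c1 a1]] := IH _ w1 (decorations_teql (teq_sym e) hV).
exists T1; split; rewrite ?n1 ?c1 ?xings_add_curl ?curls_add_curl ?addSnnS //.
by move=> ad; apply/a1/adequate_add_curl.
Qed.

(** * Tangles of diagrams *)

(** A virtual crossing is two unrelated strands; the plane is forgotten here. *)
Definition vtr (v : node) : tangle :=
  match v with
  | Cross a b c d => [:: Xing a b c d]
  | Virt a b c d => [:: Join a c; Join b d]
  | Point a b => [:: Join a b]
  end.

Definition tr (S : code) : tangle := flatten (map vtr S).

Definition arcs_of (es : seq (nat * nat)) : tangle := [seq Arc p.1 p.2 | p <- es].

Definition tangle_of (S : code) (es : seq (nat * nat)) : tangle := tr S ++ arcs_of es.

(* [S] is [D] with all the ends of edges named differently; [l] maps the name of an end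
   to the label of the edge, and [es] lists the pairs of ends of the edges. *)
Definition represents (D S : code) (es : seq (nat * nat)) (l : nat -> nat) : Prop :=
  [/\ map (relabel l) S = D, wf (tangle_of S es) & all (fun p => l p.1 == l p.2) es].

Definition rep (D : code) (T : tangle) : Prop :=
  exists S es l, represents D S es l /\ T = tangle_of S es.

Lemma labels_cons v S : labels (v :: S) = legs v ++ labels S.
Proof. by []. Qed.

Lemma labels_cat S S' : labels (S ++ S') = labels S ++ labels S'.
Proof. by rewrite /labels map_cat flatten_cat. Qed.

Lemma labels_relabel l S : labels (map (relabel l) S) = map l (labels S).
Proof. by elim: S => //= v S IH; rewrite !labels_cons map_cat IH; case: v. Qed.

Lemma tr_cat S S' : tr (S ++ S') = tr S ++ tr S'.
Proof. by rewrite /tr map_cat flatten_cat. Qed.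

Lemma tr_relabel l S : tr (map (relabel l) S) = tmap l (tr S).
Proof. by elim: S => //= v S IH; rewrite /tr /= -!/(tr _) tmap_cat IH; case: v. Qed.

Lemma nodes_tr S : perm_eq (nodes (tr S)) (labels S).
Proof.
elim: S => // v S IH; rewrite /tr /= -/(tr S) nodes_cat labels_cons; apply: perm_cat IH.
by case: v => [a b c d|a b c d|a b] //=; apply/permP => p /=; lia.
Qed.

Lemma arcs_tr S : arcs (tr S) = [::].
Proof. by elim: S => // v S IH; rewrite /tr /= -/(tr S) arcs_cat IH; case: v. Qed.

Lemma nodes_arcs_of es : nodes (arcs_of es) = [::].
Proof. by elim: es. Qed.

Lemma arcs_arcs_of es : arcs (arcs_of es) = ends es.
Proof. by elim: es => //= p es IH; rewrite arcs_cons IH. Qed.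

Lemma nodes_tangle_of S es : perm_eq (nodes (tangle_of S es)) (labels S).
Proof. by rewrite nodes_cat nodes_arcs_of cats0 nodes_tr. Qed.

Lemma arcs_tangle_of S es : arcs (tangle_of S es) = ends es.
Proof. by rewrite arcs_cat arcs_tr arcs_arcs_of. Qed.

Lemma wf_tangle_of S es : wf (tangle_of S es) = uniq (labels S) && perm_eq (labels S) (ends es).
Proof.
by rewrite /wf arcs_tangle_of (perm_uniq (nodes_tangle_of _ _)) (permPl (nodes_tangle_of _ _)).
Qed.

Lemma twice_count D x : each_label_twice D -> x \in labels D -> count_mem x (labels D) = 2.
Proof. by move=> /allP h /h /eqP. Qed.

Lemma same_label (l : nat -> nat) (s : seq nat) a b z : uniq s -> count_mem (l a) (map l s) = 2 ->
  a \in s -> b \in s -> z \in s -> l b = l a -> l z = l a -> a != b -> a != z -> b = z.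
Proof.
move=> u c ha hb hz eb ez nb nz; apply/eqP/negPn/negP => bz.
have : size [:: a; b; z] <= size [seq y <- s | l y == l a].
  apply: uniq_leq_size; first by rewrite /= !inE negb_or nb nz bz.
  by move=> y; rewrite !inE mem_filter => /or3P[] /eqP->; rewrite ?eb ?ez eqxx.
by move: c; rewrite count_map size_filter (eq_count (a2 := preim l (pred1 (l a)))) // => ->.
Qed.

Lemma mem_ends p (es : seq (nat * nat)) : p \in es -> (p.1 \in ends es) * (p.2 \in ends es).
Proof. by move=> h; split; apply/flatten_mapP; exists p; rewrite // !inE eqxx ?orbT. Qed.

(** A label occurs exactly twice, so the labelling determines which ends are joined by an edge, up
    to the direction of the pair. *)
Lemma represents_mate D S es l a b : each_label_twice D -> represents D S es l ->
  a \in labels S -> b \in labels S -> a != b -> l a = l b -> (a, b) \in es \/ (b, a) \in es.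
Proof.
move=> tw [eD w /allP he] ha hb ab lab; move: w; rewrite wf_tangle_of => /andP[u p].
have eL : labels D = map l (labels S) by rewrite -eD labels_relabel.
have cnt : count_mem (l a) (map l (labels S)) = 2.
  by rewrite -eL; apply: twice_count => //; rewrite eL map_f.
have := ha; rewrite (perm_mem p) => /flatten_mapP[[x y] hp].
have xy : x != y.
  have : uniq (ends es) by rewrite -(perm_uniq p).
  case/splitPr: hp => e1 e2; rewrite ends_cat cat_uniq /= => /and5P[_ _].
  by rewrite inE negb_or => /andP[].
have /= /eqP lxy := he _ hp; have [hx hy] := mem_ends hp.
rewrite -!(perm_mem p) /= in hx hy.
rewrite !inE /= => /orP[] /eqP e; move: cnt; [left|right].
  have -> // : b = y by apply: (same_label u cnt) => //; rewrite e.
  by rewrite e.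
have -> // : b = x by apply: (same_label u cnt) => //; rewrite e // eq_sym.
by rewrite e.
Qed.

Lemma canon_uniq es : uniq (ends es) -> uniq (canon (arcs_of es)).
Proof.
elim: es => // p es IH u.
have /and3P[n1 _ u2] : [&& p.1 \notin p.2 :: ends es, p.2 \notin ends es & uniq (ends es)] := u.
have -> : canon (arcs_of (p :: es)) = vcanon (Arc p.1 p.2) :: canon (arcs_of es) by [].
rewrite (cons_uniq (vcanon (Arc p.1 p.2)) (canon (arcs_of es))) IH // andbT; move: n1; rewrite inE negb_or => /andP[_]; apply: contra => h.
have [_ pa] := perm_canon (arcs_of es); rewrite -arcs_arcs_of -(perm_mem pa).
apply/flatten_mapP; exists (vcanon (Arc p.1 p.2)) => //.
by rewrite /=; case: ifP => _; rewrite !inE eqxx ?orbT.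
Qed.

Lemma vcanon_sym a b : vcanon (Arc a b) = vcanon (Arc b a).
Proof. by rewrite /=; case: (ltngtP a b) => // ->. Qed.

Lemma represents_edges D S es es' l : each_label_twice D ->
  represents D S es l -> represents D S es' l ->
  perm_eq (canon (arcs_of es)) (canon (arcs_of es')).
Proof.
move=> tw r r'; have [_ w he] := r; have [_ w' he'] := r'.
move: w w'; rewrite !wf_tangle_of => /andP[u p] /andP[_ p'].
have ue : uniq (ends es) by rewrite -(perm_uniq p).
have ue' : uniq (ends es') by rewrite -(perm_uniq p').
have sub e1 e2 : represents D S e1 l -> represents D S e2 l ->
    {subset canon (arcs_of e1) <= canon (arcs_of e2)}.
  move=> r1 r2 v /mapP[w /mapP[q hq ->] ->{v w}].
  have [_ w1 /allP/(_ _ hq)/eqP lq] := r1; move: w1; rewrite wf_tangle_of => /andP[_ p1].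
  have [h1 h2] := mem_ends hq; rewrite -!(perm_mem p1) in h1 h2.
  have ne : q.1 != q.2.
    have : uniq (ends e1) by rewrite -(perm_uniq p1).
    case/splitPr: hq => s1 s2; rewrite ends_cat cat_uniq /= => /and5P[_ _].
    by rewrite inE negb_or => /andP[].
  have [hm|hm] := represents_mate tw r2 h1 h2 ne lq.
    by apply/mapP; exists (Arc q.1 q.2) => //; apply/mapP; exists (q.1, q.2).
  apply/mapP; exists (Arc q.2 q.1); last exact: vcanon_sym.
  by apply/mapP; exists (q.2, q.1).
by apply: uniq_perm; [exact: canon_uniq|exact: canon_uniq|move=> v; apply/idP/idP; apply: sub].
Qed.

Lemma relabel_shape g l l' S S' : map (relabel l) S = map (relabel l') S' ->
  map g (labels S) = labels S' -> map (relabel g) S = S'.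
Proof.
elim: S S' => [|v S IH] [|v' S'] //= [ev e]; rewrite !labels_cons map_cat.
case: v ev => [a b c d|a b c d|a b]; case: v' => [a' b' c' d'|a' b' c' d'|a' b'] //= _ [].
- by move=> -> -> -> -> h; rewrite (IH _ e h).
- by move=> -> -> -> -> h; rewrite (IH _ e h).
- by move=> -> -> h; rewrite (IH _ e h).
Qed.

Definition transport (s t : seq nat) (z : nat) : nat := nth 0 t (index z s).

Lemma map_transport s t : uniq s -> size s = size t -> map (transport s t) s = t.
Proof.
move=> u e; apply: (@eq_from_nth _ 0); rewrite size_map // => i hi.
by rewrite (nth_map 0) // /transport index_uniq.
Qed.

Lemma transport_inj s t : uniq s -> uniq t -> size s = size t -> {in s &, injective (transport s t)}.
Proof. by move=> us ut e; apply: uniq_map_inj; rewrite map_transport. Qed.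

Lemma teq_tangle_of S es es' : wf (tangle_of S es) -> wf (tangle_of S es') ->
  perm_eq (canon (arcs_of es)) (canon (arcs_of es')) -> teq (tangle_of S es) (tangle_of S es').
Proof.
move=> w w' p; have c e : wf (tangle_of S e) ->
    teq (tangle_of S e) (canon (arcs_of e) ++ tr S) /\ wf (canon (arcs_of e) ++ tr S).
  move=> we; have pc : perm_eq (tangle_of S e) (tmap id (arcs_of e) ++ tr S).
    by rewrite tmap_id perm_catC.
  have w1 := we; rewrite (perm_wf pc) in w1; have := teq_canon w1; rewrite !tmap_id => h.
  rewrite tmap_id in pc w1.
  by split; [exact: teq_trans (teq_perm we pc) h|rewrite -(teq_wf h)].
have [h1 w1] := c _ w; have [h2 _] := c _ w'.
apply: (teq_trans h1); apply: teq_trans (teq_sym h2).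
by apply: teq_perm => //; rewrite perm_cat2r.
Qed.

Lemma arcs_of_map g es : arcs_of (map_pairs g es) = tmap g (arcs_of es).
Proof. by rewrite /arcs_of /tmap -!map_comp. Qed.

Lemma rep_unique D T T' : each_label_twice D -> rep D T -> rep D T' -> teq T T'.
Proof.
move=> tw [S [es [l [r ->]]]] [S' [es' [l' [r' ->]]]].
have [eD w he] := r; have [eD' w' he'] := r'.
have := w; rewrite wf_tangle_of => /andP[u p]; have := w'; rewrite wf_tangle_of => /andP[u' p'].
have eL : map l (labels S) = map l' (labels S') by rewrite -!labels_relabel eD eD'.
have sz : size (labels S) = size (labels S') by rewrite -(size_map l) eL size_map.
(* Both codes have the shape of [D], so their ends are matched by position. *)
pose g := transport (labels S) (labels S').
have mg : map g (labels S) = labels S' by exact: map_transport.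
have gS : map (relabel g) S = S' by apply: (@relabel_shape g l l') => //; rewrite eD.
have gi : {in labels S &, injective g} by exact: transport_inj.
have lg : {in labels S, forall z, l' (g z) = l z}.
  by apply/eq_in_map; rewrite (map_comp l' g) mg.
have e : tmap g (tangle_of S es) = tangle_of S' (map_pairs g es).
  by rewrite /tangle_of tmap_cat -tr_relabel gS arcs_of_map.
have gin : {in nodes (tangle_of S es) &, injective g}.
  by move=> x y; rewrite !(perm_mem (nodes_tangle_of _ _)); exact: gi.
have h : teq (tangle_of S es) (tangle_of S' (map_pairs g es)) by rewrite -e; apply/teq_step/ts_rename.
have w2 := w; rewrite (teq_wf h) in w2.
apply: (teq_trans h); apply: teq_tangle_of => //; apply: (represents_edges tw _ r').
split=> //; apply/allP => q /mapP[q0 hq ->] /=.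
have [h1 h2] := mem_ends hq; rewrite -!(perm_mem p) in h1 h2.
by rewrite !lg //; exact: (allP he).
Qed.

Lemma shape_exists D s : size s = size (labels D) -> exists2 S, labels S = s &
  forall l, map l s = labels D -> map (relabel l) S = D.
Proof.
elim: D s => [|v D IH] s; first by case: s => // _; exists [::].
rewrite labels_cons size_cat; case: v => [a b c d|a b c d|a b] /=.
- case: s => [|a' [|b' [|c' [|d' s]]]] //= [] /IH[S <- h].
  by exists (Cross a' b' c' d' :: S) => // l [] <- <- <- <- /h /= ->.
- case: s => [|a' [|b' [|c' [|d' s]]]] //= [] /IH[S <- h].
  by exists (Virt a' b' c' d' :: S) => // l [] <- <- <- <- /h /= ->.
- case: s => [|a' [|b' s]] //= [] /IH[S <- h].
  by exists (Point a' b' :: S) => // l [] <- <- /h /= ->.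
Qed.

Lemma matching_exists (l : nat -> nat) s : all (fun y => count (fun z => l z == l y) s == 2) s ->
  exists2 es, perm_eq (ends es) s & all (fun p => l p.1 == l p.2) es.
Proof.
have [n] := ubnP (size s); elim: n s => // n IH [|a s] /=; first by exists [::].
rewrite ltnS => hn /andP[]; rewrite eqxx add1n eqSS => ha hs.
have /hasP[b hb lb] : has (fun z => l z == l a) s by rewrite has_count (eqP ha).
have p := perm_to_rem hb; set s' := rem b s in p.
have sa : ~~ has (fun z => l z == l a) s'.
  rewrite has_count -leqNgt; have := ha; rewrite (permP p) /= lb add1n eqSS => /eqP ->.
  by [].
have [||es he hl] := IH s'.
- by rewrite (leq_trans _ hn) // (perm_size p).
- apply/allP => y hy; have ys : y \in s by rewrite (perm_mem p) inE hy orbT.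
  have ya : (l a == l y) = false.
    by apply: contraNF sa => e; apply/hasP; exists y; rewrite // eq_sym.
  have := allP hs _ ys; rewrite ya add0n (permP p) /= (eqP lb) ya //.
exists ((a, b) :: es); last by rewrite /= hl eq_sym lb.
by rewrite /= perm_cons perm_sym (permPl p) perm_cons perm_sym.
Qed.

Lemma rep_exists D : each_label_twice D -> exists T, rep D T.
Proof.
move=> tw; have [S eS hS] := @shape_exists D (iota 0 (size (labels D))) (size_iota _ _).
pose l := nth 0 (labels D).
have ml : map l (iota 0 (size (labels D))) = labels D by rewrite map_nth_iota0 // take_size.
have [|es he hl] := @matching_exists l (labels S).
  apply/allP => y hy; have := tw; rewrite /each_label_twice.
  move/allP/(_ (l y)); rewrite -(count_map l (pred1 (l y))) eS ml; apply.
  by rewrite -ml map_f // -eS.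
exists (tangle_of S es), S, es, l; split=> //; split=> //; first exact: hS.
by rewrite wf_tangle_of eS iota_uniq -eS perm_sym.
Qed.

(** [i] curls on [D] and [j] on [E] lead to a common tangle, with [i - j = m - n]. Only this
    difference is meaningful, since more curls can be added on both sides; it measures the change of
    writhe. *)
Definition link (D E : code) (m n : nat) : Prop :=
  forall T T', rep D T -> rep E T' ->
  exists i j V, [/\ i + n = j + m, decorations i T V & decorations j T' V].

Lemma rep_wf D T : rep D T -> wf T.
Proof. by case=> S [es [l [[_ w _] ->]]]. Qed.

Lemma link_intro D E m n i j T T' V : each_label_twice D -> each_label_twice E ->
  rep D T -> rep E T' -> i + n = j + m -> decorations i T V -> decorations j T' V -> link D E m n.
Proof.
move=> tD tE rT rT' e h h' U U' rU rU'; exists i, j, V; split=> //.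
  by apply: decorations_teql h; apply: rep_unique rU.
by apply: decorations_teql h'; apply: rep_unique rU'.
Qed.

Lemma link_refl D : each_label_twice D -> link D D 0 0.
Proof.
by move=> tw T T' h h'; exists 0, 0, T'; split=> //=; [exact: rep_unique h h'|exact: teq_refl].
Qed.

Lemma link_sym D E m n : link D E m n -> link E D n m.
Proof.
move=> h T T' hT hT'; have [i [j [V [e h1 h2]]]] := h _ _ hT' hT.
by exists j, i, V; split.
Qed.

Lemma link_trans D E F m n m' n' : each_label_twice E ->
  link D E m n -> link E F m' n' -> link D F (m + m') (n + n').
Proof.
move=> tE h h' T T' hT hT'; have [U hU] := rep_exists tE.
have [i [j [V [e h1 h2]]]] := h _ _ hT hU.
have [i' [j' [V' [e' h1' h2']]]] := h' _ _ hU hT'.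
(* [U] was decorated in two ways; each decoration is completed by as many curls as the other one
   has. *)
have [W hW hW'] := decorations_confluent (rep_wf hU) h2 h1'.
exists (i + i'), (j' + j), W; split; first by lia.
  exact: decorations_add h1 hW.
exact: decorations_add h2' hW'.
Qed.

Lemma twice_perm D E : perm_eq (labels D) (labels E) -> each_label_twice D -> each_label_twice E.
Proof.
by move=> p /allP h; apply/allP => x; rewrite -(perm_mem p) -(permP p) => /h.
Qed.

Lemma twice_drop D E x : perm_eq (labels D) [:: x, x & labels E] ->
  each_label_twice D -> each_label_twice E /\ x \notin labels E.
Proof.
move=> p /allP h.
have xE : x \notin labels E.
  have xD : x \in labels D by rewrite (perm_mem p) inE eqxx.
  have := h x xD; rewrite (permP p) /= eqxx !add1n !eqSS => /eqP/count_memPn; exact.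
split=> //; apply/allP => y hy; have yD : y \in labels D by rewrite (perm_mem p) !inE hy !orbT.
have := h y yD; rewrite (permP p) /=; suff -> : (x == y) = false by [].
by apply: contraNF xE => /eqP ->.
Qed.

Lemma extract_arcs es ps : uniq (ends ps) -> (forall p, p \in ps -> p \in es \/ (p.2, p.1) \in es) ->
  exists2 es0, perm_eq (ends (ps ++ es0)) (ends es) & {subset es0 <= es}.
Proof.
elim: ps es => [|p ps IH] es u h; first by exists es.
have /and3P[n1 n2 u'] : [&& p.1 \notin p.2 :: ends ps, p.2 \notin ends ps & uniq (ends ps)] := u.
have {}n1 : p.1 \notin ends ps by move: n1; rewrite inE negb_or => /andP[].
have [p' hp' ep] : exists2 p', p' \in es & p' = p \/ p' = (p.2, p.1).
  have [hp|hp] : p \in es \/ (p.2, p.1) \in es by apply: h; rewrite inE eqxx.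
    by exists p => //; left.
  by exists (p.2, p.1) => //; right.
have pe := perm_to_rem hp'.
have [q hq|es0 pe0 sub] := IH (rem p' es) u'.
  have [hq1 hq2] := mem_ends hq.
  have nq : (q != p') && ((q.2, q.1) != p').
    apply/andP; split; apply/negP => /eqP e; case: ep => ep.
    - by move: hq1; rewrite e ep (negbTE n1).
    - by move: hq1; rewrite e ep (negbTE n2).
    - by move: hq1; rewrite -[q.1]/(q.2, q.1).2 e ep (negbTE n2).
    - by move: hq2; rewrite -[q.2]/(q.2, q.1).1 e ep (negbTE n2).
  have [n3 n4] := andP nq.
  have [hh|hh] : q \in es \/ (q.2, q.1) \in es by apply: h; rewrite inE hq orbT.
    by left; move: hh; rewrite (perm_mem pe) inE (negbTE n3).
  by right; move: hh; rewrite (perm_mem pe) inE (negbTE n4).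
exists es0; last by move=> q /sub /mem_rem.
have pf := perm_flatten (perm_map (fun p : nat * nat => [:: p.1; p.2]) pe).
rewrite -/(ends es) in pf; rewrite (permPr pf) ends_cat.
have -> : ends (p :: ps) = [:: p.1; p.2] ++ ends ps by [].
rewrite -catA -ends_cat -[flatten _]/([:: p'.1; p'.2] ++ ends (rem p' es)).
apply: perm_cat pe0; case: ep => -> //=.
by rewrite (perm_catC [:: p.1] [:: p.2]).
Qed.

(** Chosen edges can be put in front of the list in a prescribed direction, ready for a rule to act
    on them. *)
Lemma represents_extract D S es l ps : each_label_twice D -> represents D S es l ->
  uniq (ends ps) -> {subset ends ps <= labels S} -> all (fun p => l p.1 == l p.2) ps ->
  exists es0, represents D S (ps ++ es0) l.
Proof.
move=> tw r u sub hl; have [eD w he] := r.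
have [[a b] hp|es0 pe se] := @extract_arcs es ps u.
  have [/= h1 h2] := mem_ends hp; apply: (represents_mate tw r); [exact: sub|exact: sub| |].
    move: u; case/splitPr: hp => s1 s2; rewrite ends_cat cat_uniq => /and3P[_ _].
    have -> : ends ((a, b) :: s2) = [:: a; b] ++ ends s2 by [].
    by rewrite cat_uniq /= inE => /and3P[/andP[]].
  by apply/eqP; exact: (allP hl _ hp).
exists es0; split=> //.
  by move: w; rewrite !wf_tangle_of => /andP[-> h]; rewrite (permPl h) perm_sym.
by rewrite all_cat hl; apply/allP => q /se; exact: (allP he).
Qed.

(** * Local moves given by templates *)

Record template := Template {
  tsource : code; tsource_edges : seq (nat * nat);
  ttarget : code; ttarget_edges : seq (nat * nat) }.

Definition template_ok (t : template) (c : certificate) : bool :=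
  let I := [seq z <- labels (tsource t) | z \notin labels (ttarget t)] in
  [&& uniq (labels (tsource t)), uniq (ends (tsource_edges t)),
      all (mem (labels (tsource t))) (ends (tsource_edges t)),
      perm_eq (labels (tsource t)) (labels (ttarget t) ++ I),
      perm_eq (ends (tsource_edges t)) (ends (ttarget_edges t) ++ I)
    & certifies c (tangle_of (tsource t) (tsource_edges t))
                  (tangle_of (ttarget t) (ttarget_edges t))].

Definition edges_respect (l : nat -> nat) (es : seq (nat * nat)) : bool :=
  all (fun p => l p.1 == l p.2) es.

Lemma tangle_of_cat S S' es es' :
  perm_eq (tangle_of (S ++ S') (es ++ es')) (tangle_of S es ++ tangle_of S' es').
Proof.
by rewrite /tangle_of tr_cat /arcs_of map_cat -!catA perm_cat2l perm_catCA.
Qed.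

Lemma tangle_of_map g S es : tangle_of (map (relabel g) S) (map_pairs g es) = tmap g (tangle_of S es).
Proof. by rewrite /tangle_of tmap_cat -tr_relabel arcs_of_map. Qed.

Lemma relabel_cat l S L G : map (relabel l) S = L ++ G ->
  exists S1 S0, [/\ S = S1 ++ S0, map (relabel l) S1 = L & map (relabel l) S0 = G].
Proof.
move=> e; exists (take (size L) S), (drop (size L) S); split; first by rewrite cat_take_drop.
  by rewrite map_take e take_size_cat.
by rewrite map_drop e drop_size_cat.
Qed.

Lemma ends_map g es : ends (map_pairs g es) = map g (ends es).
Proof. by elim: es => //= p es IH; rewrite /ends /= -/(ends _) IH. Qed.

Lemma eq_in_relabel l l' S : {in labels S, l =1 l'} -> map (relabel l) S = map (relabel l') S.
Proof.
elim: S => //= v S IH h; rewrite IH; last by move=> z hz; apply: h; rewrite labels_cons mem_cat hz orbT.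
have {}h z : z \in legs v -> l z = l' z by move=> hz; apply: h; rewrite labels_cons mem_cat hz.
by congr cons; case: v h => [a b c d|a b c d|a b] /= h; rewrite !h // !inE eqxx ?orbT.
Qed.

Lemma relabel_comp f g S : map (relabel f) (map (relabel g) S) = map (relabel (f \o g)) S.
Proof. by rewrite -map_comp; apply: eq_map; case. Qed.

(** The template has distinct ends, whereas in a diagram several of them may carry the same label;
    hence the instantiation by [l] and [l']. These may differ only at the ends of edges inside the
    disc. *)
Lemma link_template t c l l' G
    (D := map (relabel l) (tsource t) ++ G) (E := map (relabel l') (ttarget t) ++ G) :
  template_ok t c -> edges_respect l (tsource_edges t) -> edges_respect l' (ttarget_edges t) ->
  all (fun z => (z \in ends (tsource_edges t)) || (l z == l' z)) (labels (tsource t)) ->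
  each_label_twice D -> each_label_twice E -> link D E 0 0.
Proof.
case: t @D @E => L1 es1 R1 er1 D E /and5P[/= u1 ue /allP sub pn /andP[pa cert]] rl rl' /allP bd tD tE.
have {}sub : {subset ends es1 <= labels L1} by move=> z /sub.
have [T [S [es [k [r _]]]]] := rep_exists tD.
have [eS _ _] := r; have [S1 [S0 [e e1 e0]]] := relabel_cat eS; subst S.
have [_ w _] := r; move: w; rewrite wf_tangle_of labels_cat => /andP[uS pS].
have [uS1 dS uS0] : [/\ uniq (labels S1), ~~ has (mem (labels S1)) (labels S0) & uniq (labels S0)].
  by apply/and3P; rewrite -cat_uniq.
have eL : map k (labels S1) = map l (labels L1) by rewrite -!labels_relabel e1.
have sz : size (labels L1) = size (labels S1) by rewrite -(size_map l) -eL size_map.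
pose g := transport (labels L1) (labels S1).
pose h := transport (labels S1) (labels L1).
have mg : map g (labels L1) = labels S1 by exact: map_transport.
have gS : map (relabel g) L1 = S1 by apply: (@relabel_shape g l k).
have hg : {in labels L1, cancel g h}.
  move=> z hz; have iz := hz; rewrite -index_mem in iz.
  by rewrite /h /g /transport index_uniq -?sz // nth_index.
have kg : {in labels L1, forall z, k (g z) = l z}.
  by apply/eq_in_map; rewrite (map_comp k g) mg.
have gi : {in labels L1 &, injective g} by exact: transport_inj.
have gS1 z : z \in labels L1 -> g z \in labels S1 by move=> hz; rewrite -mg map_f.
have [|||es0 r0] := @represents_extract D (S1 ++ S0) es k (map_pairs g es1) tD r.
- by rewrite ends_map map_inj_in_uniq // => x y /sub hx /sub hy; apply: gi.
- by move=> z; rewrite ends_map labels_cat mem_cat => /mapP[x /sub hx ->]; rewrite gS1.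
- apply/allP => p /mapP[q hq ->] /=; have [h1 h2] := mem_ends hq.
  by rewrite !kg ?sub //; exact: (allP rl q hq).
have [_ w0 k0] := r0.
have pT : perm_eq (tangle_of (S1 ++ S0) (map_pairs g es1 ++ es0))
    (tmap g (tangle_of L1 es1) ++ tangle_of S0 es0).
  by rewrite (permPl (tangle_of_cat _ _ _ _)) -gS tangle_of_map.
pose T' := tangle_of (map (relabel g) R1 ++ S0) (map_pairs g er1 ++ es0).
have pT' : perm_eq T' (tmap g (tangle_of R1 er1) ++ tangle_of S0 es0).
  by rewrite (permPl (tangle_of_cat _ _ _ _)) tangle_of_map.
set I := filter _ _ in pn pa.
have w1 := w0; rewrite (perm_wf pT) in w1.
have w1' : wf (tmap g (tangle_of R1 er1) ++ tangle_of S0 es0).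
  apply: (@wf_drop _ _ _ (map g I)) w1; rewrite ?nodes_map ?arcs_map -map_cat; apply: perm_map.
    rewrite (permPl (nodes_tangle_of _ _)) (permPl pn) perm_cat2r perm_sym.
    exact: nodes_tangle_of.
  by rewrite !arcs_tangle_of.
have wT' : wf T' by rewrite (perm_wf pT').
(* New labels at the replaced nodes, old ones elsewhere. The remaining edges stay consistent because
   [l] and [l'] agree on the boundary. *)
pose k' z := if z \in labels S1 then l' (h z) else k z.
have subR z : z \in labels R1 -> z \in labels L1 by move=> hz; rewrite (perm_mem pn) mem_cat hz.
have k'g : {in labels L1, forall z, k' (g z) = l' z}.
  by move=> z hz; rewrite /k' gS1 // hg.
have rT' : represents E (map (relabel g) R1 ++ S0) (map_pairs g er1 ++ es0) k'.
  split=> //.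
    rewrite map_cat relabel_comp; congr (_ ++ _).
      by apply: eq_in_relabel => z /subR hz /=; rewrite k'g.
    rewrite -[RHS]e0; apply: eq_in_relabel => z hz; rewrite /k'.
    by case: ifP => // hz1; have /hasPn/(_ z hz) := dS; rewrite /= hz1.
  rewrite all_cat; apply/andP; split.
    apply/allP => p /mapP[q hq ->] /=; have [h1 h2] := mem_ends hq.
    have subr z : z \in ends er1 -> z \in labels L1.
      by move=> hz; apply: sub; rewrite (perm_mem pa) mem_cat hz.
    by rewrite !k'g ?subr //; exact: (allP rl' q hq).
  have ku z : z \in ends es0 -> k' z = k z.
    move=> hz; rewrite /k'; case: ifP => // hz1; rewrite -mg in hz1; case/mapP: hz1 => x hx ezx.
    have := bd x hx; rewrite ezx kg // hg //; case/orP=> [hxe|/eqP -> //].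
    have : uniq (ends (map_pairs g es1 ++ es0)).
      by move: w0; rewrite wf_tangle_of => /andP[u' p']; rewrite -(perm_uniq p').
    rewrite ends_cat cat_uniq => /and3P[_ /hasPn/(_ z hz)] /=.
    by rewrite ends_map ezx map_f.
  apply/allP => p hp; have [h1 h2] := mem_ends hp; rewrite !ku //.
  by move: k0; rewrite all_cat => /andP[_ /allP]; apply.
apply: (@link_intro _ _ _ _ 0 0 (tangle_of (S1 ++ S0) (map_pairs g es1 ++ es0)) T' T') => //.
- by exists (S1 ++ S0), (map_pairs g es1 ++ es0), k.
- by exists (map (relabel g) R1 ++ S0), (map_pairs g er1 ++ es0), k'.
- rewrite /=; apply: (teq_trans (teq_perm w0 pT)).
  apply: (teq_trans (certifies_teq cert w1 w1')).
  by apply: teq_perm => //; rewrite perm_sym.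
- exact: teq_refl.
Qed.

(** * Crossing changes and planar isotopies *)

Definition vswitch (v : node) : node := if v is Cross a b c d then Cross b c d a else v.

(** Over and under are exchanged at every crossing by a quarter turn of the legs: the [A]-smoothing
    of the result is the [B]-smoothing of the original. *)
Definition switch (D : code) : code := map vswitch D.

Lemma labels_switch D : perm_eq (labels (switch D)) (labels D).
Proof.
elim: D => //= v D IH; rewrite !labels_cons; apply: perm_cat IH.
by case: v => [a b c d|a b c d|a b] //=; rewrite (perm_catC [:: b; c; d] [:: a]).
Qed.

Lemma twice_switch D : each_label_twice (switch D) = each_label_twice D.
Proof.
by apply/idP/idP; apply: twice_perm; [|rewrite perm_sym]; exact: labels_switch.
Qed.

Lemma perm_labels D E : perm_eq D E -> perm_eq (labels D) (labels E).
Proof. by move=> h; apply/perm_flatten/perm_map. Qed.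

Lemma link_perm D E : each_label_twice D -> perm_eq D E -> link D E 0 0.
Proof.
move=> tD p; have tE := twice_perm (perm_labels p) tD.
have [T [S [es [l [r eT]]]]] := rep_exists tD; have [eD w hl] := r.
have [S' pS eS'] : exists2 S', perm_eq S S' & map (relabel l) S' = E.
  have v0 := Point 0 0; move: p; rewrite -eD perm_sym => /(perm_iotaP v0)[Is pI ->].
  rewrite size_map in pI; exists [seq nth v0 S i | i <- Is].
    by rewrite perm_sym -{2}(mkseq_nth v0 S); exact: perm_map.
  rewrite -map_comp; apply/eq_in_map => i; rewrite (perm_mem pI) mem_iota /= => hi.
  by rewrite (nth_map v0).
have pT : perm_eq (tangle_of S es) (tangle_of S' es).
  by rewrite perm_cat2r; apply/perm_flatten/perm_map.
apply: (@link_intro _ _ _ _ 0 0 T (tangle_of S' es) T) => //.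
- by exists S, es, l.
- by exists S', es, l; split=> //; split=> //; rewrite -(perm_wf pT).
- exact: teq_refl.
- by rewrite eT; apply/teq_sym/teq_perm.
Qed.

Lemma link_relabel f D : each_label_twice D -> each_label_twice (map (relabel f) D) ->
  link D (map (relabel f) D) 0 0.
Proof.
move=> tD tE; have [T [S [es [l [r eT]]]]] := rep_exists tD; have [eD w hl] := r.
apply: (@link_intro _ _ _ _ 0 0 T T T) => //; try exact: teq_refl.
- by exists S, es, l.
- exists S, es, (f \o l); split=> //; split=> //; first by rewrite -relabel_comp eD.
  by apply: sub_all hl => p /= /eqP ->.
Qed.

Lemma link0_trans E D F : each_label_twice E -> link D E 0 0 -> link E F 0 0 -> link D F 0 0.
Proof. exact: link_trans. Qed.

Lemma represents_neighbour D S es l a : represents D S es l -> a \in labels S ->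
  exists2 z, z \in labels S & [/\ z != a, l z = l a & (z, a) \in es \/ (a, z) \in es].
Proof.
case=> _ w /allP he; move: w; rewrite wf_tangle_of => /andP[u p] ha.
have := ha; rewrite (perm_mem p) => /flatten_mapP[[x y] hp].
have xy : x != y.
  have : uniq (ends es) by rewrite -(perm_uniq p).
  case/splitPr: hp => e1 e2; rewrite ends_cat cat_uniq /= => /and5P[_ _].
  by rewrite inE negb_or => /andP[].
have /= /eqP lxy := he _ hp; have [hx hy] := mem_ends hp.
rewrite -!(perm_mem p) /= in hx hy.
rewrite !inE /= => /orP[] /eqP ->; [exists y => //|exists x => //]; split=> //.
- by rewrite eq_sym.
- by right.
- by left.
Qed.

(** With [x] and [y] the far ends of the edges [a] and [b], the path from [x] through the point to
    [y] contracts to one arc. The condition [a != b] makes [x] and [y] distinct and different from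
    the ends at the point. *)
Lemma link_erase_point a b D (E := map (relabel (fun x => if x == b then a else x)) D) :
  a != b -> each_label_twice (Point a b :: D) -> each_label_twice E ->
  link (Point a b :: D) E 0 0.
Proof.
move=> ab tD tE; have [T [S [es [l [r _]]]]] := rep_exists tD; have [eS w _] := r.
case: S eS r w => [|[? ? ? ?|? ? ? ?|A B] S0] // [eA eB e0] r w.
have := w; rewrite wf_tangle_of labels_cons => /andP[/= uS _].
have hA : A \in labels (Point A B :: S0) by rewrite labels_cons inE eqxx.
have hB : B \in labels (Point A B :: S0) by rewrite labels_cons !inE eqxx orbT.
have [x hx [xA lx ex]] := represents_neighbour r hA.
have [y hy [yB ly ey]] := represents_neighbour r hB.
have xB : x != B by apply: contraNneq ab => e; rewrite -eA -eB -lx e.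
have yA : y != A by apply: contraNneq ab => e; rewrite -eA -eB -ly e.
have xy : x != y by apply: contraNneq ab => e; rewrite -eA -eB -lx e ly.
have AB : A != B by case/andP: uS; rewrite inE negb_or => /andP[].
have [|||es0 r0] := @represents_extract _ _ es l [:: (x, A); (B, y)] tD r.
- rewrite /= !inE !negb_or xA xB xy AB [A == y]eq_sym yA [B == y]eq_sym yB //.
- move=> z; rewrite /= !inE => /or4P[]/eqP-> //; by rewrite labels_cons !inE eqxx ?orbT.
- by rewrite /= lx ly !eqxx.
have [_ w0 /and3P[_ _ k0]] := r0.
have p0 : perm_eq (tangle_of (Point A B :: S0) ([:: (x, A); (B, y)] ++ es0))
   (tmap (nth 0 [:: x; A; B; y]) (nth ([::], [::]) rules 4).1 ++ tangle_of S0 es0).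
  apply: perm_trans (tangle_of_cat [:: Point A B] S0 [:: (x, A); (B, y)] es0) _.
  rewrite perm_cat2r; exact: (permEl (perm_catCA [:: Join A B] [:: Arc x A] [:: Arc B y])).
have w1 := w0; rewrite (perm_wf p0) in w1.
have hr : nth ([::], [::]) rules 4 \in rules by exact: mem_nth.
have e := teq_rule hr w1; have w2 := w1; rewrite (teq_wf e) in w2.
have p2 : perm_eq (tangle_of S0 ((x, y) :: es0))
   (tmap (nth 0 [:: x; A; B; y]) (nth ([::], [::]) rules 4).2 ++ tangle_of S0 es0).
  exact: (tangle_of_cat [::] S0 [:: (x, y)] es0).
pose f x := if x == b then a else x.
apply: (@link_intro _ _ _ _ 0 0 (tangle_of (Point A B :: S0) ([:: (x, A); (B, y)] ++ es0))
  (tangle_of S0 ((x, y) :: es0)) (tangle_of S0 ((x, y) :: es0))) => //.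
- by exists (Point A B :: S0), ([:: (x, A); (B, y)] ++ es0), l.
- exists S0, ((x, y) :: es0), (f \o l); split=> //; split.
  + by rewrite -relabel_comp e0.
  + by rewrite (perm_wf p2).
  + rewrite /= lx ly eA eB /f eqxx (negbTE ab) eqxx /=.
    by apply: sub_all k0 => p /eqP /= ->.
- apply: (teq_trans (teq_perm w0 p0)); apply: (teq_trans e).
  by apply: teq_perm => //; rewrite perm_sym.
- exact: teq_refl.
Qed.

Lemma isotopy_link D E : isotopy D E -> each_label_twice D -> each_label_twice E -> link D E 0 0.
Proof.
case=> {D E} [D E p|f D _|a b c d D|a b c d D|a b D|a b D ab] tD tE.
- exact: link_perm.
- exact: link_relabel.
- pose t := Template [:: Cross 0 1 2 3] [::] [:: Cross 2 3 0 1] [::].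
  apply: (@link_template t ([::], [::]) (nth 0 [:: a; b; c; d]) (nth 0 [:: a; b; c; d]) D) => //.
  by rewrite /= !eqxx.
- pose t := Template [:: Virt 0 1 2 3] [::] [:: Virt 1 2 3 0] [::].
  apply: (@link_template t ([::], [::]) (nth 0 [:: a; b; c; d]) (nth 0 [:: a; b; c; d]) D) => //.
  by rewrite /= !eqxx.
- pose t := Template [:: Point 0 1] [::] [:: Point 1 0] [::].
  apply: (@link_template t ([::], [::]) (nth 0 [:: a; b]) (nth 0 [:: a; b]) D) => //.
  by rewrite /= !eqxx.
- exact: link_erase_point.
Qed.

Lemma switch_relabel f D : switch (map (relabel f) D) = map (relabel f) (switch D).
Proof. by rewrite /switch -!map_comp; apply: eq_map; case. Qed.

Lemma isotopy_switch D E : isotopy D E -> isotopy (switch D) (switch E).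
Proof.
case=> {D E} [D E p|f D fi|a b c d D|a b c d D|a b D|a b D ab].
- by apply/iso_perm/perm_map.
- by rewrite switch_relabel; apply: iso_relabel.
- exact: iso_rot_cross.
- exact: iso_rot_virt.
- exact: iso_rot_point.
- by rewrite switch_relabel; apply: iso_erase_point.
Qed.

Lemma isotopy_links D E : isotopy D E -> each_label_twice D -> each_label_twice E ->
  link D E 0 0 /\ link (switch D) (switch E) 0 0.
Proof.
move=> h tD tE; split; first exact: isotopy_link.
by apply: isotopy_link; rewrite ?twice_switch //; apply: isotopy_switch.
Qed.

(** * Kinks and curls *)

Lemma arc_extract T x : x \in arcs T ->
  exists w T0, perm_eq T (Arc w x :: T0) \/ perm_eq T (Arc x w :: T0).
Proof.
case/flatten_mapP=> -[a b c d|a b|a b|a b] // hv; rewrite /= !inE => /orP[]/eqP->.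
- by exists b, (rem (Arc a b) T); right; exact: perm_to_rem.
- by exists a, (rem (Arc a b) T); left; exact: perm_to_rem.
Qed.

Lemma teq_arc_flip a b G : wf (Arc a b :: G) -> teq (Arc a b :: G) (Arc b a :: G).
Proof.
move=> w; apply: (@teq_rule (nth ([::], [::]) rules 0) (nth 0 [:: a; b]) G) => //.
Qed.

Lemma decorated_join_arc b c w H : wf (Join b c :: Arc w b :: H) ->
  decorated (Join b c :: Arc w b :: H) (Curl b c :: Arc w b :: H).
Proof.
set U := Join b c :: _ => wU; have [p [q /andP[f _]]] := fresh_exists [:: U].
have [[hp hq] pq] := fresh_names wU f.
have cU : c \in arcs U by rewrite wf_mem // nodes_cons !inE eqxx orbT.
exists c, p, q; split=> //.
have /andP[uU pU] := wU; have := uU; rewrite nodes_cons /= nodes_cons /=.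
rewrite inE negb_or => /and3P[/andP[bc bH] cH uH].
have wa := wf_add_curl wU cU f.
(* If the edge closes up at this point, [w] is [c] itself, and its arc end is renamed along with the
   others. *)
pose w' := update c q w.
have pa : perm_eq (add_curl U c p q)
   (tmap (nth 0 [:: w'; b; c; p]) (nth ([::], [::]) rules 4).1
      ++ (arc_map (update c q) H ++ [:: Curl p q])).
  have ub : update c q b = b by rewrite /update (negbTE bc).
  rewrite /add_curl /= -/w' ub.
  apply: perm_trans (permEl (perm_catCA [:: Join b c] [:: Arc w' b] _)) _.
  rewrite /= !perm_cons -(cat1s (Arc c p)) perm_catCA /=.
  by rewrite perm_cons.
have w1 := wa; rewrite (perm_wf pa) in w1.
have hr : nth ([::], [::]) rules 4 \in rules by exact: mem_nth.
have e := teq_rule hr w1; have w2 := w1; rewrite (teq_wf e) in w2.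
apply: (teq_trans (teq_perm wa pa)); apply: (teq_trans e); move: w2 => /= w2.
set Z := _ :: _ in w2 *.
have names_out z : z \in names U -> (z != p) * (z != q).
  by move=> hz; split; apply: contraTneq hz => ->.
have eZ : tmap (extend id p q b c) Z = Arc w b :: H ++ [:: Curl b c].
  rewrite /Z /= tmap_cat /= extend1 extend2 //; congr (Arc _ _ :: _ ++ _).
    rewrite /w' /update; case: eqP => [->|_]; first by rewrite extend2.
    by rewrite extend_out ?names_out // mem_cat arcs_cons !inE eqxx orbT.
  rewrite (tmap_arc_map (g := id) (k := id)) ?tmap_id ?arc_map_id // => z hz /=.
    by rewrite extend_out ?names_out // mem_cat nodes_cons !inE /= nodes_cons hz !orbT.
  rewrite /update; case: eqP => [->|_]; first by rewrite extend2.
  by rewrite extend_out ?names_out // mem_cat arcs_cons /= arcs_cons !inE hz !orbT.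
have pV : perm_eq (Arc w b :: H ++ [:: Curl b c]) (Curl b c :: Arc w b :: H).
  by rewrite -cat_cons perm_catC.
apply: teq_trans (_ : teq _ (tmap (extend id p q b c) Z)) _.
  apply/teq_step/ts_rename => //; apply: uniq_map_inj.
  rewrite -nodes_map -/(tmap _ _) eZ (perm_uniq (perm_nodes pV)) nodes_cons /= nodes_cons /=.
  by rewrite inE negb_or bc bH cH.
rewrite eZ; apply: teq_perm => //.
rewrite (perm_wf pV) /wf (_ : nodes _ = nodes U) // (_ : arcs _ = arcs U) //.
Qed.

Lemma decorated_join b c H : wf (Join b c :: H) -> decorated (Join b c :: H) (Curl b c :: H).
Proof.
move=> wT; have bT : b \in arcs (Join b c :: H) by rewrite wf_mem // nodes_cons inE eqxx.
have wC : wf (Curl b c :: H) by [].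
have bH : b \in arcs H by [].
have [w [H0 hw]] := arc_extract bH.
have gen v : v \in [:: Join b c; Curl b c] -> teq (v :: H) (v :: Arc w b :: H0).
  move=> hv; have wv : wf (v :: H) by move: hv; rewrite !inE => /orP[]/eqP->.
  case: hw => hw; first by apply: teq_perm; rewrite // perm_cons.
  have p1 : perm_eq (v :: H) (Arc b w :: v :: H0).
    apply: perm_trans (_ : perm_eq _ (v :: Arc b w :: H0)) _; first by rewrite perm_cons.
    exact: (permEl (perm_catCA [:: v] [:: Arc b w] H0)).
  have w1 := wv; rewrite (perm_wf p1) in w1; have e := teq_arc_flip w1.
  apply: (teq_trans (teq_perm wv p1)); apply: (teq_trans e).
  apply: teq_perm; first by rewrite -(teq_wf e).
  exact: (permEl (perm_catCA [:: Arc w b] [:: v] H0)).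
have eJ : teq (Join b c :: H) (Join b c :: Arc w b :: H0) by apply: gen; rewrite inE eqxx.
have eC : teq (Curl b c :: H) (Curl b c :: Arc w b :: H0) by apply: gen; rewrite !inE eqxx orbT.
have w1 := wT; rewrite (teq_wf eJ) in w1.
have [x [p [q [hx f h]]]] := decorated_teq (teq_sym eJ) (decorated_join_arc w1).
by exists x, p, q; split=> //; apply: teq_trans h (teq_sym eC).
Qed.

(** The curl is put at [c], next to the negative kink, which absorbs it. *)
Lemma decorated_kink a a' b c H : wf [:: Xing b a a' c, Arc a a' & H] ->
  decorated [:: Xing b a a' c, Arc a a' & H] (Join b c :: H).
Proof.
set U := [:: _, _ & _] => wU; have [p [q /andP[f _]]] := fresh_exists [:: U].
have [[hp hq] pq] := fresh_names wU f.
have cU : c \in arcs U by rewrite wf_mem // nodes_cons !inE eqxx !orbT.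
exists c, p, q; split=> //.
have /andP[uU pU] := wU; have := uU; rewrite nodes_cons /= nodes_cons /=.
rewrite !inE !negb_or => /and5P[/and4P[ba ba' bc bH] /and3P[aa' ac aH] /andP[a'c a'H] cH uH].
have wa := wf_add_curl wU cU f.
have pa : perm_eq (add_curl U c p q)
   (tmap (nth 0 [:: b; a; a'; c; p; q]) (nth ([::], [::]) rules 9).1 ++ arc_map (update c q) H).
  have ua : update c q a = a by rewrite /update (negbTE ac).
  have ua' : update c q a' = a' by rewrite /update (negbTE a'c).
  rewrite /add_curl /= ua ua' !perm_cons.
  by rewrite perm_catC.
have w1 := wa; rewrite (perm_wf pa) in w1.
have hr : nth ([::], [::]) rules 9 \in rules by exact: mem_nth.
have e := teq_rule hr w1; have w2 := w1; rewrite (teq_wf e) in w2.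
apply: (teq_trans (teq_perm wa pa)); apply: (teq_trans e); move: w2 => /= w2.
set Z := _ :: _ in w2 *.
have names_out z : z \in names U -> (z != p) * (z != q).
  by move=> hz; split; apply: contraTneq hz => ->.
have eZ : tmap (extend id p q p c) Z = Join b c :: H.
  rewrite /Z /= extend2 // extend_out ?names_out ?mem_cat ?nodes_cons ?inE ?eqxx //; congr cons.
  rewrite (tmap_arc_map (g := id) (k := id)) ?tmap_id ?arc_map_id // => z hz /=.
    by rewrite extend_out ?names_out // mem_cat nodes_cons !inE /= nodes_cons hz !orbT.
  rewrite /update; case: eqP => [->|_]; first by rewrite extend2.
  by rewrite extend_out ?names_out // mem_cat arcs_cons /= arcs_cons !inE hz !orbT.
rewrite -eZ; apply/teq_step/ts_rename => //; apply: uniq_map_inj.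
rewrite -nodes_map -/(tmap _ _) eZ nodes_cons /= inE negb_or bc bH cH //.
Qed.

(** A positive kink is already a curl, so it is the side without the crossing that needs one. *)
Lemma link_R1_left a b c D : each_label_twice (Cross a a b c :: D) ->
  each_label_twice (Point b c :: D) -> link (Cross a a b c :: D) (Point b c :: D) 0 1.
Proof.
move=> tD tE; have [T [S [es [l [r _]]]]] := rep_exists tD; have [eS w _] := r.
case: S eS r w => [|[a1 a2 b1 c1|? ? ? ?|? ?] S0] // [e1 e2 e3 e4 e0] r w.
have := w; rewrite wf_tangle_of labels_cons => /andP[/= uS _].
have [|||es0 r0] := @represents_extract _ _ es l [:: (a1, a2)] tD r.
- by case/and5P: uS; rewrite /= !inE !negb_or andbT => /and4P[].
- move=> z hz; have {hz} : z \in [:: a1; a2] := hz.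
  by rewrite labels_cons mem_cat !inE => /orP[]/eqP->; rewrite eqxx ?orbT.
- by rewrite /= e1 e2 eqxx.
have [_ w0 /andP[_ k0]] := r0.
have p0 : perm_eq (tangle_of (Cross a1 a2 b1 c1 :: S0) ([:: (a1, a2)] ++ es0))
   (tmap (nth 0 [:: a1; a2; b1; c1]) (nth ([::], [::]) rules 8).1 ++ tangle_of S0 es0).
  exact: (tangle_of_cat [:: Cross a1 a2 b1 c1] S0 [:: (a1, a2)] es0).
have w1 := w0; rewrite (perm_wf p0) in w1.
have hr : nth ([::], [::]) rules 8 \in rules by exact: mem_nth.
have e := teq_rule hr w1; have w2 := w1; rewrite (teq_wf e) in w2.
have wJ : wf (Join b1 c1 :: tangle_of S0 es0) by [].
apply: (@link_intro _ _ _ _ 0 1 (tangle_of (Cross a1 a2 b1 c1 :: S0) ([:: (a1, a2)] ++ es0))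
  (tangle_of (Point b1 c1 :: S0) es0) (Curl b1 c1 :: tangle_of S0 es0)) => //.
- by exists (Cross a1 a2 b1 c1 :: S0), ([:: (a1, a2)] ++ es0), l.
- exists (Point b1 c1 :: S0), es0, l; split=> //; split=> //.
  by rewrite /= e3 e4 e0.
- exact: teq_trans (teq_perm w0 p0) e.
- exists (Curl b1 c1 :: tangle_of S0 es0); last exact: teq_refl.
  exact: decorated_join.
Qed.

Lemma link_R1_right a b c D : each_label_twice (Cross b a a c :: D) ->
  each_label_twice (Point b c :: D) -> link (Cross b a a c :: D) (Point b c :: D) 1 0.
Proof.
move=> tD tE; have [T [S [es [l [r _]]]]] := rep_exists tD; have [eS w _] := r.
case: S eS r w => [|[b1 a1 a2 c1|? ? ? ?|? ?] S0] // [e1 e2 e3 e4 e0] r w.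
have := w; rewrite wf_tangle_of labels_cons => /andP[/= uS _].
have [|||es0 r0] := @represents_extract _ _ es l [:: (a1, a2)] tD r.
- by case/and5P: uS; rewrite /= !inE !negb_or andbT => _ /and3P[].
- move=> z hz; have {hz} : z \in [:: a1; a2] := hz.
  by rewrite labels_cons mem_cat !inE => /orP[]/eqP->; rewrite eqxx ?orbT.
- by rewrite /= e2 e3 eqxx.
have [_ w0 /andP[_ k0]] := r0.
have p0 : perm_eq (tangle_of (Cross b1 a1 a2 c1 :: S0) ([:: (a1, a2)] ++ es0))
   [:: Xing b1 a1 a2 c1, Arc a1 a2 & tangle_of S0 es0].
  exact: (tangle_of_cat [:: Cross b1 a1 a2 c1] S0 [:: (a1, a2)] es0).
have w1 := w0; rewrite (perm_wf p0) in w1.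
have wJ : wf (Join b1 c1 :: tangle_of S0 es0) by exact: decorated_wf (decorated_kink w1).
apply: (@link_intro _ _ _ _ 1 0 (tangle_of (Cross b1 a1 a2 c1 :: S0) ([:: (a1, a2)] ++ es0))
  (tangle_of (Point b1 c1 :: S0) es0) (Join b1 c1 :: tangle_of S0 es0)) => //.
- by exists (Cross b1 a1 a2 c1 :: S0), ([:: (a1, a2)] ++ es0), l.
- exists (Point b1 c1 :: S0), es0, l; split=> //; split=> //.
  by rewrite /= e1 e4 e0.
- exists (Join b1 c1 :: tangle_of S0 es0); last exact: teq_refl.
  exact: decorated_teq (teq_sym (teq_perm w0 p0)) (decorated_kink w1).
- exact: teq_refl.
Qed.

(** * The Reidemeister moves *)

Definition R2_template := Template [:: Cross 0 1 2 3; Cross 4 5 6 7] [:: (2, 4); (3, 7)]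
  [:: Point 0 6; Point 1 5] [::].

Definition R3_left_template :=
  Template [:: Cross 6 8 1 3; Cross 0 10 7 4; Cross 2 5 9 11] [:: (6, 7); (8, 9); (10, 11)]
           [:: Cross 0 2 6 8; Cross 7 5 1 10; Cross 9 11 3 4] [:: (6, 7); (8, 9); (10, 11)].

Definition R3_right_template :=
  Template [:: Cross 6 3 1 8; Cross 0 5 7 10; Cross 2 11 9 4] [:: (6, 7); (8, 9); (10, 11)]
           [:: Cross 0 8 6 2; Cross 7 10 1 4; Cross 9 5 3 11] [:: (6, 7); (8, 9); (10, 11)].

Definition switch_template (t : template) := Template
  (switch (tsource t)) (tsource_edges t) (switch (ttarget t)) (ttarget_edges t).

Lemma link_templates t c c' l l' G
    (D := map (relabel l) (tsource t) ++ G) (E := map (relabel l') (ttarget t) ++ G) :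
  template_ok t c -> template_ok (switch_template t) c' ->
  edges_respect l (tsource_edges t) -> edges_respect l' (ttarget_edges t) ->
  all (fun z => (z \in ends (tsource_edges t)) || (l z == l' z)) (labels (tsource t)) ->
  each_label_twice D -> each_label_twice E -> link D E 0 0 /\ link (switch D) (switch E) 0 0.
Proof.
move=> ok ok' h1 h2 h3 tD tE; split; first exact: link_template ok h1 h2 h3 tD tE.
rewrite /D /E /switch !map_cat -!/(switch _) !switch_relabel.
apply: (@link_template (switch_template t) c') => //=.
- by apply/allP => z; rewrite (perm_mem (labels_switch _)); exact: (allP h3).
- by rewrite -switch_relabel -map_cat -/(switch _) twice_switch.
- by rewrite -switch_relabel -map_cat -/(switch _) twice_switch.
Qed.

Lemma link_rot_cross a b c d D : each_label_twice (Cross a b c d :: D) ->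
  each_label_twice (Cross c d a b :: D) -> link (Cross a b c d :: D) (Cross c d a b :: D) 0 0.
Proof. by move=> *; apply: isotopy_link => //; exact: iso_rot_cross. Qed.

Lemma link_rot_point a b D : each_label_twice (Point a b :: D) ->
  each_label_twice (Point b a :: D) -> link (Point a b :: D) (Point b a :: D) 0 0.
Proof. by move=> *; apply: isotopy_link => //; exact: iso_rot_point. Qed.

Lemma twice_rot_cross a b c d D :
  each_label_twice (Cross a b c d :: D) -> each_label_twice (Cross c d a b :: D).
Proof.
apply: twice_perm; rewrite !labels_cons perm_cat2r; exact: (permEl (perm_catC [:: a; b] [:: c; d])).
Qed.

Lemma twice_rot_point a b D : each_label_twice (Point a b :: D) -> each_label_twice (Point b a :: D).
Proof.
apply: twice_perm; rewrite !labels_cons perm_cat2r; exact: (permEl (perm_catC [:: a] [:: b])).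
Qed.

(* A crossing change exchanges positive and negative kinks: it reverses the numbers of
   curls added by the two sides. *)
Lemma reidemeister_links D E : reidemeister D E -> each_label_twice D -> each_label_twice E ->
  exists m n, link D E m n /\ link (switch D) (switch E) n m.
Proof.
case=> {D E} [a b c D|a b c D|u0 u1 u2 o0 o1 o2 D|t0 t1 t2 t3 m0 m1 m2 m3 b0 b1 b2 b3 D
  |t0 t1 t2 t3 m0 m1 m2 m3 b0 b1 b2 b3 D] tD tE.
- exists 0, 1; split; first exact: link_R1_left.
  rewrite -twice_switch /= in tD; rewrite -twice_switch /= in tE.
  have tD' := twice_rot_cross tD; have tE' := twice_rot_point tE.
  have h1 := link_rot_cross tD tD'; have h2 := link_R1_right tD' tE'.
  exact: link_trans tD' h1 (link_trans tE' h2 (link_rot_point tE' tE)).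
- exists 1, 0; split; first exact: link_R1_right.
  rewrite -twice_switch /= in tD; rewrite -twice_switch /= in tE.
  have tE' := twice_rot_point tE.
  exact: link_trans tE' (link_R1_left tD tE') (link_rot_point tE' tE).
- exists 0, 0; pose l := nth 0 [:: u0; o0; u1; o1; u1; o2; u2; o1].
  apply: (@link_templates R2_template ([:: (5, iota 0 8)], [::])
    ([:: (5, [:: 5; 6; 7; 4; 3; 0; 1; 2])], [::]) l l D) => //.
  + by rewrite /= !eqxx.
  + by apply/allP => z _; rewrite eqxx orbT.
- exists 0, 0; pose l := nth 0 [:: b0; b3; m0; m3; t0; t3; b1; b1; m1; m1; t1; t1].
  pose l' := nth 0 [:: b0; b3; m0; m3; t0; t3; b2; b2; m2; m2; t2; t2].
  (* Switching all three crossings reverses the heights of the strands, so the switched move is an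
     instance of the rule for the other triangle. *)
  apply: (@link_templates R3_left_template ([:: (6, iota 0 12)], [::])
    ([:: (7, [:: 4; 5; 3; 2; 1; 0; 11; 10; 9; 8; 7; 6])], [::]) l l' D) => //;
  by rewrite /= !eqxx.
- exists 0, 0; pose l := nth 0 [:: b0; b3; m0; m3; t0; t3; b1; b1; m1; m1; t1; t1].
  pose l' := nth 0 [:: b0; b3; m0; m3; t0; t3; b2; b2; m2; m2; t2; t2].
  apply: (@link_templates R3_right_template ([:: (7, iota 0 12)], [::])
    ([:: (6, [:: 5; 4; 3; 2; 0; 1; 11; 10; 9; 8; 7; 6])], [::]) l l' D) => //;
  by rewrite /= !eqxx.
Qed.

(** * The detour move *)

Lemma twice_relabel f D : injective f -> each_label_twice D -> each_label_twice (map (relabel f) D).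
Proof.
move=> fi /allP h; apply/allP => x; rewrite labels_relabel => /mapP[y hy ->].
by rewrite count_map (eq_count (a2 := pred1 y)) ?h // => z; rewrite /= (inj_eq fi).
Qed.

Lemma link_merge_points a x z D : each_label_twice [:: Point x z, Point a x & D] ->
  each_label_twice (Point a z :: D) /\ link [:: Point x z, Point a x & D] (Point a z :: D) 0 0.
Proof.
move=> tD.
have pl : perm_eq (labels [:: Point x z, Point a x & D]) [:: x, x & labels (Point a z :: D)].
  rewrite !labels_cons; apply/permP => p; rewrite /=; perm_counts.
have [tE xE] := twice_drop pl tD; split=> //.
move: xE; rewrite labels_cons !inE !negb_or => /and3P[xa xz xD].
(* Erasing [Point x z] would leave the name [x] instead of [z]; exchanging the two names repairs
   this, as [x] no longer occurs. *)
pose t y := if y == x then z else if y == z then x else y.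
have ti : injective t.
  move=> y y'; rewrite /t; case: (eqVneq y x) => [->|yx]; case: (eqVneq y' x) => [->|y'x] //.
  - by case: (eqVneq y' z) => [_ e|y'z e]; [rewrite e eqxx in xz|rewrite e eqxx in y'z].
  - by case: (eqVneq y z) => [_ e|yz e]; [rewrite -e eqxx in xz|rewrite e eqxx in yz].
  - case: (eqVneq y z) => [->|yz]; case: (eqVneq y' z) => [->|y'z] // e.
      by rewrite e eqxx in y'x.
    by rewrite e eqxx in yx.
have tF := twice_relabel ti tE.
have eF : map (relabel t) (Point a z :: D) =
    map (relabel (fun y => if y == z then x else y)) (Point a x :: D).
  rewrite /= /t [a == x]eq_sym (negbTE xa) [z == x]eq_sym (negbTE xz) eqxx.
  congr cons; apply: eq_in_relabel => y hy.
  by have -> : (y == x) = false by apply: contraNF xD => /eqP <-.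
apply: (link0_trans tF); last by apply/link_sym; apply: link_relabel.
by move: tF; rewrite eF => tF; apply: link_erase_point.
Qed.

(** Both sides have the same tangle, so the empty certificate suffices. *)
Lemma link_split_virt a b c d D : each_label_twice (Virt a b c d :: D) ->
  each_label_twice [:: Point a c, Point b d & D] /\
  link (Virt a b c d :: D) [:: Point a c, Point b d & D] 0 0.
Proof.
move=> tD.
have tE : each_label_twice [:: Point a c, Point b d & D].
  apply: twice_perm tD; rewrite !labels_cons; apply/permP => p; rewrite /=; perm_counts.
split=> //; pose t := Template [:: Virt 0 1 2 3] [::] [:: Point 0 2; Point 1 3] [::].
apply: (@link_template t ([::], [::]) (nth 0 [:: a; b; c; d]) (nth 0 [:: a; b; c; d]) D) => //.
by rewrite /= !eqxx.
Qed.

Lemma link_perm_twice D E : perm_eq D E -> each_label_twice D -> each_label_twice E /\ link D E 0 0.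
Proof. by move=> p tD; split; [exact: twice_perm (perm_labels p) tD|exact: link_perm]. Qed.

(** The virtual crossings of the drawn arc are split one after another and its pieces merged, until
    the direct connection [Point a z] remains. Two arcs drawn between the same loose ends are thus
    linked through it. *)
Lemma draw_arc_link z a E D : draw_arc z a E D -> each_label_twice D ->
  each_label_twice (Point a z :: E) /\ link D (Point a z :: E) 0 0.
Proof.
have cross x b c d F : each_label_twice (Point x z :: Virt b c x d :: F) ->
    each_label_twice (Point b z :: Point c d :: F) /\
    link (Point x z :: Virt b c x d :: F) (Point b z :: Point c d :: F) 0 0.
  move=> t0.
  have [t1 l1] := link_perm_twice (permEl (perm_catC [:: Point x z] (Virt b c x d :: F))) t0.
  have [t2 l2] := link_split_virt t1.
  have p2 : perm_eq [:: Point b x, Point c d & F ++ [:: Point x z]]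
      [:: Point x z, Point b x & Point c d :: F].
    by rewrite -(cat_cons (Point c d)) -cat_cons perm_catC.
  have [t3 l3] := link_perm_twice p2 t2; have [t4 l4] := link_merge_points t3.
  by split=> //; apply: link0_trans t1 l1 (link0_trans t2 l2 (link0_trans t3 l3 l4)).
elim=> {a E D} [a D|a x D D' _ IH|a x c d D D' _ IH|a x c d D D' _ IH|a D1 D2 D' p _ IH] tD.
- by split=> //; exact: link_refl.
- have [t1 l1] := IH tD; have [t2 l2] := link_merge_points t1.
  by split=> //; exact: link0_trans t1 l1 l2.
- have [t1 l1] := IH tD; have [t2 l2] := cross _ _ _ _ _ t1.
  by split=> //; exact: link0_trans t1 l1 l2.
- have [t1 l1] := IH tD; have [t2 l2] := cross _ _ _ _ _ t1.
  have p c' d' : perm_eq [:: Point a z, Point c' d' & D] [:: Point c' d', Point a z & D].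
    exact: (permEl (perm_catCA [:: Point a z] [:: Point c' d'] D)).
  have [t3 l3] := link_perm_twice (p d c) t2; have t4 := twice_rot_point t3.
  have l4 := link_rot_point t3 t4.
  have p' := p c d; rewrite perm_sym in p'; have [t5 l5] := link_perm_twice p' t4.
  split=> //; apply: link0_trans t1 l1 (link0_trans t2 l2 (link0_trans t3 l3 (link0_trans t4 l4 l5))).
- have [t1 l1] := IH tD.
  have p' : perm_eq (Point a z :: D2) (Point a z :: D1) by rewrite perm_cons perm_sym.
  have [t2 l2] := link_perm_twice p' t1; split=> //; exact: link0_trans t1 l1 l2.
Qed.

Lemma draw_arc_switch z a E D : draw_arc z a E D -> draw_arc z a (switch E) (switch D).
Proof.
elim=> {a E D} [a D|a x D D' _ IH|a x c d D D' _ IH|a x c d D D' _ IH|a D1 D2 D' p _ IH].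
- exact: arc_stop.
- exact: arc_point IH.
- exact: arc_cross IH.
- exact: arc_cross_rev IH.
- by apply: arc_perm IH; apply: perm_map.
Qed.

Lemma detour_link D D' : detour D D' -> each_label_twice D -> each_label_twice D' -> link D D' 0 0.
Proof.
case=> a [z [E [h h']]] t t'; have [t1 l1] := draw_arc_link h t; have [_ l2] := draw_arc_link h' t'.
exact: link0_trans t1 l1 (link_sym l2).
Qed.

Lemma move_links (D E : vdiagram) : move D E ->
  exists m n, link D E m n /\ link (switch D) (switch E) n m.
Proof.
have tD := vcode_wf D; have tE := vcode_wf E; case=> [h|h|h].
- by exists 0, 0; exact: isotopy_links.
- exact: reidemeister_links.
- exists 0, 0; split; first exact: detour_link.
  apply: detour_link; rewrite ?twice_switch //; case: h => a [z [F [h1 h2]]].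
  by exists a, z, (switch F); split; apply: draw_arc_switch.
Qed.

Lemma equivalent_links (D E : vdiagram) : equivalent D E ->
  exists m n, link D E m n /\ link (switch D) (switch E) n m.
Proof.
elim=> {D E} [D E|D|D E _ [m [n [h1 h2]]]|D E F _ [m [n [h1 h2]]] _ [m' [n' [h1' h2']]]].
- exact: move_links.
- exists 0, 0; split; apply: link_refl; rewrite ?twice_switch; exact: vcode_wf.
- by exists n, m; split; exact: link_sym.
- exists (m + m'), (n + n'); split; first exact: link_trans (vcode_wf E) h1 h1'.
  apply: link_trans h2 h2'; rewrite twice_switch; exact: vcode_wf.
Qed.

(** * Adequacy of good diagrams *)

Section GoodAdequate.
Variables (D : vdiagram) (s : smoothing) (S : code) (es : seq (nat * nat)) (l : nat -> nat).
Hypothesis eS : map (relabel l) S = vcode D.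
Hypothesis uS : uniq (labels S).
Hypothesis pS : perm_eq (labels S) (ends es).
Hypothesis hl : all (fun p => l p.1 == l p.2) es.

Let v0 := Point 0 0.
Let vertex_of (x : dart D) : node := nth v0 S (tag x).
(** A bijection from the darts of [D] onto the ends of [S]; it carries goodness and the cell
    orientations, stated on darts, over to names. *)
Let name (x : dart D) : nat := nth 0 (legs (vertex_of x)) (tagged x).

Let size_S : size S = size (vcode D).
Proof. by rewrite -eS size_map. Qed.

Let node_atE (i : 'I_(size (vcode D))) : node_at i = relabel l (nth v0 S i).
Proof.
rewrite /node_at (tnth_nth v0); case: i => k hk /=; rewrite -size_S in hk.
by rewrite -eS (nth_map v0).
Qed.

Let dnodeE x : dnode x = relabel l (vertex_of x).
Proof. exact: node_atE. Qed.

Let size_legs_at (i : 'I_(size (vcode D))) : size (legs (node_at i)) = size (legs (nth v0 S i)).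
Proof. by rewrite node_atE; case: (nth v0 S i). Qed.

Let legs_relabel v : legs (relabel l v) = map l (legs v).
Proof. by case: v. Qed.

Let tagged_lt (x : dart D) : tagged x < size (legs (vertex_of x)).
Proof. by rewrite /vertex_of -size_legs_at. Qed.

Let dlabelE x : dlabel x = l (name x).
Proof. by rewrite /dlabel dnodeE legs_relabel (nth_map 0). Qed.

Let dart_eq (x y : dart D) : tag x = tag y :> nat -> tagged x = tagged y :> nat -> x = y.
Proof.
case: x => i k; case: y => j m /= /val_inj e; case: _ / e m => m /val_inj ->.
by [].
Qed.

Let dart_at i k : i < size S -> k < size (legs (nth v0 S i)) ->
  exists x : dart D, tag x = i :> nat /\ tagged x = k :> nat.
Proof.
move=> hi hk; have hi' : i < size (vcode D) by rewrite -eS size_map.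
have hk' : k < size (legs (node_at (Ordinal hi'))) by rewrite size_legs_at.
by exists (Tagged (fun i => 'I_(size (legs (node_at i)))) (Ordinal hk')).
Qed.

Let name_mem x : name x \in labels S.
Proof.
apply/flatten_mapP; exists (vertex_of x); last exact: mem_nth.
by apply: mem_nth; rewrite size_S ltn_ord.
Qed.

Let name_surj n : n \in labels S -> exists x, name x = n.
Proof.
case/flatten_mapP=> v /(nthP v0)[i hi <-] /(nthP 0)[k hk <-].
by have [x [e1 e2]] := dart_at hi hk; exists x; rewrite /name /vertex_of e1 e2.
Qed.

Lemma flatten_nth_inj (T : eqType) (f : node -> seq T) (t : T) V i j k m : uniq (flatten (map f V)) ->
  i < size V -> j < size V -> k < size (f (nth v0 V i)) -> m < size (f (nth v0 V j)) ->
  nth t (f (nth v0 V i)) k = nth t (f (nth v0 V j)) m -> i = j /\ k = m.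
Proof.
elim: V i j => //= v V IH i j; rewrite cat_uniq => /and3P[u1 /hasPn dis u2].
have cross i' k' m' : i' < size V -> k' < size (f (nth v0 V i')) -> m' < size (f v) ->
    nth t (f (nth v0 V i')) k' <> nth t (f v) m'.
  move=> hi hk hm e; have h : nth t (f (nth v0 V i')) k' \in flatten (map f V).
    by apply/flatten_mapP; exists (nth v0 V i'); rewrite ?mem_nth.
  by have := dis _ h; rewrite /= e mem_nth.
case: i => [|i]; case: j => [|j] //= hi hj hk hm e.
- by split=> //; apply/eqP; rewrite -(nth_uniq t hk hm u1) e.
- by case: (cross j m k) => //; rewrite e.
- by case: (cross i k m).
- by have [-> ->] := IH i j u2 hi hj hk hm e.
Qed.

Let name_inj : injective name.
Proof.
move=> x y e; have lt (z : dart D) : tag z < size S by rewrite size_S ltn_ord.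
have [] := @flatten_nth_inj _ legs 0 S (tag x) (tag y) (tagged x) (tagged y) uS => //.
exact: dart_eq.
Qed.

Let rS : represents D S es l.
Proof. by split=> //; rewrite wf_tangle_of uS pS. Qed.

Let edge_unique (x y : dart D) : y != x -> dlabel y = dlabel x -> edge x = y.
Proof.
move=> yx e; rewrite /edge; case: pickP => [z /andP[zx /eqP ez]|/(_ y)]; last first.
  by rewrite yx e eqxx.
rewrite !dlabelE in e ez; apply: name_inj.
apply: (@same_label l (labels S) (name x)) => //.
- rewrite -labels_relabel eS; apply: twice_count; first exact: vcode_wf.
  by rewrite -eS labels_relabel map_f.
- by rewrite (inj_eq name_inj) eq_sym.
- by rewrite (inj_eq name_inj) eq_sym.
Qed.

Let edge_involutive : involutive (@edge D).
Proof.
move=> x; have [n hn [nx ln _]] := represents_neighbour rS (name_mem x).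
have [y ey] := name_surj hn; rewrite -ey (inj_eq name_inj) in nx; rewrite -ey in ln.
have -> : edge x = y by apply: edge_unique; rewrite ?dlabelE.
by apply: edge_unique; rewrite ?dlabelE // eq_sym.
Qed.

(** [smooth] on plain numbers, with [ordS] and [ord_pred] unfolded to arithmetic modulo the number
    of legs; the dependent type of the legs is avoided. *)
Definition smooth_index (v : node) (k : nat) : nat :=
  match v, s with
  | Cross _ _ _ _, Asm => if odd k then (k + 4).-1 %% 4 else k.+1 %% 4
  | Cross _ _ _ _, Bsm => if odd k then k.+1 %% 4 else (k + 4).-1 %% 4
  | Virt _ _ _ _, _ => (k.+1 %% 4).+1 %% 4
  | Point _ _, _ => k.+1 %% 2
  end.

Let smooth_tag (x : dart D) : tag (smooth s x) = tag x. Proof. by []. Qed.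

Let smooth_tagged (x : dart D) : tagged (smooth s x) = smooth_index (vertex_of x) (tagged x) :> nat.
Proof.
have sz : size (legs (node_at (tag x))) = size (legs (vertex_of x)) by rewrite size_legs_at.
have := dnodeE x; rewrite /smooth /smooth_index; case: (vertex_of x) sz => [a b c d|a b c d|a b] sz ->.
- by case: s => /=; case: ifP => _ /=; move: (nat_of_ord (tagged x)) => k; rewrite sz.
- by case: s => /=; move: (nat_of_ord (tagged x)) => k; rewrite sz.
- by case: s => /=; move: (nat_of_ord (tagged x)) => k; rewrite sz.
Qed.

Let smooth_involutive : involutive (@smooth s D).
Proof.
move=> x; apply: dart_eq => //; rewrite !smooth_tagged.
have -> : vertex_of (smooth s x) = vertex_of x by [].
have := tagged_lt x; rewrite /smooth_index; case: (vertex_of x) => [a b c d|a b c d|a b] /=;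
  by case: s; move: (nat_of_ord (tagged x)) => [|[|[|[|k]]]].
Qed.

Let circle_sym : connect_sym (@state_adj s D).
Proof.
apply: sym_connect_sym => x y.
have h (f : dart D -> dart D) : involutive f -> (y == f x) = (x == f y).
  by move=> fK; apply/eqP/eqP => ->; rewrite fK.
by rewrite /state_adj /= (h _ edge_involutive) (h _ smooth_involutive).
Qed.

Variable orient : dart D -> bool.
Hypothesis ho : cell_orientation s orient.
Hypothesis hgood : forall x y : dart D, is_classical (dnode x) -> tag x = tag y -> y != x ->
  y != smooth s x -> ~~ same_circle s x y.

Let of_name (n : nat) : option (dart D) := [pick x | name x == n].
Let o n := if of_name n is Some x then orient x else false.
(** A circle is named by the rank of the canonical root of its component for [state_adj]. *)
Let c n : nat := if of_name n is Some x then enum_rank (fingraph.root (@state_adj s D) x) else 0.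

Let of_nameE x : of_name (name x) = Some x.
Proof.
rewrite /of_name; case: pickP => [y /eqP /name_inj -> //|/(_ x)]; by rewrite eqxx.
Qed.

Let adjacent_ok (x y : dart D) : y = edge x \/ y = smooth s x ->
  (o (name x) != o (name y)) && (c (name x) == c (name y)).
Proof.
move=> h; rewrite /o /c !of_nameE; apply/andP; split.
  by have [h1 h2] := ho x; case: h => ->; rewrite ?h1 ?h2; case: (orient x).
rewrite (inj_eq val_inj) (inj_eq enum_rank_inj) root_connect //.
by apply: connect1; rewrite /state_adj /=; case: h => ->; rewrite eqxx ?orbT.
Qed.

Let smoothed_ok i k m : i < size S -> k < size (legs (nth v0 S i)) -> smooth_index (nth v0 S i) k = m ->
  let n1 := nth 0 (legs (nth v0 S i)) k in let n2 := nth 0 (legs (nth v0 S i)) m in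
  (o n1 != o n2) && (c n1 == c n2).
Proof.
move=> hi hk <- /=; have [x [e1 e2]] := dart_at hi hk.
have -> : nth 0 (legs (nth v0 S i)) k = name x by rewrite /name /vertex_of e1 e2.
have -> : nth 0 (legs (nth v0 S i)) (smooth_index (nth v0 S i) k) = name (smooth s x).
  by rewrite /name smooth_tagged /vertex_of smooth_tag e1 e2.
by apply: adjacent_ok; right.
Qed.

Let good_ok i k m : i < size S -> k < size (legs (nth v0 S i)) -> m < size (legs (nth v0 S i)) ->
  is_classical (nth v0 S i) -> m != k -> m != smooth_index (nth v0 S i) k ->
  c (nth 0 (legs (nth v0 S i)) k) != c (nth 0 (legs (nth v0 S i)) m).
Proof.
move=> hi hk hm cl mk msk; have [x [e1 e2]] := dart_at hi hk; have [y [f1 f2]] := dart_at hi hm.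
have -> : nth 0 (legs (nth v0 S i)) k = name x by rewrite /name /vertex_of e1 e2.
have -> : nth 0 (legs (nth v0 S i)) m = name y by rewrite /name /vertex_of f1 f2.
rewrite /c !of_nameE (inj_eq val_inj) (inj_eq enum_rank_inj) root_connect //.
apply: hgood.
- by rewrite dnodeE /vertex_of e1; case: (nth v0 S i) cl.
- by apply: val_inj; rewrite /= e1 f1.
- by apply: contraNneq mk => e; rewrite -e2 -f2 e.
- by apply: contraNneq msk => e; rewrite -f2 e smooth_tagged /vertex_of e1 e2.
Qed.

(** The orientation of the cells and the components of the state are the two witnesses. Goodness,
    applied to the first legs of the two smoothing arcs at a crossing, gives the separation. For the
    [B]-state the diagram is switched. *)
Lemma good_adequate : adequate (tangle_of (if s is Asm then S else switch S) es).
Proof.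
exists o, c; rewrite all_cat; apply/andP; split; last first.
  apply/allP => v /mapP[p hp ->]; rewrite /vadequate /= !andbT.
  have [h1 h2] := mem_ends hp; rewrite -!(perm_mem pS) in h1 h2.
  have [x ex] := name_surj h1; have [y ey] := name_surj h2; rewrite -ex -ey.
  apply: adjacent_ok; left; apply/esym/edge_unique.
    apply/negP => /eqP exy; move: uS; rewrite (perm_uniq pS).
    case/splitPr: hp => s1 s2; rewrite ends_cat cat_uniq => /and3P[_ _].
    have -> : ends (p :: s2) = [:: p.1; p.2] ++ ends s2 by [].
    by rewrite cat_uniq /= inE -ex -ey exy eqxx.
  by rewrite !dlabelE ex ey; apply/eqP; rewrite eq_sym; exact: (allP hl p hp).
have ok v : v \in S -> all (vadequate o c) (vtr (if s is Asm then v else vswitch v)).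
  move=> /(nthP v0)[i hi ev].
  have sm k m : k < size (legs v) -> smooth_index v k = m ->
      (o (nth 0 (legs v) k) != o (nth 0 (legs v) m)) && (c (nth 0 (legs v) k) == c (nth 0 (legs v) m)).
    by rewrite -ev => h1 h2; apply: smoothed_ok.
  have gd k m : k < size (legs v) -> m < size (legs v) -> is_classical v -> m != k ->
      m != smooth_index v k -> c (nth 0 (legs v) k) != c (nth 0 (legs v) m).
    by rewrite -ev; exact: good_ok.
  move: sm gd; rewrite /smooth_index; case: v {ev} => [a b x d|a b x d|a b] sm gd.
  - move: sm gd; case: s => sm gd; rewrite /vadequate /= ?andbT.
      by rewrite (sm 0 1) // (sm 2 3) // (gd 0 2).
    by rewrite (sm 1 2) // (sm 3 0) // (gd 1 3).
  - have -> : (if s is Asm then Virt a b x d else vswitch (Virt a b x d)) = Virt a b x d by case: (s).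
    by rewrite /vadequate /= !andbT (sm 0 2) // (sm 1 3).
  - have -> : (if s is Asm then Point a b else vswitch (Point a b)) = Point a b by case: (s).
    by rewrite /vadequate /= !andbT (sm 0 1).
apply/allP => w /flatten_mapP[v]; case: (s) ok => ok.
  by move=> /ok/allP; apply.
by case/mapP=> u /ok/allP h -> /h.
Qed.

End GoodAdequate.

(** * Comparison of crossing numbers *)

Lemma xings_tangle_of S es : xings (tangle_of S es) = count is_classical S.
Proof.
rewrite /xings count_cat (_ : count _ (arcs_of es) = 0) ?addn0; last by elim: es.
by elim: S => //= v S IH; rewrite /tr /= -/(tr S) count_cat IH; case: v.
Qed.

Lemma curls_tangle_of S es : curls (tangle_of S es) = 0.
Proof.
rewrite /curls count_cat (_ : count _ (arcs_of es) = 0) ?addn0; last by elim: es.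
by elim: S => //= v S IH; rewrite /tr /= -/(tr S) count_cat IH; case: v.
Qed.

Lemma xings_rep D T : rep D T -> xings T = count is_classical D /\ curls T = 0.
Proof.
case=> S [es [l [[eS _ _] ->]]]; rewrite xings_tangle_of curls_tangle_of -eS count_map.
by split=> //; apply: eq_count; case.
Qed.

Lemma classical_switch D : count is_classical (switch D) = count is_classical D.
Proof. by rewrite count_map; apply: eq_count; case. Qed.

Lemma represents_switch D S es l : represents D S es l -> represents (switch D) (switch S) es l.
Proof.
case=> eS w hl; split=> //; first by rewrite -switch_relabel eS.
move: w; rewrite !wf_tangle_of (perm_uniq (labels_switch S)) => /andP[-> h].
by rewrite (permPl (labels_switch S)).
Qed.

(** With [i] curls on [D] and [j] on [E], the minimality of [x + f] at an adequate tangle bounds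
    [count is_classical D + i] by [count is_classical E + j], and [i - j = m - n]. *)
Lemma link_crossing_bound D E T m n : rep D T -> adequate T -> each_label_twice E -> link D E m n ->
  count is_classical D + m <= count is_classical E + n.
Proof.
move=> rT ad tE h; have [T' rT'] := rep_exists tE; have [i [j [V [e d d']]]] := h _ _ rT rT'.
have [T1 [w1 e1 x1 c1 a1]] := decorations_undecorated (rep_wf rT) d.
have [U1 [_ e2 x2 c2 _]] := decorations_undecorated (rep_wf rT') d'.
have := adequate_crossing_bound w1 (a1 ad) (teq_trans e1 (teq_sym e2)).
have [xT cT] := xings_rep rT; have [xT' cT'] := xings_rep rT'.
by rewrite x1 x2 c1 c2 xT xT' cT cT' !add0n; lia.
Qed.

Theorem theorem4 (L : vdiagram) (n : nat) :
  orientable L -> good L -> crossings L = n ->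
  (forall D : vdiagram, equivalent L D -> orientable D -> ~ split_diagram D) ->
  forall L' : vdiagram, equivalent L L' -> orientable L' ->
  n - 2 <= crossings L'.
Proof.
move=> [oA [oB [hA hB _]]] gd <- _ L' e _.
have tL := vcode_wf L; have tL' := vcode_wf L'.
have [T [S [es [l [r _]]]]] := rep_exists tL; have [eS w hl] := r.
move: w; rewrite wf_tangle_of => /andP[uS pS].
have [p [q [h1 h2]]] := equivalent_links e.
have b1 : crossings L + p <= crossings L' + q.
  apply: (link_crossing_bound (T := tangle_of S es)) h1 => //; first by exists S, es, l.
  exact: (good_adequate eS uS pS hl hA (gd Asm)).
(* The same bound for the [B]-state: switching has exchanged [p] and [q], which cancel in the sum
   with [b1]. *)
have b2 : crossings L + q <= crossings L' + p.
  rewrite /crossings -(classical_switch L) -(classical_switch L').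
  apply: (link_crossing_bound (T := tangle_of (switch S) es)) h2; rewrite ?twice_switch //.
    by exists (switch S), es, l; split=> //; exact: represents_switch.
  exact: (good_adequate eS uS pS hl hB (gd Bsm)).
by lia.
Qed.
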